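(* Fix $n\ge1$. Let $X_1,\ldots,X_n$ be continuous random variables. Suppose that the characteristic functions of $X_1,\ldots,X_n$ are holonomic, or that $X_1,\ldots,X_n$ have holonomic densities. Then $$\mathrm{PSO}(X_1)\cap\cdots\cap\mathrm{PSO}(X_n)\neq\{0\}.$$
   Context: For $\mathbb{K}\in\{\mathbb{R},\mathbb{C}\}$, $A_1(\mathbb{K})$ is the first Weyl algebra: the ring of linear differential operators $\sum_{t=0}^T p_t\partial^t$ with polynomial coefficients $p_t\in\mathbb{K}[x]$, $\partial=\frac{d}{dx}$, with composition as multiplication. Polynomial Stein operators. All random variables are real-valued. For a continuous random variable $X$ and a class $\mathcal{F}$ of functions, an operator $S=\sum_{t=0}^{T}p_t\partial^t$ ($T\ge1$, $p_t\in\mathbb{R}[x]$) is a polynomial Stein operator for $X$ if $Sf\in L^1(X)$ (i.e. $\mathbb{E}|Sf(X)|<\infty$) and $\mathbb{E}[Sf(X)]=0$ for all $f\in\mathcal{F}$; $\mathrm{PSO}_{\mathcal{F}}(X)$ is the set of all of them (it contains $0$), and $\mathrm{PSO}(X)$ is shorthand for $\mathrm{PSO}_{\mathcal{F}}(X)$. Convention: $\mathcal{F}$ is the Schwartz class $\mathcal{S}(\mathbb{R})$; when all moments of the target random variables exist, the results are also asserted for $\mathcal{F}=\mathbb{R}[x]$, for $\mathcal{F}=P(\mathbb{R})=\{f\in C^\infty(\mathbb{R}):\sup_{x}|(1+x^\alpha)^{-1}\partial^\beta f(x)|<\infty$ for all $\beta\in\mathbb{N}_0$ and some $\alpha\ge1\}$,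 and for the operator-dependent class of all $f\in C^T(I)$ ($I$ the support of $X$) with $\mathbb{E}|X^jf^{(t)}(X)|<\infty$ for $0\le j\le \max_t\deg p_t$, $0\le t\le T$. Holonomic functions. A function $f:\mathrm{Dom}(f)\subseteq\mathbb{K}\to\mathbb{K}$ is holonomic if there is a nonzero $L\in A_1(\mathbb{K})$ with $Lf=0$; equivalently, if the functions $\partial^tf$, $t=0,1,2,\ldots$, span a finite-dimensional vector space over the field $\mathbb{K}(x)$ of rational functions. A characteristic function $\varphi_X(t)=\mathbb{E}[e^{\mathrm{i}tX}]$, $t\in\mathbb{R}$, is considered with $\mathbb{K}=\mathbb{C}$, and a density with $\mathbb{K}=\mathbb{R}$. *)

(* Defs.v *)
From HB Require Import structures.
From mathcomp Require Import all_boot all_order all_algebra.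
From mathcomp Require Import complex.
From mathcomp Require Import all_classical all_reals all_analysis.

Set Implicit Arguments.
Unset Strict Implicit.
Unset Printing Implicit Defensive.

Import Order.TTheory GRing.Theory Num.Theory.
Import numFieldNormedType.Exports.

Local Open Scope classical_set_scope.
Local Open Scope ring_scope.

(* The element p_0 + p_1 d + ... + p_T d^T of the first Weyl algebra A_1(K) is
   encoded by its (unique) normal form, the sequence of the p_t : {poly K}.
   Only the underlying additive group of {poly {poly K}} is meaningful here:
   the commutative product of {poly {poly K}} is not composition. *)
Definition diffop (K : numFieldType) := {poly {poly K}}.

Definition order (K : numFieldType) (L : diffop K) : nat := (size L).-1.

Definition coef_deg (K : numFieldType) (L : diffop K) : nat :=
  (\max_(t < size L) (size (L`_t)%R).-1)%N.

(* Derivatives of a function whose domain is D: the difference quotients are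
   taken inside D only, so the values of f outside D are irrelevant (one-sided
   derivatives at end points of an interval of R, derivatives along the real
   line when D is the real line of C). *)
Definition diffquot (K : numFieldType) (D : set K) (f : K -> K) (x : K) :
    set_system K :=
  (fun y => (y - x)^-1 * (f y - f x)) @ within D x^'.

Definition deriv_in (K : numFieldType) (D : set K) (f : K -> K) : K -> K :=
  fun x => lim (diffquot D f x).

Definition derivn_in (K : numFieldType) (D : set K) (t : nat) (f : K -> K) :
    K -> K :=
  iter t (deriv_in D) f.

Definition derivable_in (K : numFieldType) (D : set K) (T : nat) (f : K -> K) :
    Prop :=
  forall (t : nat) (x : K), (t < T)%N -> D x ->
    cvg (diffquot D (derivn_in D t f) x).

Definition op_apply (K : numFieldType) (D : set K) (L : diffop K)
    (f : K -> K) : K -> K :=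
  fun x => \sum_(t < size L) (L`_t).[x] * derivn_in D t f x.

(* Holonomicity is insensitive to a finite exceptional set Z: this is what
   linear dependence over K(x) of the derivatives of f means, and it is needed
   for x^(a-1) e^(-x) 1_(x > 0) or e^(-|x|) to be holonomic on R. *)
Definition holonomic (K : numFieldType) (D : set K) (f : K -> K) : Prop :=
  exists (Z : set K) (L : diffop K),
    [/\ finite_set Z,
        L != 0,
        derivable_in (D `\` Z) (order L) f &
        forall x, (D `\` Z) x -> op_apply (D `\` Z) L f x = 0].

Section RandomVariable.
Context {d : measure_display} {Om : measurableType d} {R : realType}.
Variables (P : probability Om R) (X : {RV P >-> R}).

Definition is_density (p : R -> R) : Prop :=
  [/\ measurable_fun setT p,
      forall x, 0 <= p x &
      forall A : set R, measurable A ->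
        distribution P X A = (\int[lebesgue_measure]_(x in A) (p x)%:E)%E].

Definition continuous_RV : Prop := exists p : R -> R, is_density p.

Definition holonomic_density : Prop :=
  exists p : R -> R, is_density p /\ holonomic setT p.

Definition charfun (t : R) : R[i] :=
  Complex (fine ('E_P[fun w => cos (t * X w)])%E)
          (fine ('E_P[fun w => sin (t * X w)])%E).

(* K = C, with the real line of C as domain. *)
Definition holonomic_charfun : Prop :=
  holonomic [set z : R[i] | complex.Im z = 0]
            (fun z : R[i] => charfun (complex.Re z)).

Definition all_moments : Prop :=
  forall k : nat, P.-integrable setT (EFin \o (fun w => X w ^+ k)).

Definition RV_support : set R :=
  [set x | forall e : R, 0 < e -> (0 < P (X @^-1` ball x e))%E].

(* The functions of F have domain I, with P (X \in I) = 1, and F may depend on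
   the operator. Requiring p_T <> 0 in the condition T >= 1 loses nothing: for
   a continuous X, no nonzero polynomial p_0 is a Stein operator. *)
Definition PSO_on (I : set R) (F : diffop R -> set (R -> R)) :
    set (diffop R) :=
  [set S | (S = 0 \/ (1 <= order S)%N) /\
     forall f, F S f ->
       let Sf := op_apply I S f \_ I in
       P.-integrable setT (EFin \o (Sf \o X)) /\ ('E_P[Sf \o X] = 0)%E].

Definition PSO (F : set (R -> R)) : set (diffop R) := PSO_on setT (fun=> F).

(* C^T(I) with I the support of X and E |X^j f^(t)(X)| finite. *)
Definition adapted_class (S : diffop R) : set (R -> R) :=
  [set f | let I := RV_support in let T := order S in
     [/\ derivable_in I T f,
         forall t, (t <= T)%N -> {within I, continuous (derivn_in I t f)} &
         forall j t, (j <= coef_deg S)%N -> (t <= T)%N ->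
           P.-integrable setT
             (EFin \o (((fun x => x ^+ j * derivn_in I t f x) \_ I) \o X))]].

Definition PSO_adapted : set (diffop R) := PSO_on RV_support adapted_class.

End RandomVariable.

Section FunctionClasses.
Variable R : realType.

Definition smooth (f : R -> R) : Prop :=
  forall (n : nat) (x : R), derivable (derive1n n f) x 1.

Definition schwartz : set (R -> R) :=
  [set f | smooth f /\
     forall a b : nat, exists M : R, forall x, `|x ^+ a * derive1n b f x| <= M].

(* |x|^a instead of x^a in the weight, which makes it positive for odd a and
   does not change the class. *)
Definition poly_growth : set (R -> R) :=
  [set f | smooth f /\
     forall b : nat, exists2 a : nat, (1 <= a)%N &
       exists M : R, forall x, `|(1 + `|x| ^+ a)^-1 * derive1n b f x| <= M].

Definition poly_funs : set (R -> R) :=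
  range (fun (p : {poly R}) (x : R) => p.[x]).

End FunctionClasses.

Lemma deriv_in_nbhs (R : realType) (D : set R) (f : R -> R) (x : R) :
  nbhs x D -> deriv_in D f x = derive1 f x.
Proof.
move=> xD; rewrite /deriv_in /diffquot /derive1; congr (lim _).
have -> : within D x^' = x^'.
  rewrite eqEsubset; split=> A; rewrite /within /dnbhs /within /=.
    by apply: filterS2 xD => y Dy + yx; apply.
  by apply: filterS => y Ay yx _; exact: Ay.
have e : x^' = (fun h : R => h + x) @ 0^'.
  rewrite eqEsubset; split=> A; rewrite /fmap /dnbhs /within /= => H.
    have {}H : \forall y \near x, y != x -> A y by exact: H.
    rewrite (near_shift 0) subr0 in H.
    move: H; apply: filterS => h /= Ah h0; apply: Ah.
    by rewrite -subr_eq0 addrK.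
  have {}H : \forall h \near (0 : R), h != 0 -> A (h + x) by exact: H.
  rewrite (near_shift x) sub0r in H.
  move: H; apply: filterS => y /= Ay yx; rewrite -(subrK x y); apply: Ay.
  by rewrite subr_eq0.
rewrite e -fmap_comp.
by under [X in X @ _]funext => h do rewrite /= addrK.
Qed.

Lemma derivn_in_setT (R : realType) (f : R -> R) (n : nat) :
  derivn_in setT n f = derive1n n f.
Proof.
rewrite /derivn_in; elim: n => //= n ->.
by apply/funext => x; rewrite deriv_in_nbhs ?derive1nS//; exact: filterT.
Qed.

(* Main.v *)
(* Call a function p rational when p = (B . w) / q for a solution w of a linear
   system w' = (A w) / q, with polynomials in A, B, q, off the zeros of q.
   Holonomic functions are rational. The derivatives of finitely many rational
   functions lie in a finite-dimensional space over the field of rational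
   functions, hence have a common annihilator L off the zeros of some Q. When
   the p_i are densities, the formal adjoint of Q^(2N) L is a common Stein
   operator: cutting off near the zeros of Q and at infinity, the integrations
   by parts leave no boundary term in the limit.
   A holonomic characteristic function is rational too, and so are its real and
   imaginary parts. The same integration by parts, tested against the functions
   exp (- (s t)^2) cos (t y) and exp (- (s t)^2) sin (t y) of t, is a linear
   differential equation in y with polynomial coefficients for the Gaussian
   smoothing of the distribution function F. Integrated often enough, it passes
   to the limit s = 0 and becomes a Volterra equation for F. So F is rational,
   hence so is some density, its derivative, which reduces to the first case. *)

Require Import Defs.
From HB Require Import structures.
From mathcomp Require Import all_boot all_order all_algebra.
From mathcomp Require Import complex qpoly.
From mathcomp Require Import all_classical all_reals all_analysis.
From mathcomp Require Import measurable_realfun.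
From mathcomp Require Import ring lra zify.
(* Required again for [order] to be the order of a differential operator. *)
Require Import Defs.

Set Implicit Arguments.
Unset Strict Implicit.
Unset Printing Implicit Defensive.

Import Order.TTheory GRing.Theory Num.Theory.
Import numFieldNormedType.Exports.

Local Open Scope classical_set_scope.
Local Open Scope ring_scope.

(** * Derivatives and rational systems *)

(** Nothing is known of the derivatives of p near the zeros of Q or at infinity, and the adapted
    class grants only the moments of x^a f^(j) with a <= [coef_deg S]. Hence the cutoff is a power
    of the positive part of Q^2 - e (x^2 + 1)^K. It vanishes near every zero of Q and outside a
    bounded set, and its growth, uniformly in e, is of the degree of Q^(2N). All derivatives are
    moved off p while e > 0, so that the limit needs no more than the moments granted. For
    characteristic functions the limit s = 0 meets two obstacles. The integrations produce
    polynomials of bounded degree over whose coefficients there is no control; but a pointwise limit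
    of such polynomials is again one. And the limit equation must not be trivial: the integral of
    t^a exp (- (s t)^2) against the n-th derivative of cos at t z vanishes for odd n + a, so the
    leading coefficient survives only if the maximal degree of the coefficients of L has the parity
    of an index where it is attained. *)

Lemma linear_dependence (D : idomainType) (I : finType) (v : nat -> I -> D) :
  exists2 c : nat -> D, (exists2 t, (t <= #|I|)%N & c t != 0) &
    forall i, \sum_(t < #|I|.+1) c t * v t i = 0.
Proof.
set N := #|I|.
(* A zero column is added to make the matrix square and singular; [det0P] then yields a dependence
   over D itself, without denominators to clear. *)
pose A : 'M[D]_(N.+1) := \matrix_(t, j)
  (if unlift ord_max j is Some i then v t (enum_val i) else 0).
have : \det A = 0.
  rewrite (expand_det_col _ ord_max) big1// => t _.
  by rewrite mxE unlift_none mul0r.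
move=> /eqP/det0P[u u0 uA].
have /rV0Pn [t ut] := u0.
exists (fun k => u ord0 (inord k)).
  by exists t; rewrite ?inord_val// -ltnS ltn_ord.
move=> i; have /matrixP/(_ ord0 (lift ord_max (enum_rank i))) := uA.
rewrite [RHS]mxE => uAi; rewrite -[RHS]uAi mxE; apply: eq_bigr => k _.
by rewrite inord_val mxE liftK enum_rankK.
Qed.

Section DerivativeRules.
Variable R : realType.
Implicit Types (f g : R -> R) (x : R).

Lemma is_derive1D f g x a b : is_derive x 1 f a -> is_derive x 1 g b ->
  is_derive x 1 (fun y => f y + g y) (a + b).
Proof. by move=> fa gb; exact: is_deriveD. Qed.

Lemma is_derive1M f g x a b : is_derive x 1 f a -> is_derive x 1 g b ->
  is_derive x 1 (fun y => f y * g y) (a * g x + f x * b).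
Proof.
move=> fa gb; apply: (@is_derive_eq _ _ _ _ _ _ _ _ (is_deriveM fa gb)).
by rewrite /GRing.scale/= addrC mulrC.
Qed.

Lemma is_derive1Z f (c : R) x a : is_derive x 1 f a ->
  is_derive x 1 (fun y => c * f y) (c * a).
Proof. by move=> fa; exact: is_deriveZ. Qed.

Lemma is_derive1_sum (I : Type) (s : seq I) (P : pred I) (f : I -> R -> R) x (a : I ->
  R) :
  (forall i, P i -> is_derive x 1 (f i) (a i)) ->
  is_derive x 1 (fun y => \sum_(i <- s | P i) f i y) (\sum_(i <- s | P i) a i).
Proof.
move=> fa; elim: s => [|i s ih].
  under eq_fun do rewrite big_nil; rewrite big_nil; exact: is_derive_cst.
under eq_fun do rewrite big_cons; rewrite big_cons.
by case: ifPn => // Pi; apply: is_derive1D => //; exact: fa.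
Qed.

Lemma is_derive_near_eq f g x a : (\forall y \near x, f y = g y) ->
  is_derive x 1 f a -> is_derive x 1 g a.
Proof.
move=> fg fa; have xfg : {near x, f =1 g} by [].
apply: DeriveDef.
  by apply: (near_eq_derivable xfg); exact: ex_derive.
by rewrite -(near_eq_derive (1 : R) xfg) derive_val.
Qed.

Lemma is_derive1E f x a : is_derive x 1 f a -> derive1 f x = a.
Proof. by move=> fa; rewrite derive1E derive_val. Qed.

Lemma is_derive1_continuous f x a : is_derive x 1 f a -> {for x, continuous f}.
Proof.
by move=> fa; apply/differentiable_continuous/derivable1_diffP; exact: ex_derive.
Qed.

Lemma is_derive_horner (q : {poly R}) x :
  is_derive x 1 (fun y : R => q.[y]) (q^`()).[x].
Proof. exact: is_derive_poly. Qed.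

End DerivativeRules.

Section RationalSystem.
Variable R : realType.
Implicit Types (p : R -> R) (q : {poly R}).

(* Off the zeros of q, p = (B . w) / q where w solves the linear system
   w' = A w / q with polynomial coefficients. *)
Definition rational_system p := exists (m : nat) (q : {poly R})
    (A : 'I_m -> 'I_m -> {poly R}) (B : 'I_m -> {poly R}) (w : 'I_m -> R -> R),
  q != 0 /\ forall x, q.[x] != 0 ->
    (forall j, is_derive x 1 (w j) ((\sum_k (A j k).[x] * w k x) / q.[x])) /\
    p x = (\sum_k (B k).[x] * w k x) / q.[x].

Lemma near_poly_neq0 q (x : R) : q.[x] != 0 -> \forall y \near x, q.[y] != 0.
Proof.
move=> qx; have c : {for x, continuous (fun y => q.[y])} by exact: continuous_horner.
exact: (cvgr_neq0 _ c qx).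
Qed.

Section Derivatives.
Variables (m : nat) (q : {poly R}) (A : 'I_m -> 'I_m -> {poly R}).
Variables (B : 'I_m -> {poly R}) (w : 'I_m -> R -> R) (p : R -> R).
Hypothesis wp : forall x, q.[x] != 0 ->
    (forall j, is_derive x 1 (w j) ((\sum_k (A j k).[x] * w k x) / q.[x])) /\
    p x = (\sum_k (B k).[x] * w k x) / q.[x].

(** Numerator of the t-th derivative of p over the denominator q^(t+1): each quotient rule costs one
    more factor q, and w' = A w / q makes the numerator linear in w again. *)
Fixpoint derivn_coef (t : nat) : 'I_m -> {poly R} :=
  if t is t'.+1 then fun k =>
    q * (derivn_coef t' k)^`() + \sum_j derivn_coef t' j * A j k
    - (q^`() * derivn_coef t' k) *+ t'.+1
  else B.

Let comb (t : nat) (x : R) := (\sum_k (derivn_coef t k).[x] * w k x) / q.[x] ^+ t.+1.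

Lemma is_derive_comb t x : q.[x] != 0 -> is_derive x 1 (comb t) (comb t.+1 x).
Proof.
move=> qx; have [dw _] := wp qx.
have qtx : (q ^+ t.+1).[x] != 0 by rewrite horner_exp expf_neq0.
have dq := is_deriveV qtx (is_derive_horner (q ^+ t.+1) x).
have dk k := is_derive1M (is_derive_horner (derivn_coef t k) x) (dw k).
have dS := is_derive1M (@is_derive1_sum _ _ (index_enum _) xpredT _ _ _ (fun k _ =>
  dk k)) dq.
have -> : comb t = fun y : R => (\sum_k (derivn_coef t k).[y] * w k y) * (fun y =>
  ((q ^+ t.+1).[y])^-1) y.
  by apply/funext => y; rewrite /comb horner_exp.
apply: (@is_derive_eq _ _ _ _ _ _ _ _ dS).
rewrite /comb /= deriv_exp /GRing.scale/= !hornerE /=.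
set S := \sum_k (derivn_coef t k).[x] * w k x.
have -> : \sum_k (q * (derivn_coef t k)^`() + \sum_j derivn_coef t j * A j k -
      (q^`() * derivn_coef t k) *+ t.+1).[x] * w k x =
   q.[x] * (\sum_k ((derivn_coef t k)^`()).[x] * w k x) +
   \sum_j (derivn_coef t j).[x] * (\sum_k (A j k).[x] * w k x)
   - q^`().[x] * S *+ t.+1.
  under eq_bigr do rewrite hornerD hornerN hornerMn hornerD !hornerM horner_sum !mulrDl.
  rewrite !big_split/=; congr (_ + _ + _).
  - by rewrite mulr_sumr; apply: eq_bigr => k _; rewrite mulrA.
  - under eq_bigr do rewrite mulr_suml.
    rewrite exchange_big/=; apply: eq_bigr => j _; rewrite mulr_sumr.
    by apply: eq_bigr => k _; rewrite hornerM mulrA.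
  - rewrite /S mulr_sumr -sumrMnl -sumrN; apply: eq_bigr => k _.
    by rewrite mulNr mulrnAl mulrA.
rewrite big_split/=.
have -> : \sum_i (derivn_coef t i).[x] * ((\sum_k (A i k).[x] * w k x) / q.[x]) =
   (\sum_i (derivn_coef t i).[x] * (\sum_k (A i k).[x] * w k x)) / q.[x].
  by rewrite mulr_suml; apply: eq_bigr => i _; rewrite mulrA.
rewrite -/S hornerMn hornerM horner_exp -(mulr_natl _ t.+1) -(mulr_natl (_ * S) t.+1).
have qt0 : q.[x] ^+ t != 0 by rewrite expf_neq0.
rewrite !exprS; move: qx qt0; move: (q.[x] ^+ t) (q.[x]) => a b a0 b0.
by field; rewrite a0 b0.
Qed.

Lemma derive1n_comb t x : q.[x] != 0 -> derive1n t p x = comb t x.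
Proof.
elim: t x => [|t ih] x qx; first by rewrite /comb expr1; case: (wp qx).
rewrite derive1nS; apply: is_derive1E; apply: is_derive_near_eq (is_derive_comb t qx).
by near=> y; rewrite ih//; near: y; exact: near_poly_neq0.
Unshelve. all: by end_near. Qed.

Lemma is_derive_derive1n t x : q.[x] != 0 ->
  is_derive x 1 (derive1n t p) (derive1n t.+1 p x).
Proof.
move=> qx; rewrite derive1n_comb//; apply: is_derive_near_eq (is_derive_comb t qx).
by near=> y; rewrite derive1n_comb//; near: y; exact: near_poly_neq0.
Unshelve. all: by end_near. Qed.

End Derivatives.

(** The data are packed in one tuple and indexed by nat, with zeros beyond m, so that [choice] can
    select them for several functions whose systems differ in size. *)
Lemma rational_system_derive1n p : rational_system p ->
  exists (c : nat * {poly R} * (nat -> nat -> {poly R}) * (nat -> R -> R)),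
  c.1.1.2 != 0 /\ forall x, c.1.1.2.[x] != 0 -> forall t,
    is_derive x 1 (derive1n t p) (derive1n t.+1 p x) /\
    derive1n t p x =
      (\sum_(k < c.1.1.1) (c.1.2 t k).[x] * c.2 k x) / c.1.1.2.[x] ^+ t.+1.
Proof.
move=> [m [q [A [B [w [q0 wp]]]]]].
pose C t (k : nat) := if insub k is Some k' then derivn_coef q A B t k' else 0.
pose W (k : nat) := if insub k is Some k' then w k' else (fun=> 0).
exists (m, q, C, W); split => //= x qx t; split.
  exact: (is_derive_derive1n wp).
rewrite (derive1n_comb wp)//; congr (_ / _); apply: eq_bigr => k _.
by rewrite /C /W valK.
Qed.

Lemma sum_coef_widen (K : nzRingType) (T : nzRingType) (L : {poly K}) n (F : K -> nat ->
  T) :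
  (forall t, F 0 t = 0) -> (size L <= n)%N ->
  \sum_(t < size L) F L`_t t = \sum_(t < n) F L`_t t.
Proof.
move=> F0 Ln; rewrite (big_ord_widen n (fun t => F L`_t t) Ln) big_mkcond/=.
apply: eq_bigr => t _; case: ifPn => //; rewrite -leqNgt => /(nth_default 0) ->.
by rewrite F0.
Qed.

Lemma frac_pad (u a b c : R) t N : u != 0 -> (t <= N)%N ->
  a * (b * c / u ^+ t.+2) = a * (u ^+ (N - t) * b) * c / u ^+ N.+2.
Proof.
move=> u0 tN; have -> : N.+2 = ((N - t) + t.+2)%N by rewrite !addnS subnK.
rewrite exprD; have := expf_neq0 (N - t) u0; have := expf_neq0 t.+2 u0.
by move: (u ^+ (N - t)) (u ^+ t.+2) => d e e0 d0; field; rewrite e0 d0.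
Qed.

(* The coefficient vectors of the derivatives of the p_i over the w_i live in a
   space of finite dimension over the field of fractions. *)
Lemma common_annihilator n (p : 'I_n -> R -> R) :
  (forall i, rational_system (p i)) ->
  exists (L : diffop R) (Q : {poly R}), [/\ (1 <= order L)%N, Q != 0 &
    forall i x, Q.[x] != 0 ->
      (forall t, is_derive x 1 (derive1n t (p i)) (derive1n t.+1 (p i) x)) /\
      \sum_(t < size L) (L`_t).[x] * derive1n t (p i) x = 0].
Proof.
move=> rs; have [c cP] := choice (fun i => rational_system_derive1n (rs i)).
pose M := (\max_i (c i).1.1.1)%N.
pose I : finType := ('I_n * 'I_M)%type.
pose q i := (c i).1.1.2.
(* The (t+1)-st derivative has denominator q^(t+2), which the factor q^(#|I| - t) raises to
   q^(#|I|+2) for every t. Starting at the first derivative makes the order of L positive. *)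
pose v t (z : I) := q z.1 ^+ (#|I| - t) * (c z.1).1.2 t.+1 z.2.
have [a [t0 t0I at0] av] := linear_dependence v.
pose L : diffop R := \poly_(t < #|I|.+2) (if t is t'.+1 then a t' else 0).
exists L, (\prod_i q i); split.
- have : L`_t0.+1 != 0 by rewrite coef_poly ltnS ltnS t0I.
  rewrite /order; case: (ltnP t0.+1 (size L)) => [|/(nth_default 0)->];
    last by rewrite eqxx.
  by case: (size L) => [//|[]].
- by apply/prodf_neq0 => i _; case: (cP i).
- move=> i x; rewrite horner_prod => /prodf_neq0/(_ i isT) qx.
  have [_ /(_ _ qx) cPi] := cP i; split; first by move=> t; case: (cPi t).
  rewrite (@sum_coef_widen _ _ L #|I|.+2 (fun z t => z.[x] * derive1n t (p i) x));
    first last.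
  - exact: size_poly.
  - by move=> t; rewrite horner0 mul0r.
  have Lt (t : 'I_#|I|.+1) : L`_(lift ord0 t) =
    a t by rewrite coef_poly /= ltnS ltn_ord.
  rewrite big_ord_recl [L`__]coef_poly/= horner0 mul0r add0r.
  transitivity (\sum_(t < #|I|.+1) (a t).[x] *
      ((\sum_(k < (c i).1.1.1) ((c i).1.2 t.+1 k).[x] * (c i).2 k x) / (q i).[x] ^+
        t.+2)).
    by apply: eq_bigr => t _; rewrite Lt; have [_ <-] := cPi t.+1.
  transitivity ((\sum_(k < (c i).1.1.1) (\sum_(t < #|I|.+1)
      a t * (q i ^+ (#|I| - t) * (c i).1.2 t.+1 k)).[x] * (c i).2 k x) / (q i).[x] ^+
        #|I|.+2);
    last first.
    rewrite big1 ?mul0r// => k _; have kM : (k < M)%N.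
      by rewrite (leq_trans (ltn_ord k))// /M (leq_bigmax i).
    by have /= -> := av (i, Ordinal kM); rewrite horner0 mul0r.
  under [in RHS]eq_bigr do rewrite horner_sum mulr_suml.
  rewrite exchange_big/= mulr_suml; apply: eq_bigr => t _.
  rewrite mulr_suml mulr_sumr mulr_suml; apply: eq_bigr => k _.
  by rewrite !hornerM horner_exp; apply: frac_pad => //; rewrite -ltnS.
Qed.

End RationalSystem.

(** * Cutoffs and integrals on the line *)

Section PolyFacts.
Variable R : realType.
Implicit Types (q a : {poly R}) (x : R).

Lemma finite_poly_zeros q : q != 0 -> finite_set [set x | q.[x] = 0].
Proof.
have [n] := ubnP (size q); elim: n q => // n ih q qn q0.
have [->|/set0P[x /= qx]] := eqVneq [set x | q.[x] = 0] set0; first exact: finite_set0.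
have /factor_theorem[p pq] : root q x by apply/eqP.
have p0 : p != 0 by apply: contra_neq q0 => p0; rewrite pq p0 mul0r.
apply: (@sub_finite_set _ _ ([set x] `|` [set y | p.[y] = 0])).
  move=> y /=; rewrite pq hornerM hornerXsubC => /eqP; rewrite mulf_eq0 => /orP[/eqP|].
    by right.
  by rewrite subr_eq0 => /eqP; left.
rewrite finite_setU; split; first exact: finite_set1.
apply: ih => //; move: qn; rewrite pq size_mul ?polyXsubC_eq0//.
by rewrite size_XsubC addn2.
Qed.

Lemma poly_bound q n : (size q <= n.+1)%N ->
  exists2 C : R, 0 <= C & forall x, `|q.[x]| <= C * (1 + `|x|) ^+ n.
Proof.
move=> qn; exists (\sum_(i < size q) `|q`_i|); first exact: sumr_ge0.
move=> x; rewrite horner_coef (le_trans (ler_norm_sum _ _ _))// mulr_suml.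
apply: ler_sum => i _; rewrite normrM ler_wpM2l// normrX.
have x1 : 1 <= 1 + `|x| by rewrite lerDl.
rewrite (@le_trans _ _ ((1 + `|x|) ^+ i))//.
  by rewrite lerXn2r ?nnegrE ?addr_ge0// lerDr.
by rewrite ler_weXn2l// -ltnS (leq_trans (ltn_ord i)).
Qed.

Lemma size_derivn q i : (size q^`(i) <= size q - i)%N.
Proof.
elim: i => [|i ih]; first by rewrite subn0.
rewrite derivnS (@leq_trans (size q^`(i)).-1)//;
  last by rewrite subnS -!subn1 leq_sub2r.
have [->|p0] := eqVneq q^`(i) 0; first by rewrite deriv0 size_poly0.
by have := lt_size_deriv p0; case: (size q^`(i)).
Qed.

Lemma derivn_mul_expr (r a : {poly R}) N i : (i <= N)%N ->
  exists H, (r ^+ N * a)^`(i) = r ^+ (N - i) * H.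
Proof.
elim: i => [|i ih] iN; first by exists a; rewrite subn0.
have [H e] := ih (ltnW iN); rewrite derivnS e derivM deriv_exp.
exists (r^`() * H *+ (N - i) + r * H^`()).
have -> : (N - i = (N - i.+1).+1)%N by rewrite subnSK.
rewrite /= exprS mulrDr mulrnAr mulrnAl !mulrA; congr (_ *+ _ + _ * _).
  by rewrite [r^`() * _]mulrC.
by rewrite [r * _]mulrC.
Qed.

End PolyFacts.

Section Cutoff.
Variable R : realType.
Implicit Types (r a : {poly R}) (x : R).

(** For i < N this is the i-th derivative of the function equal to r^N a where r > 0 and to 0
    elsewhere. *)
Definition cutoff r a N i x : R := if 0 < r.[x] then ((r ^+ N * a)^`(i)).[x] else 0.

(** Only a zero x of r needs care. There i + 1 < N leaves a factor r^2 in the i-th derivative of r^N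
    a, hence a double zero at x, and the slope of the cutoff at x is 0 from either branch. *)
Lemma is_derive_cutoff r a N i x : (i.+1 < N)%N ->
  is_derive x 1 (cutoff r a N i) (cutoff r a N i.+1 x).
Proof.
move=> iN; have rc : {for x, continuous (fun y => r.[y])} by exact: continuous_horner.
rewrite {2}/cutoff; case: ltgtP => rx.
- rewrite derivnS; apply: is_derive_near_eq (is_derive_horner _ _).
  by near=> y; rewrite /cutoff ifT//; near: y; exact: (cvgr_gt _ rc).
- apply: is_derive_near_eq (is_derive_cst (0 : R) x 1).
  near=> y; rewrite /cutoff ifF//; apply/negbTE; rewrite -leNgt ltW//.
  by near: y; exact: (cvgr_lt _ rc).
have [H HE] := @derivn_mul_expr R r a N i (ltnW (ltnW iN)).
have /factor_theorem[r' r'E] : root r x by apply/eqP.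
pose K := r' ^+ 2 * r ^+ (N - i - 2) * H.
have KE : (r ^+ N * a)^`(i) = ('X - x%:P) ^+ 2 * K.
  rewrite HE /K; have -> : (N - i = 2 + (N - i - 2))%N.
    by rewrite subnKC// ltn_subRL addn1.
  by rewrite exprD {1}r'E addKn; ring.
apply/is_derive1_caratheodory.
exists (fun z => if 0 < r.[z] then (('X - x%:P) * K).[z] else 0); split.
- move=> z; rewrite /cutoff -rx ltxx subr0; case: ifP => _; last by rewrite mul0r.
  by rewrite KE !hornerE /=; ring.
- rewrite /prop_for /continuous_at /= -rx ltxx.
  have c : ((('X - x%:P) * K).[z]) @[z --> x] --> 0.
    have := @continuous_horner R (('X - x%:P) * K) x.
    by rewrite /continuous_at hornerM hornerXsubC subrr mul0r.
  apply: norm_cvg0; move/cvg_norm: c; rewrite normr0 => c.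
  apply: (@squeeze_cvgr _ _ _ _ (fun=> 0) (fun z => `|(('X - x%:P) * K).[z]|)) => //;
    last exact: cvg_cst.
  by near=> z; case: ifP => _; rewrite ?normr0 ?normr_ge0 ?lexx.
- by rewrite -rx ltxx.
Unshelve. all: by end_near. Qed.

Lemma continuous_cutoff r a N i : (i.+1 < N)%N -> continuous (cutoff r a N i).
Proof. by move=> iN x; exact: is_derive1_continuous (is_derive_cutoff r a x iN). Qed.

Lemma cutoff_eq0 r a N i x : r.[x] <= 0 -> cutoff r a N i x = 0.
Proof. by rewrite /cutoff ltNge => ->. Qed.

End Cutoff.

Section RealIntegral.
Context d (T : measurableType d) (R : realType) (mu : {measure set T -> \bar R}).
Variables (D : set T) (mD : measurable D).
Implicit Types (f g : T -> R).

Local Notation intR f := (mu.-integrable D (EFin \o f)).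

Lemma intR_le f g : measurable_fun D f -> (forall x, D x -> `|f x| <= g x) ->
  intR g -> intR f.
Proof.
move=> mf fg; apply: le_integrable => //; first exact/measurable_EFinP.
by move=> x Dx /=; rewrite lee_fin (le_trans (fg _ Dx))// ler_norm.
Qed.

Lemma eq_intR f g : (forall x, D x -> f x = g x) -> intR f -> intR g.
Proof. by move=> fg; apply: eq_integrable => // x /set_mem Dx /=; rewrite fg. Qed.

Lemma intRD f g : intR f -> intR g -> intR (fun x => f x + g x).
Proof. by move=> fi gi; have := integrableD mD fi gi. Qed.

Lemma intRZ (c : R) f : intR f -> intR (fun x => c * f x).
Proof. by move=> fi; have := integrableZl mD c fi. Qed.

Lemma intR_abs f : intR f -> intR (fun x => `|f x|).
Proof. by move=> fi; have := integrable_abse fi. Qed.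

Lemma intR_sum (I : Type) (s : seq I) (P : pred I) (f : I -> T -> R) :
  (forall i, P i -> intR (f i)) -> intR (fun x => \sum_(i <- s | P i) f i x).
Proof.
move=> fi; elim: s => [|i s ih].
  by under eq_fun do rewrite big_nil; exact: integrable0.
under eq_fun do rewrite big_cons.
by case Pi: (P i) => //; apply: intRD => //; exact: fi.
Qed.

Lemma Rintegral_sum (I : Type) (s : seq I) (P : pred I) (f : I -> T -> R) :
  (forall i, P i -> intR (f i)) ->
  \int[mu]_(x in D) (\sum_(i <- s | P i) f i x) =
  \sum_(i <- s | P i) \int[mu]_(x in D) f i x.
Proof.
move=> fi; elim: s => [|i s ih].
  rewrite big_nil -[RHS](mul0r (\int[mu]_(x in D) 0)) -RintegralZl//.
    by apply: eq_Rintegral => x _; rewrite big_nil mul0r.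
  exact: integrable0.
rewrite big_cons; case: ifPn => Pi.
  rewrite -ih -RintegralD//; first by apply: eq_Rintegral => x _; rewrite big_cons Pi.
    exact: fi.
  exact: intR_sum.
by rewrite -ih; apply: eq_Rintegral => x _; rewrite big_cons (negbTE Pi).
Qed.

Lemma Rdominated (f_ : nat -> T -> R) f g :
  (forall n, measurable_fun D (f_ n)) -> measurable_fun D f ->
  {ae mu, forall x, D x -> f_ n x @[n --> \oo] --> f x} ->
  (forall n x, D x -> `|f_ n x| <= g x) -> intR g ->
  intR f /\ \int[mu]_(x in D) f_ n x @[n --> \oo] --> \int[mu]_(x in D) f x.
Proof.
move=> mf_ mf cvf fg ig.
have cvE : {ae mu, forall x, D x -> (f_ n x)%:E @[n --> \oo] --> (f x)%:E}.
  apply: filterS cvf => x + Dx => /(_ Dx) h.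
  by apply: cvg_EFin => //; exact: nearW.
have fgE : {ae mu, forall x n, D x -> (`|(f_ n x)%:E| <= (EFin \o g) x)%E}.
  by apply: aeW => x n Dx; rewrite lee_fin fg.
have [fi _ fc] := dominated_convergence mD
  (fun n => (measurable_EFinP _ _).2 (mf_ n)) ((measurable_EFinP _ _).2 mf) cvE ig fgE.
split => //; apply: fine_cvg; rewrite fineK//; exact: integrable_fin_num.
Qed.

End RealIntegral.

Section CompactSupport.
Variable R : realType.
Notation mu := (@lebesgue_measure R).
Implicit Types f : R -> R.

Lemma integrable_compact_support f (M : R) : continuous f ->
  (forall x, M < `|x| -> f x = 0) -> mu.-integrable setT (EFin \o f).
Proof.
move=> cf f0.
have fM : mu.-integrable `[- M, M]%classic (EFin \o f).
  apply: continuous_compact_integrable; first exact: segment_compact.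
  exact: continuous_subspaceT.
have := iffLR (@integrable_mkcond _ _ R mu `[- M,
  M]%classic (EFin \o f) (measurable_itv _)) fM.
apply: eq_integrable => //= x _; rewrite patchE; case: ifPn => //.
move=> /negP xM /=; rewrite f0//; rewrite ltNge; apply: contra_notN xM => xM.
by rewrite inE/= in_itv/= -ler_norml.
Qed.

Lemma Rintegral_derive_eq0 f f' (M : R) : (forall x : R, is_derive x 1 f (f' x)) ->
  continuous f' -> (forall x, M < `|x| -> f x = 0) ->
  \int[mu]_x f' x = 0.
Proof.
move=> ff' cf' f0; pose N := Num.max M 0 + 1.
have N0 : 0 < N by rewrite ltr_pwDr// le_max lexx orbT.
have MN : M < N by rewrite /N ltr_pwDr// le_max lexx.
have f0' x : M < `|x| -> f' x = 0.
  move=> Mx; rewrite -(is_derive1E (ff' x)); apply: is_derive1E.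
  apply: is_derive_near_eq (is_derive_cst (0 : R) x 1).
  near=> y; rewrite f0//; near: y.
  by apply: (cvgr_gt `|x|) Mx; apply: (@norm_continuous R R).
transitivity (\int[mu]_(x in `[- N, N]) f' x).
  rewrite [RHS]Rintegral_mkcond; apply: eq_Rintegral => x _; rewrite patchE.
  case: ifPn => // /negP xM; rewrite f0'//; rewrite ltNge; apply: contra_notN xM => xM.
  by rewrite inE/= in_itv/= -ler_norml (le_trans xM)// ltW.
rewrite /Rintegral (@continuous_FTC2 _ _ f).
- by rewrite -EFinB/= !f0 ?subrr// ?normrN gtr0_norm.
- by rewrite gtrN.
- exact: continuous_subspaceT.
- have cf : continuous f by move=> x; exact: is_derive1_continuous (ff' x).
  split; first by move=> x _; exact: ex_derive.
  + by apply: cvg_at_right_filter; exact: cf.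
  + by apply: cvg_at_left_filter; exact: cf.
- by move=> x _; exact: is_derive1E (ff' x).
Unshelve. all: by end_near. Qed.

Lemma ae_poly_neq0 (q : {poly R}) : q != 0 -> {ae mu, forall x, q.[x] != 0}.
Proof.
move=> q0; exists [set x | q.[x] = 0]; split.
- by apply/countable_measurable/finite_set_countable/finite_poly_zeros.
- by apply/countable_lebesgue_measure0/finite_set_countable/finite_poly_zeros.
- by move=> x /= /negP; rewrite negbK => /eqP.
Qed.

End CompactSupport.

(** * Integration against an annihilated function *)

(* Applied to W i k j = integral of a^(i) p^(k) f^(j). *)
Lemma binomial_recursion (R : comNzRingType) (T : nat) (W : nat -> nat -> nat -> R) :
  (forall i k j, (i < T)%N -> (k < T)%N -> (j < T)%N ->
     W i k.+1 j = - (W i.+1 k j + W i k j.+1)) ->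
  forall t i j, (i + t <= T)%N -> (j + t <= T)%N ->
    W i t j = (-1) ^+ t * \sum_(l < t.+1) W (i + (t - l))%N 0%N (j + l)%N *+ 'C(t, l).
Proof.
move=> rec; elim=> [|t ih] i j it jt.
  by rewrite big_ord1 expr0 mul1r bin0 mulr1n !addn0.
rewrite rec; first last.
- by rewrite (leq_trans _ jt)// addnS ltnS leq_addr.
- by rewrite (leq_trans _ it)// leq_addl.
- by rewrite (leq_trans _ it)// addnS ltnS leq_addr.
rewrite !ih; do ?[by rewrite ?addSn -?addnS|by rewrite (leq_trans _ it)//
  leq_add2l|by rewrite (leq_trans _ jt)// leq_add2l].
rewrite -mulrDr -mulNr exprS mulN1r; congr (_ * _).
pose g l := W (i + (t.+1 - l))%N 0%N (j + l)%N.
transitivity (\sum_(l < t.+1) g l *+ 'C(t, l) + \sum_(l < t.+1) g l.+1 *+ 'C(t, l)).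
  congr (_ + _); apply: eq_bigr => l _; rewrite /g.
    by rewrite addSnnS subSn// -ltnS.
  by rewrite subSS addSnnS.
rewrite [RHS]big_ord_recl/= -/(g 0%N) bin0.
under [in RHS]eq_bigr => l _ do rewrite binS mulrnDr -/(g l.+1).
rewrite big_split/= addrA; congr (_ + _).
rewrite [in RHS]big_ord_recr/= bin_small// mulr0n addr0.
by rewrite big_ord_recl/= bin0.
Qed.

Lemma cvgr_sum (R : realType) (I : Type) (s : seq I) (P : pred I) (f : I -> nat ->
  R) (a : I -> R) :
  (forall i, P i -> f i n @[n --> \oo] --> a i) ->
  (\sum_(i <- s | P i) f i n) @[n --> \oo] --> \sum_(i <- s | P i) a i.
Proof.
move=> fa; elim: s => [|i s ih].
  by under eq_fun do rewrite big_nil; rewrite big_nil; exact: cvg_cst.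
under eq_fun do rewrite big_cons; rewrite big_cons.
by case Pi: (P i) => //; apply: cvgD => //; exact: fa.
Qed.

Section CutoffFamily.
Variables (R : realType) (Q : {poly R}).
Hypothesis Q0 : Q != 0.
Notation mu := (@lebesgue_measure R).

(* Positive only on a compact subset of {Q <> 0}, and increasing to Q^2 as
   e tends to 0. *)
Definition cutbase (e : R) : {poly R} := Q ^+ 2 - e *: ('X ^+ 2 + 1) ^+ size Q.

(** The exponent [size Q] exceeds the degree of Q by one, so that e (x^2 + 1)^(size Q) < Q^2 leaves
    a gap of degree 2. The bound makes the region bounded for fixed e and, uniformly in e, pays for
    the excess degrees in [cutoff_bound]. *)
Lemma cutbase_region : exists2 C : R, 0 <= C &
  forall e x, 0 < e -> 0 < (cutbase e).[x] -> e * (1 + `|x|) ^+ 2 <= C.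
Proof.
have K0 : (0 < size Q)%N by rewrite size_poly_gt0.
have [C C0 CQ] := @poly_bound R Q (size Q).-1 (leqSpred _).
exists (2 ^+ size Q * C ^+ 2); first by rewrite mulr_ge0 ?exprn_ge0.
move=> e x e0 eQ; have {}eQ : e * (x ^+ 2 + 1) ^+ size Q < Q.[x] ^+ 2.
  by move: eQ; rewrite /cutbase !hornerE subr_gt0.
set y := 1 + `|x|.
have y0 : 0 < y by rewrite /y ltr_pwDl.
have y2 : y ^+ 2 <= 2 * (x ^+ 2 + 1).
  by rewrite /y -[x ^+ 2]real_normK ?num_real//; have := sqr_ge0 (1 - `|x|); nra.
have yp : 0 < (y ^+ 2) ^+ (size Q).-1 by rewrite !exprn_gt0.
rewrite -(ler_pM2r yp) -mulrA -exprS prednK//.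
apply: (@le_trans _ _ (2 ^+ size Q * (e * (x ^+ 2 + 1) ^+ size Q))).
  rewrite mulrCA ler_pM2l// -exprMn lerXn2r ?nnegrE ?exprn_ge0//; first exact: ltW.
  by rewrite mulr_ge0// addr_ge0 ?sqr_ge0.
rewrite -mulrA ler_pM2l ?exprn_gt0//; apply: (le_trans (ltW eQ)).
rewrite -exprM mulnC exprM -exprMn -[leLHS]real_normK ?num_real//.
by rewrite lerXn2r ?nnegrE ?mulr_ge0 ?exprn_ge0 ?(ltW y0)// CQ.
Qed.

Lemma cutbase_lt0 e x : 0 < e -> Q.[x] = 0 -> (cutbase e).[x] < 0.
Proof.
move=> e0 Qx; rewrite /cutbase !hornerE Qx expr0n sub0r oppr_lt0 mulr_gt0//.
by rewrite exprn_gt0// ltr_pwDr// sqr_ge0.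
Qed.

Lemma cutbase_derivn (a : {poly R}) N i e x : ((cutbase e ^+ N * a)^`(i)).[x] =
  \sum_(l < N.+1) (- e) ^+ l *
    (((Q ^+ 2) ^+ (N - l) * (('X ^+ 2 + 1) ^+ size Q) ^+ l * a)^`(i)).[x] *+ 'C(N, l).
Proof.
rewrite /cutbase exprDn mulr_suml linear_sum horner_sum; apply: eq_bigr => l _ /=.
by rewrite -scaleNr exprZn -scalerAr mulrnAl -scalerAl derivnMn derivnZ hornerMn
  hornerZ.
Qed.

(** In the binomial expansion the term of index l may have degree 2 l too much, but it carries e^l,
    and e (1 + |x|)^2 is bounded where the cutoff is nonzero. The exponent is thus the degree bound
    of Q^(2N) a, with nothing lost to the cutoff. *)
Lemma cutoff_bound (a : {poly R}) D N i : (size a <= D.+1)%N ->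
  exists2 C : R, 0 <= C & forall e x, 0 < e ->
    `|cutoff (cutbase e) a N i x| <= C * (1 + `|x|) ^+ (D + 2 * N * (size Q).-1).
Proof.
move=> aD; have [C1 C10 C1P] := cutbase_region.
set A := (D + 2 * N * (size Q).-1)%N.
have K0 : (0 < size Q)%N by rewrite size_poly_gt0.
have sz l : (l < N.+1)%N ->
    (size (((Q ^+ 2) ^+ (N - l) * (('X ^+ 2 + 1) ^+ size Q) ^+ l * a)^`(i)) <=
      (A + 2 * l).+1)%N.
  move=> lN; apply: (leq_trans (size_derivn _ _)); apply: (leq_trans (leq_subr _ _)).
  rewrite -!exprM; apply: (leq_trans (size_polyMleq _ _)).
  have s1 := size_poly_exp_leq Q (2 * (N - l)).
  have s2 := size_poly_exp_leq ('X ^+ 2 + 1 : {poly R}) (size Q * l).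
  have s3 := size_polyMleq (Q ^+ (2 * (N - l))) (('X ^+ 2 + 1) ^+ (size Q * l)).
  rewrite -[X in 'X^_ + X]polyC1 size_XnaddC//= polyC1 in s2.
  have e1 : ((size Q).-1 * (2 * (N - l)) + 2 * (size Q * l) =
    2 * N * (size Q).-1 + 2 * l)%N.
    by move: K0 lN; case: (size Q) => // k _; rewrite ltnS /= => lN; nia.
  have pred_add (b c u v : nat) : (b <= u.+1 -> c <= v.+1 ->
    (b + c).-1 <= (u + v).+1)%N.
    by move=> bu cv; lia.
  have s4 := leq_trans s3 (pred_add _ _ _ _ s1 s2).
  by apply: (leq_trans (pred_add _ _ _ _ s4 aD)); rewrite e1 /A; lia.
pose f l := ((Q ^+ 2) ^+ (N - l) * (('X ^+ 2 + 1) ^+ size Q) ^+ l * a)^`(i).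
have fb l : exists2 C : R, 0 <= C & (l < N.+1)%N ->
  forall x, `|(f l).[x]| <= C * (1 + `|x|) ^+ (A + 2 * l).
  case: (ltnP l N.+1) => [lN|_]; last by exists 0.
  by have [C ? ?] := poly_bound (sz l lN); exists C.
have [C CP] := choice (fun l => iffLR (exists2P _ _) (fb l)).
exists (\sum_(l < N.+1) C l * C1 ^+ l *+ 'C(N, l)).
  by apply: sumr_ge0 => l _; rewrite mulrn_wge0// mulr_ge0 ?exprn_ge0//; case: (CP l).
move=> e x e0; rewrite /cutoff; case: ifPn => [|_]; last first.
  rewrite normr0 mulr_ge0//.
    by apply: sumr_ge0 => l _; rewrite mulrn_wge0// mulr_ge0 ?exprn_ge0//; case: (CP l).
move=> /(C1P _ _ e0) eC; rewrite cutbase_derivn mulr_suml.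
apply: (le_trans (ler_norm_sum _ _ _)); apply: ler_sum => l _.
rewrite normrMn mulrnAl lerMn2r orbC; apply/orP; left.
have [Cl0 CPl] := CP l.
rewrite normrM normrX normrN (gtr0_norm e0).
apply: (@le_trans _ _ (e ^+ l * (C l * (1 + `|x|) ^+ (A + 2 * l)))).
  by rewrite ler_wpM2l ?exprn_ge0 ?(ltW e0)// CPl.
rewrite exprD exprM; set y := (1 + `|x|) ^+ 2 in eC *.
have -> : e ^+ l * (C l * ((1 + `|x|) ^+ A * y ^+ l)) =
  C l * (e * y) ^+ l * (1 + `|x|) ^+ A.
  have aux (b c c' c'' : R) : b * (c * (c' * c'')) = c * (b * c'') * c' by ring.
  by rewrite (exprMn l e y) aux.
rewrite ler_wpM2r ?exprn_ge0 ?addr_ge0// ler_wpM2l// lerXn2r ?nnegrE//.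
by rewrite mulr_ge0 ?(ltW e0)// exprn_ge0 ?addr_ge0.
Qed.

End CutoffFamily.

Section Core.
Variables (R : realType) (L : diffop R) (Q : {poly R}).
Hypothesis Q0 : Q != 0.
Hypothesis L0 : L != 0.
Notation mu := (@lebesgue_measure R).
Notation T := (Defs.order L).
(** Large enough for the cutoffs of index at most T + 1 to be differentiable. *)
Let N := T.+3.

(* The formal adjoint of Q^(2N) L. *)
Definition adjoint_op : diffop R := \poly_(l < size L)
  \sum_(t < size L) (-1) ^+ t * ((Q ^+ 2) ^+ N * L`_t)^`(t - l) *+ 'C(t, l).

(* pf k j stands for the product of the k-th derivative of p and the j-th
   derivative of a test function, or for a sum of such products. *)
Variable pf : nat -> nat -> R -> R.
Hypothesis pf_derive : forall k j (x : R), (k < T)%N -> (j < T)%N -> Q.[x] != 0 ->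
  is_derive x 1 (pf k j) (pf k.+1 j x + pf k j.+1 x).
Hypothesis pf_cont : forall k j (x : R), (k <= T)%N -> (j <= T)%N -> Q.[x] != 0 ->
  {for x, continuous (pf k j)}.
Hypothesis pf_ode : forall x, Q.[x] != 0 -> \sum_(t < size L) (L`_t).[x] * pf t 0%N x =
  0.
Hypothesis pf_meas : forall j, (j <= T)%N -> measurable_fun setT (pf 0%N j).

Section Step.
Variables (e : R) (e0 : 0 < e) (a : {poly R}).
Let cut i := cutoff (cutbase Q e) a N i.
Let W i k j := \int[mu]_x (cut i x * pf k j x).

(** Since [cutbase] is negative at x, it stays so nearby. Products with the cutoff are therefore
    smooth at the zeros of Q whatever the other factor does there. *)
Lemma cut_near0 i x : Q.[x] = 0 -> \forall y \near x, cut i y = 0.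
Proof.
move=> Qx; have c : {for x, continuous (fun y =>
  (cutbase Q e).[y])} by exact: continuous_horner.
near=> y; apply: cutoff_eq0; apply: ltW; near: y.
by apply: (cvgr_lt _ c); exact: cutbase_lt0.
Unshelve. all: by end_near. Qed.

Lemma cut_support : exists M : R, forall i x, M < `|x| -> cut i x = 0.
Proof.
have [C C0 CP] := cutbase_region Q0.
exists (C / e) => i x Cx; apply: cutoff_eq0; rewrite leNgt; apply/negP => /(CP _ _ e0).
rewrite leNgt => /negP; apply; rewrite mulrC -ltr_pdivrMr//; apply: (lt_le_trans Cx).
by have := normr_ge0 x; nra.
Qed.

Lemma continuous_cutM i k j : (i <= T.+1)%N -> (k <= T)%N -> (j <= T)%N ->
  continuous (fun x => cut i x * pf k j x).
Proof.
move=> iT kT jT x; have [Qx|Qx] := eqVneq Q.[x] 0.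
  apply: (@is_derive1_continuous _ _ _ 0).
  apply: is_derive_near_eq (is_derive_cst (0 : R) x 1).
  by near=> y; rewrite (near (cut_near0 i Qx) y)// mul0r.
apply: cvgM; last exact: pf_cont.
by apply: continuous_cutoff; rewrite !ltnS.
Unshelve. all: by end_near. Qed.

Lemma integrable_cutM i k j : (i <= T.+1)%N -> (k <= T)%N -> (j <= T)%N ->
  mu.-integrable setT (EFin \o (fun x => cut i x * pf k j x)).
Proof.
move=> iT kT jT; have [M MP] := cut_support.
apply: (@integrable_compact_support _ _ M); first exact: continuous_cutM.
by move=> x Mx; rewrite MP// mul0r.
Qed.

Lemma core_step i k j : (i < T)%N -> (k < T)%N -> (j < T)%N ->
  W i k.+1 j = - (W i.+1 k j + W i k j.+1).
Proof.
move=> iT kT jT; have [M MP] := cut_support.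
have i1 : mu.-integrable setT (EFin \o (fun x => cut i.+1 x * pf k j x)).
  by apply: integrable_cutM => //; exact: ltnW.
have i2 : mu.-integrable setT (EFin \o (fun x => cut i x * pf k.+1 j x)).
  by apply: integrable_cutM => //; rewrite ltnW// ltnW.
have i3 : mu.-integrable setT (EFin \o (fun x => cut i x * pf k j.+1 x)).
  by apply: integrable_cutM => //; rewrite ltnW// ltnW.
pose g x := cut i.+1 x * pf k j x + (cut i x * pf k.+1 j x + cut i x * pf k j.+1 x).
have : \int[mu]_x g x = 0.
  apply: (@Rintegral_derive_eq0 _ (fun x => cut i x * pf k j x) _ M).
  - move=> x; have [Qx|Qx] := eqVneq Q.[x] 0.
      have n0 i' := nbhs_singleton (cut_near0 i' Qx).
      rewrite /g !n0 !mul0r !addr0.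
      apply: is_derive_near_eq (is_derive_cst (0 : R) x 1).
      by near=> y; rewrite (near (cut_near0 i Qx) y)// mul0r.
    have dc : is_derive x 1 (cut i) (cut i.+1 x) by apply: is_derive_cutoff;
      rewrite ltnS ltnW// ltnW.
    by apply: is_derive_eq (is_derive1M dc (pf_derive kT jT Qx)) _; rewrite /g mulrDr.
  - move=> x; apply: cvgD; first by apply: continuous_cutM => //; exact: ltnW.
    by apply: cvgD; apply: continuous_cutM => //; rewrite ltnW// ltnW.
  - by move=> x Mx; rewrite MP// mul0r.
rewrite /g RintegralD//; last exact: intRD.
rewrite RintegralD// => /eqP; rewrite addrCA addr_eq0 => /eqP e1.
by rewrite /W e1.
Unshelve. all: by end_near. Qed.

(** On the right only p itself occurs, undifferentiated. This is done before the cutoff is removed,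
    so that integrability is needed for [pf 0 l] alone. *)
Lemma core_ibp t : (t <= T)%N ->
  W 0 t 0 = (-1) ^+ t * \sum_(l < t.+1) W (t - l) 0%N l *+ 'C(t, l).
Proof. by move=> tT; rewrite (binomial_recursion core_step). Qed.

End Step.

Section Limit.
Variable D : nat.
Hypothesis LD : forall t : nat, (size (L`_t)%R <= D.+1)%N.
Let A := (D + 2 * N * (size Q).-1)%N.
Hypothesis pf_int : forall j, (j <= T)%N ->
  mu.-integrable setT (EFin \o (fun x => (1 + `|x|) ^+ A * pf 0%N j x)).

Let G t i := ((Q ^+ 2) ^+ N * L`_t)^`(i).
Let eps (n : nat) : R := n.+1%:R^-1.

Lemma cvg_cutoff t i x : Q.[x] != 0 ->
  cutoff (cutbase Q (eps n)) L`_t N i x @[n --> \oo] --> (G t i).[x].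
Proof.
move=> Qx.
have eps0 : eps n @[n --> \oo] --> (0 : R) by exact: cvg_harmonic.
have c1 : ((cutbase Q (eps n) ^+ N * L`_t)^`(i)).[x] @[n --> \oo] --> (G t i).[x].
  under eq_fun do rewrite cutbase_derivn.
  have -> : (G t i).[x] = \sum_(l < N.+1) (- 0 : R) ^+ l *
    (((Q ^+ 2) ^+ (N - l) * (('X ^+ 2 + 1) ^+ size Q) ^+ l * L`_t)^`(i)).[x] *+ 'C(N,
      l).
    rewrite big_ord_recl/= expr0 mul1r bin0 subn0 expr0 mulr1 big1 ?addr0// => l _.
    by rewrite oppr0 expr0n mul0r mul0rn.
  apply: cvgr_sum => l _; apply: cvgMn; apply: cvgMl.
  by apply: (continuous_cvg _ (@exprn_continuous R l _)); apply: cvgN.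
have c2 : (cutbase Q (eps n)).[x] @[n --> \oo] --> (Q ^+ 2).[x].
  rewrite /cutbase; under eq_fun do rewrite hornerD hornerN hornerZ.
  suff : (Q ^+ 2).[x] - eps n * (('X^2 + 1) ^+ size Q).[x] @[n --> \oo] -->
    (Q ^+ 2).[x] - 0 * (('X^2 + 1) ^+ size Q).[x] by rewrite mul0r subr0.
  by apply: cvgB; [exact: cvg_cst|exact: cvgMl].
have Q2 : 0 < (Q ^+ 2).[x] by rewrite horner_exp exprn_even_gt0.
apply: cvg_trans c1; apply: near_eq_cvg; near=> n; rewrite /cutoff ifT//.
by near: n; exact: (cvgr_gt _ c2).
Unshelve. all: by end_near. Qed.

Lemma core_limit t i j : (i <= T)%N -> (j <= T)%N ->
  mu.-integrable setT (EFin \o (fun x => (G t i).[x] * pf 0%N j x)) /\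
  (\int[mu]_x (cutoff (cutbase Q (eps n)) L`_t N i x * pf 0%N j x)) @[n --> \oo] -->
  \int[mu]_x ((G t i).[x] * pf 0%N j x).
Proof.
move=> iT jT.
have [C C0 CP] := cutoff_bound Q0 N i (LD t).
apply: (@Rdominated _ _ _ mu setT measurableT _ _ (fun x =>
  C * `|(1 + `|x|) ^+ A * pf 0%N j x|)).
- move=> n; apply: measurable_funM; last exact: pf_meas.
  by apply: continuous_measurable_fun; apply: continuous_cutoff;
    rewrite !ltnS ltnW// ltnS.
- apply: measurable_funM; last exact: pf_meas.
  by apply: continuous_measurable_fun; exact: continuous_horner.
- apply: (@filterS _ _ (ae_filter_ringOfSetsType mu)) (ae_poly_neq0 Q0) => x Qx _;
  apply: cvgMl; exact: cvg_cutoff.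
- move=> n x _; rewrite !normrM mulrA ler_wpM2r// (le_trans (CP _ _ _))//.
    by rewrite /eps invr_gt0.
  by rewrite ger0_norm// exprn_ge0// addr_ge0.
- by apply: intRZ => //; apply: intR_abs => //; exact: pf_int.
Qed.

Lemma adjoint_op_integral :
  mu.-integrable setT (EFin \o (fun x => \sum_(l < size L) (adjoint_op`_l).[x] * pf 0%N
    l x)) /\
  \int[mu]_x (\sum_(l < size L) (adjoint_op`_l).[x] * pf 0%N l x) = 0.
Proof.
have sL : size L = T.+1 by rewrite /Defs.order prednK// size_poly_gt0.
have sT (t : 'I_(size L)) : (t <= T)%N by rewrite -ltnS -sL.
pose F (l t : 'I_(size L)) x := (-1) ^+ t *+ 'C(t,
  l) * ((G t (t - l)).[x] * pf 0%N l x).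
have Fi l t : mu.-integrable setT (EFin \o (F l t)).
  apply: intRZ => //.
  by have [] := @core_limit t (t - l) l (leq_trans (leq_subr _ _) (sT t)) (sT l).
have adjE x : \sum_(l < size L) (adjoint_op`_l).[x] * pf 0%N l x =
    \sum_(l < size L) \sum_(t < size L) F l t x.
  apply: eq_bigr => l _; rewrite coef_poly ltn_ord horner_sum mulr_suml.
  apply: eq_bigr => t _; rewrite /F -/(G t (t - l)) hornerMn hornerM.
  rewrite -polyC1 -polyCN -polyC_exp hornerC.
  by rewrite mulrnAl mulrnAl mulrA.
have -> : (fun x => \sum_(l < size L) (adjoint_op`_l).[x] * pf 0%N l x) =
    (fun x => \sum_(l < size L) \sum_(t < size L) F l t x) by exact/funext.
split; first by apply: intR_sum => // l _; apply: intR_sum.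
rewrite Rintegral_sum//; last by move=> l _; apply: intR_sum.
under eq_bigr do rewrite Rintegral_sum//.
rewrite exchange_big/=.
pose W n (t i j : nat) := \int[mu]_x (cutoff (cutbase Q (eps n)) L`_t N i x * pf 0%N j
  x).
have e0 n : 0 < eps n by rewrite invr_gt0.
(* Undone by [core_ibp], the sum is the integral of the cutoff power times the sum of the L_t p^(t)
   f: the underived cutoffs of the L_t share one factor, and the differential equation applies under
   the integral. *)
have W0 n : \sum_(t < size L) \sum_(l < size L) (-1) ^+ t *+ 'C(t,
  l) * W n t (t - l)%N l = 0.
  transitivity (\sum_(t < size L)
     \int[mu]_x (cutoff (cutbase Q (eps n)) L`_t N 0%N x * pf t 0%N x)).
    apply: eq_bigr => t _; rewrite (core_ibp (e0 n))//.
    rewrite mulr_sumr (big_ord_widen (size L) (fun l =>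
      (-1) ^+ t * (W n t (t - l)%N l *+ 'C(t, l)))) //.
    rewrite [RHS]big_mkcond/=; apply: eq_bigr => l _; case: ifPn => [_|].
      by rewrite mulrnAr mulrnAl.
    by rewrite -leqNgt => tl; rewrite bin_small// mulr0n mul0r.
  rewrite -Rintegral_sum//; last by move=> t _; apply: (integrable_cutM (e0 n)).
  rewrite -[RHS](mul0r (\int[mu]_(x in setT) (0 : R))) -RintegralZl//;
    last exact: integrable0.
  apply: eq_Rintegral => x _; rewrite mul0r; have [Qx|Qx] := eqVneq Q.[x] 0.
    by apply: big1 => t _; rewrite cutoff_eq0 ?mul0r// ltW// cutbase_lt0.
  rewrite /cutoff; case: (0 < (cutbase Q (eps n)).[x]); last by rewrite big1// => t _;
    rewrite mul0r.
  have := pf_ode Qx => e.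
  transitivity ((cutbase Q (eps n) ^+ N).[x] * \sum_(t < size L) (L`_t).[x] * pf t 0%N
    x).
    by rewrite mulr_sumr; apply: eq_bigr => t _; rewrite derivn0 hornerM mulrA.
  by rewrite e mulr0.
have cW : \sum_(t < size L) \sum_(l < size L) (-1) ^+ t *+ 'C(t, l) * W n t (t - l)%N l
   @[n --> \oo] --> \sum_(t < size L) \sum_(l < size L) \int[mu]_x F l t x.
  apply: cvgr_sum => t _; apply: cvgr_sum => l _.
  have [Gi Gc] := @core_limit t (t - l) l (leq_trans (leq_subr _ _) (sT t)) (sT l).
  by rewrite /F RintegralZl//; apply: cvgMr.
move: cW; rewrite (_ : (fun n => _) = (fun=> 0)); last exact/funext.
by move=> /(cvg_lim (@Rhausdorff R)) <-; rewrite lim_cst.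
Qed.

End Limit.

End Core.

(** * Densities and the adjoint operator *)

Section AdjointDegree.
Variables (R : realType) (L : diffop R) (Q : {poly R}).
Hypothesis Q0 : Q != 0.
Hypothesis L0 : L != 0.
Notation T := (Defs.order L).
Notation S := (adjoint_op L Q).

Lemma size_adjoint_op : size S = size L.
Proof.
have sL : size L = T.+1 by rewrite /Defs.order prednK// size_poly_gt0.
have TL : (T < size L)%N by rewrite sL.
rewrite /adjoint_op; apply: size_poly_eq; rewrite -/T.
rewrite (bigD1 (Ordinal TL))//= subnn derivn0 binn mulr1n big1 ?addr0; last first.
  move=> t tT; rewrite bin_small ?mulr0n// ltn_neqAle -ltnS -sL ltn_ord andbT.
  by apply: contra tT => /eqP tT; apply/eqP/val_inj.
rewrite -polyC1 -polyCN -polyC_exp mulf_neq0 ?polyC_eq0 ?signr_eq0//.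
by rewrite mulf_neq0 ?expf_neq0// -/(lead_coef L) lead_coef_eq0.
Qed.

Variable D : nat.
Hypothesis LD : forall t : nat, (size (L`_t)%R <= D.+1)%N.
Let A := (D + 2 * T.+3 * (size Q).-1)%N.

Lemma size_Qexp : size ((Q ^+ 2) ^+ T.+3)%R = (2 * T.+3 * (size Q).-1).+1.
Proof. by rewrite -exprM; rewrite [(_ * _.-1)%N]mulnC -size_exp;
  rewrite prednK// size_poly_gt0 expf_neq0. Qed.

Lemma size_adjoint_coef_le t : (size ((Q ^+ 2) ^+ T.+3 * L`_t)%R <= A.+1)%N.
Proof.
rewrite (leq_trans (size_polyMleq _ _))// size_Qexp.
by rewrite addSn /= addnC /A -addSn leq_add2r LD.
Qed.

(** Only the summand t = i reaches degree A: for t < i the binomial coefficient is zero, and for t >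
    i the t - i derivatives lower the degree. *)
Lemma coef_adjoint_top (i : nat) : (i < size L)%N -> size (L`_i)%R = D.+1 ->
  (S`_i)`_A != 0.
Proof.
move=> iL sLi; rewrite coef_poly iL.
rewrite (bigD1 (Ordinal iL))//= coefD subnn derivn0 binn mulr1n [X in _ + X]coef_sum
  big1; last first.
  move=> t /eqP ti; have [tl|tl|tl] := ltngtP t i.
  - by rewrite bin_small// mulr0n coef0.
  - rewrite coefMn -polyC1 -polyCN -polyC_exp coefCM.
    rewrite [X in _ * X]nth_default ?mulr0 ?mul0rn//.
    rewrite (leq_trans (size_derivn _ _))// leq_subLR (leq_trans (size_adjoint_coef_le
      t))//.
    by rewrite -add1n leq_add2r subn_gt0.
  - by case: ti; apply: val_inj.
rewrite addr0 -polyC1 -polyCN -polyC_exp coefCM mulf_neq0 ?signr_eq0//.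
have Li0 : (L`_i)%R != 0 by rewrite -size_poly_gt0 sLi.
have : size ((Q ^+ 2) ^+ T.+3 * L`_i) = A.+1.
  by rewrite size_mul ?expf_neq0// size_Qexp sLi addSn /= addnS addnC.
move=> sA; have : lead_coef ((Q ^+ 2) ^+ T.+3 * L`_i) != 0.
  by rewrite lead_coef_eq0 mulf_neq0 ?expf_neq0.
by rewrite /lead_coef sA.
Qed.

(** The adapted class controls x^a f^(j) only for a <= [coef_deg S]; this brings the exponent A of
    [cutoff_bound] within its reach. *)
Lemma coef_deg_adjoint i : (i < size L)%N -> size (L`_i)%R = D.+1 ->
  (A <= coef_deg S)%N.
Proof.
move=> iL sLi; have := coef_adjoint_top iL sLi => Si.
have iS : (i < size S)%N by rewrite size_adjoint_op.
rewrite /coef_deg; apply: leq_trans (leq_bigmax (Ordinal iS)) => /=.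
rewrite -ltnS; case: (ltnP A (size (S`_i)%R)) => [AS|/(nth_default 0) e].
  by rewrite prednK// (leq_trans _ AS).
by rewrite e eqxx in Si.
Qed.

End AdjointDegree.

Section Density.
Context {d : measure_display} {Om : measurableType d} {R : realType}.
Variables (P : probability Om R) (X : {RV P >-> R}) (p : R -> R).
Hypothesis pd : is_density X p.
Notation mu := (@lebesgue_measure R).
Local Open Scope ereal_scope.

Lemma density_integrable1 : mu.-integrable setT (EFin \o p).
Proof.
have [mp p0 pA] := pd; apply/integrableP; split; first exact/measurable_EFinP.
have := pA setT measurableT; rewrite probability_setT => e.
under eq_integral do rewrite /= ger0_norm//.
by rewrite -e ltry.
Qed.

(** A density has the same integrals over measurable sets as the Radon-Nikodym derivative of the
    law, hence equals it almost everywhere, and the change of variables for the latter applies. *)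
Lemma density_integral_ge0 (g : R -> R) : measurable_fun setT g ->
  (forall x, 0 <= g x)%R ->
  \int[P]_w (g (X w))%:E = \int[mu]_x (g x * p x)%:E.
Proof.
move=> mg g0; have [mp p0 pA] := pd.
have mX : measurable_fun setT (X : Om -> measurableTypeR R) := measurable_funP X.
pose X' : {RV P >-> measurableTypeR R} :=
  MeasurableFun.Pack (MeasurableFun.Class (isMeasurableFun.Build _ _ _ _ _ mX)).
pose nu : {finite_measure set (measurableTypeR R) -> \bar R} := distribution P X'.
pose la : {sigma_finite_measure set (measurableTypeR R) -> \bar R} := mu.
have dom : nu `<< la.
  apply/null_content_dominatesP => A mA A0; rewrite [nu A]pA//.
  by rewrite null_set_integral//; apply: measurable_funTS; exact/measurable_EFinP.
transitivity (\int[nu]_x (g x)%:E).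
  by rewrite /nu (@ge0_integral_distribution _ _ _ _ _ P X' (EFin \o g))//;
    exact/measurable_EFinP.
rewrite -(Radon_Nikodym_SigmaFinite.change_of_variables dom)//;
  last exact/measurable_EFinP.
have mf : measurable_fun setT (Radon_Nikodym_SigmaFinite.f nu la).
  exact: measurable_int (Radon_Nikodym_SigmaFinite.f_integrable dom).
apply: ae_eq_integral => //.
- by apply: emeasurable_funM => //; exact/measurable_EFinP.
- by apply/measurable_EFinP; exact: measurable_funM.
- have : ae_eq mu setT (Radon_Nikodym_SigmaFinite.f nu la) (EFin \o p).
    apply: integral_ae_eq => //.
    + exact: Radon_Nikodym_SigmaFinite.f_integrable.
    + exact/measurable_EFinP.
    + by move=> E _ mE; rewrite -Radon_Nikodym_SigmaFinite.f_integral//; exact: pA.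
  apply: (@filterS _ _ (ae_filter_ringOfSetsType mu)) => x /= e _.
  by rewrite e// EFinM.
Qed.

Lemma density_integrable (g : R -> R) : measurable_fun setT g ->
  P.-integrable setT (EFin \o (g \o X)) <->
  mu.-integrable setT (EFin \o (fun x => g x * p x)%R).
Proof.
move=> mg; have [mp p0 pA] := pd.
have e : \int[P]_w `|(EFin \o (g \o X)) w| =
         \int[mu]_x `|(EFin \o (fun x => g x * p x)%R) x|.
  transitivity (\int[mu]_x (`|g x| * p x)%:E).
    by rewrite -(@density_integral_ge0 (fun x => `|g x|)%R)//; exact: measurableT_comp.
  by apply: eq_integral => x _; rewrite /= normrM (ger0_norm (p0 x)).
split => /integrableP[mf fi]; apply/integrableP; split; [|by rewrite -e| |by rewrite e].
  by apply/measurable_EFinP; exact: measurable_funM.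
by apply/measurable_EFinP; apply: measurableT_comp.
Qed.

Lemma density_expectation (g : R -> R) : measurable_fun setT g ->
  'E_P[g \o X] = \int[mu]_x (g x * p x)%:E.
Proof.
move=> mg; have [mp p0 pA] := pd.
rewrite unlock integralE [RHS]integralE; congr (_ - _).
- transitivity (\int[P]_w (Num.max (g (X w)) 0)%:E).
    by apply: eq_integral => w _; rewrite funeposE EFin_max.
  rewrite (@density_integral_ge0 (fun x => Num.max (g x) 0)%R).
  + apply: eq_integral => x _; rewrite funeposE -EFin_max.
    by rewrite maxr_pMl// mul0r.
  + exact: measurable_maxr.
  + by move=> x; rewrite le_max lexx orbT.
- transitivity (\int[P]_w (Num.max (- g (X w)) 0)%:E).
    by apply: eq_integral => w _; rewrite funenegE EFin_max.
  rewrite (@density_integral_ge0 (fun x => Num.max (- g x) 0)%R).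
  + apply: eq_integral => x _; rewrite funenegE -EFinN -EFin_max.
    by rewrite maxr_pMl// mul0r mulNr.
  + by apply: measurable_maxr => //; exact: measurableT_comp.
  + by move=> x; rewrite le_max lexx orbT.
Qed.

End Density.

(** * Stein operators of random variables with a density *)

Section DerivIn.
Variable R : realType.
Implicit Types (f : R -> R) (D : set R) (x : R).

Lemma diffquot_nbhs D f x : nbhs x D ->
  diffquot D f x = (fun h => h^-1 * (f (h + x) - f x)) @ 0^'.
Proof.
move=> xD; rewrite eqEsubset; split => A; rewrite /diffquot /fmap /dnbhs /within /= =>
  H.
  have {}H : \forall y \near x, y != x -> D y -> A ((y - x)^-1 * (f y - f x)).
    by exact: H.
  have {}H : \forall y \near x, y != x -> A ((y - x)^-1 * (f y - f x)).
    by move: H xD; apply: filterS2 => y Hy Dy yx; exact: Hy.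
  rewrite (near_shift 0) subr0 in H; move: H; apply: filterS => h /= Ah h0.
  by have := Ah; rewrite addrK; apply; rewrite -subr_eq0 addrK.
have {}H : \forall h \near (0 : R), h != 0 -> A (h^-1 * (f (h + x) - f x)) by exact: H.
rewrite (near_shift x) sub0r in H; move: H; apply: filterS => y /= Ay yx _.
by move: Ay; rewrite subrK; apply; rewrite subr_eq0.
Qed.

Lemma is_derive_diffquot D f x : nbhs x D -> cvg (diffquot D f x) ->
  is_derive x 1 f (deriv_in D f x).
Proof.
move=> xD c; have fd : derivable f x 1.
  have := c; rewrite (diffquot_nbhs f xD) /derivable.
  by under [X in _ -> cvg (X @ _)]eq_fun => h do rewrite /= [h *: 1]mulr1.
by rewrite (deriv_in_nbhs f xD) derive1E; exact: derivableP.
Qed.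

End DerivIn.

Section LocallyBounded.
Variable R : realType.

(** Meant for boundary points of the support: there g, a derivative of a test function cut off
    outside the support, may jump but stays bounded, while u, a derivative of p, vanishes.
    [is_derive_mul_bounded] serves the same purpose. *)
Lemma continuous_mul_bounded (u g : R -> R) (x M : R) : {for x, continuous u} ->
  u x = 0 ->
  (\forall y \near x, `|g y| <= M) -> {for x, continuous (fun y => u y * g y)}.
Proof.
move=> uc ux gM; rewrite /prop_for /continuous_at ux mul0r.
apply: norm_cvg0.
have uM : `|u y| * M @[y --> x] --> 0.
  rewrite -(mul0r M); apply: cvgMl.
  have un : (`|u y| @[y --> x] --> `|u x|) by exact: cvg_norm.
  by move: un; rewrite ux normr0.
apply: (@squeeze_cvgr _ _ _ _ (fun=> 0) (fun y => `|u y| * M)) => //;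
  last exact: cvg_cst.
by near=> y; rewrite normr_ge0 normrM ler_wpM2l//; near: y.
Unshelve. all: by end_near. Qed.

Lemma is_derive_mul_bounded (u g : R -> R) (x M : R) : is_derive x 1 u 0 -> u x = 0 ->
  (\forall y \near x, `|g y| <= M) -> is_derive x 1 (fun y => u y * g y) 0.
Proof.
move=> /is_derive1_caratheodory[phi [ephi cphi phix]] ux gM.
apply/is_derive1_caratheodory; exists (fun y => phi y * g y); split.
- by move=> z; have := ephi z; rewrite ux mul0r !subr0 => ->; rewrite mulrAC.
- exact: continuous_mul_bounded gM.
- by rewrite phix mul0r.
Qed.

Lemma within_continuous_bounded (I : set R) (f : R -> R) (x : R) : I x ->
  {within I, continuous f} -> \forall y \near x, `|(f \_ I) y| <= `|f x| + 1.
Proof.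
move=> Ix fc; have := fc x; rewrite /continuous_at => fcx.
have : \forall y \near within I (nbhs x), `|f x - f y| < 1.
  have fw : f y @[y --> within I (nbhs x)] --> f x.
    by rewrite (nbhs_subspace_in Ix); exact: fcx.
  by move/cvgrPdist_lt : fw; apply.
rewrite near_withinE; apply: filterS => y fy; rewrite patchE.
case: ifPn => [/set_mem/fy {}fy|_]; last by rewrite normr0 addr_ge0.
by rewrite -lerBlDl (le_trans (lerB_dist _ _))// distrC ltW.
Qed.

End LocallyBounded.

Lemma restrict_setT (R : realType) (h : R -> R) : h \_ setT = h.
Proof. by apply/funext => x; rewrite patchE in_setT. Qed.

Section Stein.
Context {d : measure_display} {Om : measurableType d} {R : realType}.
Variables (P : probability Om R) (X : {RV P >-> R}) (p : R -> R).
Hypothesis pd : is_density X p.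
Variables (L : diffop R) (Q : {poly R}).
Hypothesis Q0 : Q != 0.
Hypothesis L1 : (1 <= Defs.order L)%N.
Hypothesis pder : forall k (x : R), Q.[x] != 0 ->
  is_derive x 1 (derive1n k p) (derive1n k.+1 p x).
Hypothesis pode : forall x, Q.[x] != 0 ->
  \sum_(t < size L) (L`_t).[x] * derive1n t p x = 0.
Notation mu := (@lebesgue_measure R).
Notation T := (Defs.order L).
Notation S := (adjoint_op L Q).

Let L0 : L != 0.
Proof. by apply: contraTneq L1 => ->; rewrite /Defs.order size_poly0. Qed.

Lemma exprD1_bound (y : R) n : 0 <= y -> (1 + y) ^+ n <= 2 ^+ n * (1 + y ^+ n).
Proof.
move=> y0; rewrite mulrDr mulr1; have [y1|y1] := leP y 1.
  rewrite (@le_trans _ _ (2 ^+ n))//; last by rewrite lerDl mulr_ge0 ?exprn_ge0.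
  by rewrite lerXn2r ?nnegrE ?addr_ge0//; lra.
rewrite (@le_trans _ _ (2 ^+ n * y ^+ n))//; last by rewrite lerDr exprn_ge0.
by rewrite -exprMn lerXn2r ?nnegrE ?addr_ge0 ?mulr_ge0//; lra.
Qed.

Lemma max_coef_size : exists D, (forall t : nat, (size (L`_t)%R <= D.+1)%N) /\
  exists2 i, (i < size L)%N & size (L`_i)%R = D.+1.
Proof.
pose D := (\max_(t < size L) size (L`_t)%R)%N.
have sL : (0 < size L)%N by rewrite size_poly_gt0.
have [i iD] := @bigop.eq_bigmax 'I_(size L) (fun t =>
  size (L`_t)%R) ltac:(by rewrite card_ord).
have Ds t : (size (L`_t)%R <= D)%N.
  case: (ltnP t (size L)) => [tL|/(nth_default 0)->]; last by rewrite size_poly0.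
  exact: (leq_bigmax (Ordinal tL)).
have D0 : (0 < D)%N.
  apply: leq_trans (Ds T); rewrite size_poly_gt0.
  by rewrite -/(lead_coef L) lead_coef_eq0.
exists D.-1; split; first by move=> t; rewrite prednK.
by exists i => //; rewrite prednK.
Qed.

Section SteinIdentity.
Variables (I : set R) (f : R -> R).
Let g j := (derivn_in I j f) \_ I.
Hypothesis g_meas : forall j, (j <= T)%N -> measurable_fun setT (g j).
Hypothesis g_int : forall a j, (a <= coef_deg S)%N -> (j <= T)%N ->
  P.-integrable setT (EFin \o (((fun x => x ^+ a * derivn_in I j f x) \_ I) \o X)).
Hypothesis g_der : forall k j (x : R), (j < T)%N -> Q.[x] != 0 ->
  is_derive x 1 (fun y => derive1n k p y * g j y)
    (derive1n k.+1 p x * g j x + derive1n k p x * g j.+1 x).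
Hypothesis g_cont : forall k j (x : R), (j <= T)%N -> Q.[x] != 0 ->
  {for x, continuous (fun y => derive1n k p y * g j y)}.

(** Shared by the classes on the whole line and the adapted class. Regularity is asked of the
    products p^(k) g_j only, since the g_j themselves may be discontinuous at the boundary of I. *)
Lemma stein_identity : let Sf := op_apply I S f \_ I in
  P.-integrable setT (EFin \o (Sf \o X)) /\ ('E_P[Sf \o X] = 0)%E.
Proof.
move=> Sf; have [mp p0 _] := pd.
have sL : size L = T.+1 by rewrite /Defs.order prednK// size_poly_gt0.
pose pf k j x := derive1n k p x * g j x.
have SfE x : Sf x * p x = \sum_(l < size L) (S`_l).[x] * pf 0%N l x.
  rewrite /Sf patchE /pf /g /op_apply size_adjoint_op//.
  under [RHS]eq_bigr do rewrite patchE.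
  case: ifPn => _; last by rewrite mul0r big1// => l _; rewrite /= !mulr0.
  by rewrite mulr_suml; apply: eq_bigr => l _; rewrite -mulrA [_ * p x]mulrC.
have mSf : measurable_fun setT Sf.
  rewrite (_ : Sf = fun x => \sum_(l < size L) (S`_l).[x] * g l x); last first.
    apply/funext => x; rewrite /Sf patchE /op_apply size_adjoint_op// /g.
    under [RHS]eq_bigr do rewrite patchE.
    by case: ifPn => // _; rewrite big1// => l _; rewrite mulr0.
  apply: measurable_sum => l; apply: measurable_funM.
    by apply: continuous_measurable_fun; exact: continuous_horner.
  by apply: g_meas; rewrite -ltnS -sL.
have [D [LD [i iL iD]]] := max_coef_size.
set A := (D + 2 * T.+3 * (size Q).-1)%N.
have AS : (A <= coef_deg S)%N by exact: coef_deg_adjoint iL iD.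
have gi a j : (a <= coef_deg S)%N -> (j <= T)%N ->
    mu.-integrable setT (EFin \o (fun x => x ^+ a * g j x * p x)).
  move=> aS jT; apply/(density_integrable pd).
    by apply: measurable_funM; [exact: measurable_funX|exact: g_meas].
  move: (g_int aS jT); rewrite /g; apply: eq_integrable => // w _ /=.
  by congr EFin; rewrite !patchE; case: ifPn => //; rewrite mulr0.
have [||||pi pi0] := @adjoint_op_integral R L Q Q0 L0 pf _ _ _ _ D LD _.
- by move=> k j x _ jT Qx; exact: g_cont.
- move=> x Qx; rewrite /pf.
  under eq_bigr do rewrite mulrA.
  by rewrite -mulr_suml pode// mul0r.
- move=> j jT; apply: measurable_funM => //; exact: g_meas.
- move=> j jT.
  (* The weight (1 + |x|)^A is dominated by the moments of order 0 and A, both allowed by A <=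
     [coef_deg S]. *)
  apply: (@intR_le _ _ _ mu setT measurableT _
     (fun x => 2 ^+ A * (`|x ^+ 0 * g j x * p x| + `|x ^+ A * g j x * p x|))).
  + apply: measurable_funM; last by apply: measurable_funM => //; exact: g_meas.
    apply: measurable_funX; apply: measurable_funD => //.
  + move=> x _.
    have -> : `|x ^+ 0 * g j x * p x| + `|x ^+ A * g j x * p x| =
        (1 + `|x| ^+ A) * (`|p x| * `|g j x|).
      by rewrite expr0 mul1r !normrM normrX; ring.
    have x0 : 0 <= 1 + `|x| by rewrite addr_ge0.
    rewrite /pf normrM normrX (ger0_norm x0) normrM [leRHS]mulrA.
    by rewrite ler_wpM2r ?mulr_ge0// exprD1_bound.
  + apply: intRZ => //; apply: intRD => //; apply: intR_abs => //; exact: gi.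
split.
  apply/(density_integrable pd) => //.
  by move: pi; apply: eq_integrable => // x _ /=; rewrite SfE.
rewrite (density_expectation pd)//.
under eq_integral do rewrite SfE.
move: pi0; rewrite /Rintegral => pi0.
by rewrite -[LHS]fineK ?pi0//; exact: integrable_fin_num pi.
Qed.

End SteinIdentity.

Lemma order_adjoint_op : (1 <= Defs.order S)%N.
Proof. by rewrite /Defs.order size_adjoint_op. Qed.

Lemma smooth_is_derive (f : R -> R) : smooth f ->
  forall n (x : R), is_derive x 1 (derive1n n f) (derive1n n.+1 f x).
Proof. by move=> sf n x; rewrite derive1nS derive1E; apply: derivableP; exact: sf. Qed.

Lemma stein_smooth (f : R -> R) : smooth f ->
  (forall a j, P.-integrable setT (EFin \o (fun w => X w ^+ a * derive1n j f (X w)))) ->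
  let Sf := op_apply setT S f \_ setT in
  P.-integrable setT (EFin \o (Sf \o X)) /\ ('E_P[Sf \o X] = 0)%E.
Proof.
move=> sf fi; have gE j : derivn_in setT j f \_ setT = derive1n j f.
  by rewrite restrict_setT derivn_in_setT.
have fc j : continuous (derive1n j f).
  by move=> x; exact: is_derive1_continuous (smooth_is_derive sf j x).
apply: stein_identity.
- by move=> j _; rewrite gE; exact: continuous_measurable_fun.
- by move=> a j _ _; rewrite restrict_setT derivn_in_setT; exact: fi.
- by move=> k j x _ Qx; rewrite !gE; apply: is_derive1M;
  [exact: pder|exact: smooth_is_derive].
- move=> k j x _ Qx; rewrite !gE; apply: cvgM; last exact: fc.
  exact: is_derive1_continuous (pder k Qx).
Qed.

Lemma mom_integrable (g : R -> R) (C : R) n : all_moments X -> measurable_fun setT g ->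
  (forall x, `|g x| <= C * (1 + `|x|) ^+ n) ->
  P.-integrable setT (EFin \o (g \o X)).
Proof.
move=> mX mg gC.
apply: (@intR_le _ _ _ P setT measurableT _ (fun w =>
  `|C| * 2 ^+ n * (`|X w ^+ 0| + `|X w ^+ n|))).
- exact: measurableT_comp.
- move=> w _ /=; rewrite (le_trans (gC _))// expr0 normr1 normrX.
  rewrite -mulrA (le_trans (ler_wpM2r _ (ler_norm C))) ?exprn_ge0 ?addr_ge0//.
  by rewrite ler_wpM2l// exprD1_bound.
- apply: intRZ => //; apply: intRD => //; apply: intR_abs => //; exact: mX.
Qed.

Lemma adjoint_schwartz : PSO X (@schwartz R) S.
Proof.
split; first by right; exact: order_adjoint_op.
move=> f [sf fb]; apply: stein_smooth => // a j; have [M Mf] := fb a j.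
apply: (@intR_le _ _ _ P setT measurableT _ (fun=> M)).
- apply: measurable_funM; first exact: measurable_funX.
  apply: measurableT_comp => //; apply: continuous_measurable_fun => x.
  exact: is_derive1_continuous (smooth_is_derive sf j x).
- by move=> w _; exact: Mf.
- exact: finite_measure_integrable_cst.
Qed.

Lemma adjoint_poly_growth : all_moments X -> PSO X (@poly_growth R) S.
Proof.
move=> mX; split; first by right; exact: order_adjoint_op.
move=> f [sf fb]; apply: stein_smooth => // a j; have [n n1 [M Mf]] := fb j.
apply: (@mom_integrable (fun x => x ^+ a * derive1n j f x) `|M| (a + n)) => //.
  apply: measurable_funM; first exact: measurable_funX.
  apply: continuous_measurable_fun => x.
  exact: is_derive1_continuous (smooth_is_derive sf j x).
move=> x; have x1 : 0 < 1 + `|x| ^+ n by rewrite ltr_pwDl// exprn_ge0.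
have := Mf x; rewrite normrM normfV (gtr0_norm x1) ler_pdivrMl// => Mfx.
rewrite normrM normrX exprD mulrCA.
apply: ler_pM => //.
  by rewrite lerXn2r ?nnegrE ?addr_ge0// lerDr.
rewrite mulrC (le_trans Mfx)// (le_trans (ler_wpM2l (ltW x1) (ler_norm M)))//.
rewrite ler_wpM2r// -[X in X + _](expr1n _ n).
elim: n n1 {Mfx x1 Mf} => // n ih _; case: n ih => [|n] ih; first by rewrite !expr1.
apply: (@le_trans _ _ ((1 + `|x|) * (1 ^+ n.+1 + `|x| ^+ n.+1))); last first.
  by rewrite [leRHS]exprS ler_wpM2l ?addr_ge0// ih.
by rewrite !expr1n mulrDr mulr1 mulrDl mul1r -exprS -addrA lerD2l;
  have := exprn_ge0 n.+1 (normr_ge0 x); have := normr_ge0 x; lra.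
Qed.

Lemma poly_funs_growth : @poly_funs R `<=` @poly_growth R.
Proof.
move=> _ [q _ <-].
have dq n : derive1n n (fun x : R => q.[x]) = (fun x => (q^`(n)).[x]).
  elim: n => [|n ih]; first by rewrite derivn0.
  rewrite derive1nS ih; apply/funext => x; rewrite derivnS.
  exact: is_derive1E (is_derive_horner _ _).
split; first by move=> n x; rewrite dq; exact: derivable_horner.
move=> b; exists (size q).+1 => //; rewrite dq.
have [C C0 Cq] := @poly_bound R q^`(b) (size q).+1 ltac:(
  by rewrite (leq_trans (size_derivn _ _))// (leq_trans (leq_subr _ _))// ltnW// ltnW).
exists (C * 2 ^+ (size q).+1) => x.
have x1 : 0 < 1 + `|x| ^+ (size q).+1 by rewrite ltr_pwDl// exprn_ge0.
rewrite normrM normfV (gtr0_norm x1) ler_pdivrMl// mulrC -mulrA.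
by rewrite (le_trans (Cq x))// ler_wpM2l// exprD1_bound.
Qed.

Lemma adjoint_poly_funs : all_moments X -> PSO X (@poly_funs R) S.
Proof.
move=> /adjoint_poly_growth[oS h]; split => // f /poly_funs_growth; exact: h.
Qed.

Local Notation I := (RV_support X).

Lemma closed_RV_support : closed I.
Proof.
rewrite -[I]setCK; apply: open_closedC; rewrite openE => x /= nIx.
have [e [e0 Pe]] : exists e : R, 0 < e /\ ~ (0 < P (X @^-1` ball x e))%E.
  by apply: contrapT => h; apply: nIx => e e0; apply: contrapT => Pe; apply: h;
    exists e.
exists e => //= y xy Iy; have xy0 : 0 < e - `|x - y| by rewrite subr_gt0.
apply: Pe; apply: lt_le_trans (Iy _ xy0) _; apply: le_measure; rewrite ?inE.
- by rewrite -[X in measurable X]setTI; apply: measurable_funP => //;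
  exact: measurable_ball.
- by rewrite -[X in measurable X]setTI; apply: measurable_funP => //;
  exact: measurable_ball.
- move=> w /=; rewrite /ball/= => yw.
  rewrite (le_lt_trans (ler_distD y _ _))// -ltrBrDl.
  exact: yw.
Qed.

Lemma near_notin_support (x : R) : ~ I x -> \forall y \near x, ~ I y.
Proof. by move=> nIx; apply: open_nbhs_nbhs; split => //;
  exact: closed_openC closed_RV_support. Qed.

(** Where Q is nonzero p is continuous, so a positive value would give every small ball around x a
    mass of at least p x / 2 times its length. *)
Lemma density_notin_support (x : R) : Q.[x] != 0 -> ~ I x -> p x = 0.
Proof.
move=> Qx nIx; have [mp p0 pA] := pd; apply/eqP; apply: contrapT => /negP px.
have {}px : 0 < p x by rewrite lt_neqAle eq_sym px p0.
have [e [e0 Pe]] : exists e : R, 0 < e /\ ~ (0 < P (X @^-1` ball x e))%E.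
  by apply: contrapT => h; apply: nIx => e e0; apply: contrapT => Pe; apply: h;
    exists e.
have pc : {for x, continuous p} by exact: is_derive1_continuous (pder 0 Qx).
have px2 : p x / 2 < p x by rewrite ltr_pdivrMr// ltr_pMr// ltr1n.
have [r /= r0 rp] : \forall y \near x, p x / 2 < p y by apply: cvgr_gt pc _ px2.
pose m := Num.min r e; have m0 : 0 < m by rewrite lt_min r0 e0.
apply: Pe; apply: (@lt_le_trans _ _ (P (X @^-1` ball x m))); last first.
  apply: le_measure; rewrite ?inE.
  - by rewrite -[X in measurable X]setTI; apply: measurable_funP => //;
    exact: measurable_ball.
  - by rewrite -[X in measurable X]setTI; apply: measurable_funP => //;
    exact: measurable_ball.
  - by move=> w /=; apply: le_ball; rewrite ge_min lexx orbT.
have -> : P (X @^-1` ball x m) = distribution P X (ball x m) by [].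
rewrite pA; last exact: measurable_ball.
apply: (@lt_le_trans _ _ (\int[mu]_(y in ball x m) (p x / 2)%:E)%E).
  rewrite integral_cst; last exact: measurable_ball.
  rewrite [X in (_ * X)%E](_ : _ = (m *+ 2)%:E);
    last exact: lebesgue_measure_ball (ltW m0).
  rewrite -EFinM lte_fin.
  by rewrite mulr_gt0 ?divr_gt0// mulrn_wgt0.
apply: ge0_le_integral => //.
- exact: measurable_ball.
- by move=> y _; rewrite lee_fin divr_ge0// ltW.
- by apply/measurable_EFinP; exact: measurable_funTS.
- move=> y xy; rewrite lee_fin ltW//; apply: rp.
  by move: xy; apply: le_ball; rewrite ge_min lexx.
Qed.

Lemma derive1n_notin_support k (x : R) : Q.[x] != 0 -> ~ I x -> derive1n k p x = 0.
Proof.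
elim: k x => [|k ih] x Qx nIx; first exact: density_notin_support.
rewrite derive1nS; apply: is_derive1E.
apply: is_derive_near_eq (is_derive_cst (0 : R) x 1).
near=> y; rewrite ih//; near: y; [exact: near_poly_neq0|exact: near_notin_support].
Unshelve. all: by end_near. Qed.

(** By continuity, a nonzero value of p^(k) at x persists on a neighbourhood, which must then lie in
    the support. So integration by parts leaves nothing at the boundary. *)
Lemma derive1n_boundary_support k (x : R) : Q.[x] != 0 -> ~ nbhs x I ->
  derive1n k p x = 0.
Proof.
move=> Qx nIx; apply/eqP; apply: contrapT => /negP px; apply: nIx.
have pc : {for x, continuous (derive1n k p)} by exact: is_derive1_continuous (pder k
  Qx).
have : \forall y \near x, derive1n k p y != 0 by exact: cvgr_neq0 _ pc px.
have := near_poly_neq0 Qx; apply: filterS2 => y Qy py; apply: contrapT => nIy.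
by move: py; rewrite derive1n_notin_support// eqxx.
Qed.

Lemma adjoint_adapted : PSO_adapted X S.
Proof.
split; first by right; exact: order_adjoint_op.
have oS : Defs.order S = T by rewrite /Defs.order size_adjoint_op.
move=> f; rewrite /adapted_class /= oS => -[fder fcont fint].
have fb j (x : R) : (j <= T)%N -> I x ->
    \forall y \near x, `|(derivn_in I j f \_ I) y| <= `|derivn_in I j f x| + 1.
  by move=> jT Ix; apply: within_continuous_bounded => //; exact: fcont.
have near_out j (x : R) : ~ I x -> \forall y \near x, (derivn_in I j f \_ I) y = 0.
  move=> nIx; apply: filterS (near_notin_support nIx) => y nIy.
  by rewrite patchE memNset.
have near_in j (x : R) : nbhs x I -> \forall y \near x,
  (derivn_in I j f \_ I) y = derivn_in I j f y.
  by apply: filterS => y Iy; rewrite patchE mem_set.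
apply: stein_identity => //.
- move=> j jT; have mI : measurable I by exact: closed_measurable closed_RV_support.
  apply/(measurable_restrictT _ mI); apply: subspace_continuous_measurable_fun => //.
  exact: fcont.
- move=> k j x jT Qx.
  (* At interior points the derivatives relative to I are the ordinary ones. At all others the
     derivatives of p vanish: on the boundary local boundedness of f^(j) suffices, and outside the
     closed support the product is locally zero. *)
  have [nIx|nIx] := pselect (nbhs x I).
    have gx j' := nbhs_singleton (near_in j' x nIx).
    rewrite !gx; have dg : is_derive x 1 (derivn_in I j f) (derivn_in I j.+1 f x).
      by apply: is_derive_diffquot => //; apply: fder => //; exact: nbhs_singleton.
    apply: is_derive_near_eq (is_derive1M (pder k Qx) dg).
    by near=> y; congr (_ * _); rewrite (near (near_in j x nIx) y).
  rewrite !(derive1n_boundary_support _ Qx nIx) !mul0r addr0.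
  have [Ix|Ix] := pselect (I x).
    apply: is_derive_mul_bounded (fb j x (ltnW jT) Ix).
      by have := pder k Qx; rewrite (derive1n_boundary_support k.+1 Qx nIx).
    exact: derive1n_boundary_support.
  apply: is_derive_near_eq (is_derive_cst (0 : R) x 1).
  by near=> y; rewrite (near (near_out j x Ix) y)// mulr0.
- move=> k j x jT Qx.
  have pc : {for x, continuous (derive1n k p)} by exact: is_derive1_continuous (pder k
    Qx).
  have [nIx|nIx] := pselect (nbhs x I).
    have gc : {for x, continuous (derivn_in I j f)}.
      have := fcont j jT x; rewrite /continuous_at /prop_for.
      by rewrite -(nbhs_subspace_interior nIx).
    have hc : {for x, continuous (fun y => derive1n k p y * derivn_in I j f y)} by
      exact: cvgM.
    rewrite /prop_for /continuous_at (nbhs_singleton (near_in j x nIx)).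
    apply: cvg_trans hc; apply: near_eq_cvg.
    by near=> y; rewrite (near (near_in j x nIx) y).
  have px := derive1n_boundary_support k Qx nIx.
  have [Ix|Ix] := pselect (I x).
    exact: continuous_mul_bounded (fb j x jT Ix).
  apply: (@is_derive1_continuous _ _ _ 0); apply: is_derive_near_eq (is_derive_cst (0 :
    R) x 1).
  by near=> y; rewrite (near (near_out j x Ix) y)// mulr0.
Unshelve. all: by end_near. Qed.

End Stein.

Lemma common_stein_operator {R : realType} {d : measure_display} {Om : measurableType d}
    (P : probability Om R) (n : nat) (X : 'I_n -> {RV P >-> R}) (p : 'I_n -> R -> R) :
  (forall i, is_density (X i) (p i)) -> (forall i, rational_system (p i)) ->
  \bigcap_(i in [set: 'I_n]) PSO (X i) (@schwartz R) <> [set 0] /\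
  ((forall i, all_moments (X i)) ->
    [/\ \bigcap_(i in [set: 'I_n]) PSO (X i) (@poly_funs R) <> [set 0],
        \bigcap_(i in [set: 'I_n]) PSO (X i) (@poly_growth R) <> [set 0] &
        \bigcap_(i in [set: 'I_n]) PSO_adapted (X i) <> [set 0]]).
Proof.
move=> pd rs; have [L [Q [L1 Q0 LQ]]] := common_annihilator rs.
have pder i k (x : R) : Q.[x] != 0 -> is_derive x 1 (derive1n k (p i)) (derive1n k.+1 (p
  i) x).
  by move=> Qx; have [] := LQ i x Qx.
have pode i (x : R) : Q.[x] != 0 -> \sum_(t < size L) (L`_t).[x] * derive1n t (p i) x =
  0.
  by move=> Qx; have [] := LQ i x Qx.
have S0 (A : set (diffop R)) : A (adjoint_op L Q) -> A <> [set 0].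
  move=> AS A0; move: AS; rewrite A0 /= => S0.
  have L0 : L != 0 by apply: contraTneq L1 => ->; rewrite /Defs.order size_poly0.
  by have := order_adjoint_op Q0 L1; rewrite S0 /Defs.order size_poly0.
split; first by apply: S0 => i _; exact (adjoint_schwartz (pd i) Q0 L1 (pder i) (pode
  i)).
move=> mX; split; apply: S0 => i _.
- exact (adjoint_poly_funs (pd i) Q0 L1 (pder i) (pode i) (mX i)).
- exact (adjoint_poly_growth (pd i) Q0 L1 (pder i) (pode i) (mX i)).
- exact (adjoint_adapted (pd i) Q0 L1 (pder i) (pode i)).
Qed.

(** * Holonomic functions *)

Section RationalSystemFin.
Variable R : realType.

Lemma rational_system_fin (J : finType) (q : {poly R}) (A : J -> J -> {poly R})
    (B : J -> {poly R}) (w : J -> R -> R) (p : R -> R) : q != 0 ->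
  (forall x, q.[x] != 0 ->
    (forall j, is_derive x 1 (w j) ((\sum_k (A j k).[x] * w k x) / q.[x])) /\
    p x = (\sum_k (B k).[x] * w k x) / q.[x]) ->
  rational_system p.
Proof.
move=> q0 wp; exists #|J|, q, (fun j k => A (enum_val j) (enum_val k)),
  (fun k => B (enum_val k)), (fun k => w (enum_val k)); split => // x qx.
have [dw px] := wp x qx; split => [j|].
  apply: is_derive_eq (dw (enum_val j)) _; congr (_ / _).
  by rewrite (reindex _ (onW_bij _ (@enum_val_bij J))).
by rewrite px; congr (_ / _); rewrite (reindex _ (onW_bij _ (@enum_val_bij J))).
Qed.

Lemma finite_set_poly (F : fieldType) (Z : set F) : finite_set Z ->
  exists2 q : {poly F}, q != 0 & forall z, Z z -> q.[z] = 0.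
Proof.
move=> /finite_seqP[r ->]; exists (\prod_(z <- r) ('X - z%:P)).
  exact: monic_neq0 (monic_prod_XsubC _ _ _).
by move=> z /= zr; apply/eqP; rewrite -/(root _ z) root_prod_XsubC.
Qed.

(** Companion system of L with denominator L_T s, where s vanishes on the exceptional set. Off the
    zeros of s a whole neighbourhood avoids that set, and derivatives relative to it are ordinary
    ones. *)
Lemma holonomic_rational_system (p : R -> R) : holonomic setT p -> rational_system p.
Proof.
move=> [Z [L [Zf L0 Ld LZ]]]; pose U := setT `\` Z.
have [s s0 sZ] := finite_set_poly Zf.
pose T := Defs.order L.
have sL : size L = T.+1 by rewrite /T /Defs.order prednK// size_poly_gt0.
have lT : L`_T != 0 by rewrite -/(lead_coef L) lead_coef_eq0.
have Us x : s.[x] != 0 -> U x by move=> sx; split => // /sZ; exact/eqP.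
have nU (x : R) : s.[x] != 0 -> nbhs x U.
  by move=> sx; apply: filterS (near_poly_neq0 sx) => y; exact: Us.
pose A (j k : 'I_T) : {poly R} :=
  if j.+1 == T then - (L`_k * s) else if k == j.+1 :> nat then L`_T * s else 0.
pose B (k : 'I_T) : {poly R} := if k == 0%N :> nat then L`_T * s else 0.
apply: (@rational_system_fin _ (L`_T * s) A B (fun k => derivn_in U k p)).
  by rewrite mulf_neq0.
move=> x; rewrite hornerM mulf_eq0 negb_or => /andP[Lx sx].
have ode := LZ _ (Us _ sx).
have lsx : (L`_T).[x] * s.[x] != 0 by rewrite mulf_neq0.
split => [j|]; last first.
  (* For T = 0 the system is empty, and L says that p vanishes off the zeros of L_0. *)
  case: (posnP T) => T0.
    rewrite big1 ?mul0r; last by move=> k _; suff: false by [];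
      rewrite -(ltn0 k) -T0 ltn_ord.
    have Lx0 : (L`_0).[x] != 0 by rewrite -T0.
    by move: ode; rewrite /op_apply sL T0 big_ord1 => /eqP;
      rewrite mulf_eq0 (negbTE Lx0) => /eqP.
  rewrite (bigD1 (Ordinal T0))//= {1}/B eqxx big1 ?addr0.
    by rewrite hornerM mulrAC divff ?mul1r.
  by move=> k; rewrite -val_eqE/= /B => /negbTE ->; rewrite horner0 mul0r.
have dj : is_derive x 1 (derivn_in U j p) (derivn_in U j.+1 p x).
  by apply: is_derive_diffquot (nU _ sx) _; apply: Ld; [exact: ltn_ord|exact: Us].
apply: is_derive_eq dj _; have [jT|jT] := eqVneq j.+1 T.
  move: ode; rewrite /op_apply sL big_ord_recr/= => /eqP;
    rewrite addrC addr_eq0 => /eqP e.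
  rewrite -[deriv_in U _ x]/(derivn_in U j.+1 p x) jT; apply: (mulfI lsx);
    rewrite [RHS]mulrCA divff// mulr1 mulrAC e mulNr mulr_suml.
  rewrite -sumrN; apply: eq_bigr => k _; rewrite /A jT eqxx hornerN hornerM.
  by rewrite mulNr mulrAC.
have jT' : (j.+1 < T)%N by rewrite ltn_neqAle jT ltn_ord.
rewrite (bigD1 (Ordinal jT'))//= {1}/A (negbTE jT) eqxx big1 ?addr0.
  by rewrite hornerM mulrAC divff ?mul1r.
move=> k; rewrite -val_eqE/= /A (negbTE jT) => /negbTE ->.
by rewrite horner0 mul0r.
Qed.

End RationalSystemFin.

Section ComplexLine.
Variable R : realType.
Local Open Scope complex_scope.
Local Notation C := R[i].
Implicit Types (f : C -> C) (t : R).

Lemma normc_ge_Im (z : C) : `|complex.Im z|%:C <= `|z|.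
Proof.
rewrite normc_def lecR -[X in (X <= _)%R]sqrtr_sqr; apply: ler_wsqrtr.
by case: z => a b /=; rewrite lerDr sqr_ge0.
Qed.

(** [rho] stands for the real or the imaginary part. Along the real line the increments are real, so
    a real-linear contraction commutes with the difference quotients and passes to their limit. *)
Lemma is_derive_complex_line (rho : C -> R) (Z : set C) f t :
  (forall y z, rho (y - z) = rho y - rho z) ->
  (forall (a : R) z, rho (a%:C * z) = a * rho z) ->
  (forall z, `|rho z|%:C <= `|z|) ->
  (\forall s \near t, ~ Z s%:C) ->
  let D := [set z : C | complex.Im z = 0] `\` Z in
  cvg (diffquot D f t%:C) ->
  is_derive t 1 (fun s => rho (f s%:C)) (rho (deriv_in D f t%:C)).
Proof.
move=> rB rZ rn nZ D; rewrite /deriv_in; set l := lim _ => fl.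
suff rl : (fun h => h^-1 * (rho (f (h + t)%:C) - rho (f t%:C))) @ 0^' --> rho l.
  apply: DeriveDef.
    apply/cvg_ex; exists (rho l).
    by under [X in X @ _]eq_fun => h do rewrite /= [h *: 1]mulr1.
  apply/cvg_lim => //.
  by under [X in X @ _]eq_fun => h do rewrite /= [h *: 1]mulr1.
apply/cvgrPdist_lt => e e0.
have e0c : 0 < e%:C :> C by rewrite ltcR.
have := (cvgrPdist_lt _ _).1 fl e%:C e0c.
rewrite near_withinE near_withinE => -[d /= d0 dP].
move: (d0); rewrite ltcE => /andP[/eqP/= dI dR].
have dE : d = (complex.Re d)%:C by case: (d) dI => a b /= ->.
near=> h.
have h0 : h != 0 by near: h; exact: nbhs_dnbhs_neq.
have hD : D (h + t)%:C.
  split => //; near: h; apply: nbhs_dnbhs.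
  by have := nZ; rewrite (near_shift 0) subr0.
have := dP (h + t)%:C _ _ hD.
have hE : (h + t)%:C - t%:C = h%:C :> C by rewrite -rmorphB addrK.
rewrite hE -fmorphV /= => H.
rewrite -ltcR; apply: le_lt_trans (H _ _).
- by rewrite -rB -rZ -rB.
- rewrite distrC hE normc_def /= expr0n addr0 sqrtr_sqr dE ltcR.
  by near: h; apply: dnbhs0_lt.
- by rewrite -subr_eq0 hE; apply: contra h0 => /eqP[->].
Unshelve. all: by end_near. Qed.

Lemma horner_Re (q : {poly C}) (t : R) :
  complex.Re q.[t%:C] = (map_poly (@complex.Re R) q).[t].
Proof.
rewrite (@horner_coef_wide _ (size q) (map_poly _ q)) ?size_poly//
  horner_coef raddf_sum.
apply: eq_bigr => i _; rewrite coef_map_id0// -rmorphXn /=.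
by case: q`_i => a b /=; rewrite mulr0 subr0.
Qed.

Lemma horner_Im (q : {poly C}) (t : R) :
  complex.Im q.[t%:C] = (map_poly (@complex.Im R) q).[t].
Proof.
rewrite (@horner_coef_wide _ (size q) (map_poly _ q)) ?size_poly//
  horner_coef raddf_sum.
apply: eq_bigr => i _; rewrite coef_map_id0// -rmorphXn /=.
by case: q`_i => a b /=; rewrite mulr0 add0r.
Qed.

(** On the real line the sum is |q|^2, a real polynomial that replaces q as a denominator. If it is
    zero, both parts vanish at every real point, in particular at more points than their degrees
    allow. *)
Lemma poly_neq0_Re_Im (q : {poly C}) : q != 0 ->
  (map_poly (@complex.Re R) q) ^+ 2 + (map_poly (@complex.Im R) q) ^+ 2 != 0.
Proof.
apply: contra_neq => e.
have e0 t : (map_poly (@complex.Re R) q).[t] = 0 /\ (map_poly (@complex.Im R) q).[t] =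
  0.
  have /eqP : ((map_poly (@complex.Re R) q) ^+ 2 + (map_poly (@complex.Im R) q) ^+
    2).[t] = 0.
    by rewrite e horner0.
  rewrite hornerD !horner_exp paddr_eq0 ?sqr_ge0// => /andP[].
  by rewrite !expf_eq0/= => /eqP -> /eqP ->.
have z0 (r : {poly R}) : (forall t, r.[t] = 0) -> r = 0.
  move=> r0; apply: (@roots_geq_poly_eq0 _ _ [seq i%:R | i <- iota 0 (size r)]).
  - by apply/allP => t _; apply/eqP.
  - by rewrite map_inj_uniq ?iota_uniq//; exact: mulrIn (oner_neq0 _).
  - by rewrite size_map size_iota.
have [r0 i0] : map_poly (@complex.Re R) q = 0 /\ map_poly (@complex.Im R) q = 0.
  by split; apply: z0 => t; have [] := e0 t.
apply/polyP => i; rewrite coef0.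
have := congr1 (fun r : {poly R} => r`_i) r0; have := congr1 (fun r : {poly R} =>
  r`_i) i0.
rewrite !coef_map_id0// !coef0; case: q`_i => a b /= -> ->.
by [].
Qed.

(* The real and imaginary parts of the derivatives of f below the order of L
   form a rational system: one divides by |L_T|^2. *)
Lemma holonomic_line_rational_system (f : C -> C) :
  holonomic [set z : C | complex.Im z = 0] f ->
  rational_system (fun t => complex.Re (f t%:C)) /\
  rational_system (fun t => complex.Im (f t%:C)).
Proof.
move=> [Z [L [Zf L0 Ld LZ]]].
set U := [set z : C | complex.Im z = 0] `\` Z in Ld LZ.
have [s s0 sZ] := finite_set_poly Zf.
pose s2 := (map_poly (@complex.Re R) s) ^+ 2 + (map_poly (@complex.Im R) s) ^+ 2.
pose T := Defs.order L.
have sL : size L = T.+1 by rewrite /T /Defs.order prednK// size_poly_gt0.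
have lT : L`_T != 0 by rewrite -/(lead_coef L) lead_coef_eq0.
pose re k := map_poly (@complex.Re R) L`_k; pose im k := map_poly (@complex.Im R) L`_k.
pose n2 := re T ^+ 2 + im T ^+ 2.
pose q := n2 * s2.
have q0 : q != 0 by rewrite mulf_neq0// poly_neq0_Re_Im.
have qs t : q.[t] != 0 -> ~ Z t%:C.
  rewrite hornerM mulf_eq0 negb_or => /andP[_]; apply: contraNnot => /sZ st.
  have := horner_Re s t; have := horner_Im s t; rewrite st /= => i0 r0.
  by rewrite /s2 hornerD !horner_exp -r0 -i0 expr0n addr0.
pose g k t := derivn_in U k f t%:C.
pose w (z : bool * 'I_T) t := if z.1 then complex.Im (g z.2 t) else complex.Re (g z.2
  t).
(* L_k conj(L_T) = cre k + i cim k *)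
pose cre k := re k * re T + im k * im T; pose cim k := im k * re T - re k * im T.
pose A (j k : bool * 'I_T) : {poly R} :=
  if j.2.+1 == T then
    - s2 * (if j.1 then (if k.1 then cre k.2 else cim k.2)
            else (if k.1 then - cim k.2 else cre k.2))
  else if (k.1 == j.1) && (k.2 == j.2.+1 :> nat) then q else 0.
pose B b (k : bool * 'I_T) : {poly R} := if (k.1 == b) && (k.2 == 0%N :> nat) then q
  else 0.
have sys b : forall x, q.[x] != 0 ->
    (forall j, is_derive x 1 (w j) ((\sum_k (A j k).[x] * w k x) / q.[x])) /\
    (if b then complex.Im (f x%:C) else complex.Re (f x%:C)) =
       (\sum_k (B b k).[x] * w k x) / q.[x].
  move=> x qx; have nZ : \forall t \near x, ~ Z t%:C.
    by apply: filterS (near_poly_neq0 qx) => t; exact: qs.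
  have Ux : U x%:C by split => //; exact: qs.
  split => [[c j]|]; last first.
    have -> : (if b then complex.Im (f x%:C) else complex.Re (f x%:C)) =
       if b then complex.Im (g 0%N x) else complex.Re (g 0%N x) by [].
    case: (posnP T) => T0.
      rewrite big1 ?mul0r; last by move=> k _; suff: false by [];
        rewrite -(ltn0 k.2) -T0 ltn_ord.
      have Lx0 : (L`_0).[x%:C] != 0.
        apply: contraTneq qx => L0x; rewrite /q /n2 /re /im T0.
        rewrite hornerM hornerD !horner_exp -horner_Re -horner_Im L0x /=.
        by rewrite expr0n addr0 mul0r eqxx.
      have := LZ _ Ux; rewrite /op_apply sL T0 big_ord1 => /eqP;
        rewrite mulf_eq0 (negbTE Lx0) => /eqP g0.
      by rewrite /g g0 /=; case: b.
    rewrite (bigD1 (b, Ordinal T0))//= {1}/B !eqxx /= big1 ?addr0.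
      by rewrite mulrAC divff ?mul1r//; rewrite /w /=; case: b.
    move=> [c k] /=; rewrite xpair_eqE /B /= -val_eqE /= => /negbTE ->.
    by rewrite horner0 mul0r.
  have dj : is_derive x 1 (w (c, j)) (if c then complex.Im (g j.+1 x) else complex.Re (g
    j.+1 x)).
    have cj : cvg (diffquot U (derivn_in U j f) x%:C) by apply: Ld => //;
      exact: ltn_ord.
    rewrite /w /=; case: c.
    - apply: (is_derive_complex_line _ _ _ nZ cj); first exact: raddfB.
        by move=> a [a1 a2] /=; rewrite mul0r addr0.
      exact: normc_ge_Im.
    - apply: (is_derive_complex_line _ _ _ nZ cj); first exact: raddfB.
        by move=> a [a1 a2] /=; rewrite mul0r subr0.
      exact: normc_ge_Re.
  apply: is_derive_eq dj _; have [jT|jT] := eqVneq j.+1 T; last first.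
    have jT' : (j.+1 < T)%N by rewrite ltn_neqAle jT ltn_ord.
    rewrite (bigD1 (c, Ordinal jT'))//= {1}/A /= (negbTE jT) !eqxx big1 ?addr0.
      by rewrite mulrAC divff ?mul1r//; rewrite /w /=; case: (c).
    move=> [c' k]; rewrite xpair_eqE -val_eqE/= /A /= (negbTE jT) => /negbTE ->.
    by rewrite horner0 mul0r.
  apply: (mulIf qx); rewrite divfK// -(pair_bigA _ (fun b k =>
    (A (c, j) (b, k)).[x] * w (b, k) x))/= big_bool.
  have /= ode := LZ _ Ux; move: ode; rewrite /op_apply sL big_ord_recr /=.
  rewrite -/(g _ x); set GT := g T x => ode.
  pose r k := (re k).[x]; pose i k := (im k).[x].
  pose Sra := \sum_(k < T) r k * complex.Re (g k x).
  pose Srb := \sum_(k < T) r k * complex.Im (g k x).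
  pose Sia := \sum_(k < T) i k * complex.Re (g k x).
  pose Sib := \sum_(k < T) i k * complex.Im (g k x).
  have ReM (y z : C) : complex.Re (y * z) = complex.Re y * complex.Re z - complex.Im y *
    complex.Im z.
    by case: y z => [? ?] [? ?].
  have ImM (y z : C) : complex.Im (y * z) = complex.Re y * complex.Im z + complex.Im y *
    complex.Re z.
    by case: y z => [? ?] [? ?].
  have E1 : Sra - Sib + (r T * complex.Re GT - i T * complex.Im GT) = 0.
    have := congr1 (@complex.Re R) ode; rewrite raddfD raddf_sum /= ReM horner_Re
      horner_Im => <-.
    congr (_ + _); rewrite -sumrB; apply: eq_bigr => k _.
    by rewrite ReM horner_Re horner_Im.
  have E2 : Srb + Sia + (r T * complex.Im GT + i T * complex.Re GT) = 0.
    have := congr1 (@complex.Im R) ode; rewrite raddfD raddf_sum /= ImM horner_Re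
      horner_Im => <-.
    congr (_ + _); rewrite -big_split; apply: eq_bigr => k _.
    by rewrite /= ImM horner_Re horner_Im.
  have qE : q.[x] = (r T ^+ 2 + i T ^+ 2) * s2.[x].
    by rewrite /q hornerM /n2 hornerD !horner_exp.
  rewrite qE jT -/GT.
  have e1 : Sra - Sib = - (r T * complex.Re GT - i T * complex.Im GT).
    by apply/eqP; rewrite -addr_eq0 E1.
  have e2 : Srb + Sia = - (r T * complex.Im GT + i T * complex.Re GT).
    by apply/eqP; rewrite -addr_eq0 E2.
  (* Imaginary and real part of the equation multiplied by the conjugate of L_T, which gives [GT]
     the real coefficient |L_T|^2. *)
  case: c => /=.
  - transitivity (- s2.[x] * (r T * (Srb + Sia) - i T * (Sra - Sib))).
      by rewrite e1 e2; ring.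
    rewrite /Srb /Sia /Sra /Sib -big_split -sumrB /= !mulr_sumr -sumrB mulr_sumr
      -big_split /=.
    apply: eq_bigr => k _; rewrite /A /w /= jT eqxx !hornerE /r /i.
    ring.
  - transitivity (- s2.[x] * (r T * (Sra - Sib) + i T * (Srb + Sia))).
      by rewrite e1 e2; ring.
    rewrite /Srb /Sia /Sra /Sib -big_split -sumrB /= !mulr_sumr -big_split mulr_sumr
      -big_split /=.
    apply: eq_bigr => k _; rewrite /A /w /= jT eqxx !hornerE /r /i.
    ring.
split; [have := sys false|have := sys true]; exact: rational_system_fin.
Qed.

End ComplexLine.

Lemma holonomic_charfun_rational_system {d : measure_display} {Om : measurableType d}
    {R : realType} (P : probability Om R) (X : {RV P >-> R}) : holonomic_charfun X ->
  rational_system (fun t => fine ('E_P[fun w => cos (t * X w)])%E) /\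
  rational_system (fun t => fine ('E_P[fun w => sin (t * X w)])%E).
Proof. exact: holonomic_line_rational_system. Qed.

(** * Iterated primitives *)

Section Primitive.
Variable R : realType.
Notation mu := (@lebesgue_measure R).
Implicit Types (f g : R -> R) (x y : R).

(** The primitive that vanishes at 0, on both sides of 0: one of the two intervals is empty or a
    point. *)
Definition prim f y : R :=
  \int[mu]_(x in `[0, y]) f x - \int[mu]_(x in `[y, 0]) f x.

Lemma integrable_itv f (a b : R) : continuous f -> mu.-integrable `[a, b] (EFin \o f).
Proof.
move=> fc; apply: continuous_compact_integrable; first exact: segment_compact.
exact: continuous_subspaceT.
Qed.

Lemma Rintegral_itv_chasles f (a b c : R) : continuous f -> a <= b -> b <= c ->
  \int[mu]_(x in `[a, c]) f x = \int[mu]_(x in `[a, b]) f x + \int[mu]_(x in `[b,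
    c]) f x.
Proof.
move=> fc ab bc; apply/eqP; rewrite addrC -subr_eq; apply/eqP.
rewrite (@Rintegral_itvB _ f (BLeft a) (BRight c) b) ?bnd_simp//;
  last exact: integrable_itv.
rewrite Rintegral_itv_obnd_cbnd//; apply: integrableS (integrable_itv b c fc) => //.
exact: subset_itv_oc_cc.
Qed.

Lemma prim0 f : prim f 0 = 0.
Proof. by rewrite /prim subrr. Qed.

Lemma Rintegral_itv_ge f (a b : R) : b <= a -> \int[mu]_(x in `[a, b]) f x = 0.
Proof.
rewrite le_eqVlt => /predU1P[->|ba]; first by rewrite set_itv1 Rintegral_set1.
by rewrite set_itv_ge ?Rintegral_set0// bnd_simp -ltNge.
Qed.

Lemma prim_shift f (M y : R) : continuous f -> 0 <= M -> - M <= y ->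
  prim f y = \int[mu]_(x in `[- M, y]) f x - \int[mu]_(x in `[- M, 0]) f x.
Proof.
move=> fc M0 My; rewrite /prim; have [y0|y0] := leP 0 y.
  rewrite [X in _ - X = _]Rintegral_itv_ge// subr0.
  by rewrite (@Rintegral_itv_chasles f (- M) 0 y) ?oppr_le0// addrAC subrr add0r.
rewrite [X in X - _]Rintegral_itv_ge ?(ltW y0)// sub0r.
by rewrite (Rintegral_itv_chasles fc My (ltW y0)) opprD addrA subrr add0r.
Qed.

Lemma is_derive_prim f y : continuous f -> is_derive y 1 (prim f) (f y).
Proof.
move=> fc; pose M := `|y| + 1.
have My : - M < y by have := ler_norm (- y); rewrite normrN /M; lra.
have yM : y < M by rewrite /M (le_lt_trans (ler_norm y))// ltrDl.
have M0 : 0 <= M by rewrite /M addr_ge0.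
have [dG G'] := @continuous_FTC1_closed R f (- M) y M yM (integrable_itv _ _ fc) My (fc
  y).
apply: (@is_derive_near_eq _ (fun z => \int[mu]_(x in `[- M,
  z]) f x - \int[mu]_(x in `[- M, 0]) f x)).
  near=> z; rewrite (@prim_shift _ M)//; apply: ltW; near: z.
  by apply: (cvgr_gt y) My; exact: cvg_id.
have dF : is_derive y 1 (fun z => \int[mu]_(x in `[- M, z]) f x) (f y).
  by apply: DeriveDef; [exact: dG|rewrite -derive1E; exact: G'].
have dc : is_derive y 1 (fun=> - \int[mu]_(x in `[- M,
  0]) f x) 0 by exact: is_derive_cst.
by have := is_derive1D dF dc; rewrite addr0.
Unshelve. all: by end_near. Qed.

Lemma continuous_prim f : continuous f -> continuous (prim f).
Proof. by move=> fc y; exact: is_derive1_continuous (is_derive_prim y fc). Qed.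

Lemma prim_unique f g : continuous f -> (forall y : R, is_derive y 1 g (f y)) ->
  forall y, prim f y = g y - g 0.
Proof.
move=> fc gf y; have h0 (x : R) : is_derive x 1 (fun z => prim f z - g z) 0.
  rewrite -(subrr (f x)); apply: is_deriveB; exact: is_derive_prim.
have := is_derive_0_is_cst y 0 h0; rewrite prim0 sub0r => e.
by rewrite -[LHS](subrK (g y)) e addrC.
Qed.

Lemma prim_sum (J : Type) (s : seq J) (a : J -> R) (f : J -> R -> R) :
  (forall j, continuous (f j)) ->
  forall y, prim (fun x => \sum_(j <- s) a j * f j x) y =
    \sum_(j <- s) a j * prim (f j) y.
Proof.
move=> fc y; have c : continuous (fun x => \sum_(j <- s) a j * f j x).
  by move=> x; apply: cvg_big => //; [exact: add_continuous|move=> j _; apply: cvgMr;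
    exact: fc].
have d (x : R) : is_derive x 1 (fun y => \sum_(j <- s) a j * prim (f j) y) (\sum_(j <-
  s) a j * f j x).
  by apply: is_derive1_sum => j _; apply: is_derive1Z; exact: is_derive_prim.
by rewrite (prim_unique c d) [X in _ - X]big1 ?subr0// => j _; rewrite prim0 mulr0.
Qed.

Lemma prim_bound f (M C : R) : continuous f -> (forall y, `|y| <= M -> `|f y| <= C) ->
  forall y, `|y| <= M -> `|prim f y| <= C * M.
Proof.
move=> fc fC y yM; have C0 : 0 <= C.
  by rewrite (le_trans _ (fC 0 _))// normr0 (le_trans _ yM).
have aux (a b : R) : a < b -> (forall x, x \in `]a, b[ -> `|x| <= M) ->
    `|prim f b - prim f a| <= C * (b - a).
  move=> ab hM; have pd (x : R) : x \in `]a, b[ -> is_derive x 1 (prim f) (f x).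
    by move=> _; exact: is_derive_prim.
  have [|x xab ->] := @MVT _ (prim f) f a b ab pd.
    by apply: continuous_subspaceT; exact: continuous_prim.
  by rewrite normrM [`|b - a|]gtr0_norm ?subr_gt0// ler_wpM2r ?subr_ge0 ?(ltW ab)// fC//
    hM.
have [y0|y0|<-] := ltgtP 0 y.
- have := aux _ _ y0; rewrite prim0 !subr0 => h; apply: le_trans (h _) _.
    move=> x; rewrite in_itv/= => /andP[x0 xy].
    by rewrite gtr0_norm// (le_trans (ltW xy))// (le_trans _ yM)// ler_norm.
  by rewrite ler_wpM2l// (le_trans _ yM)// ler_norm.
- have := aux _ _ y0; rewrite prim0 !sub0r normrN => h; apply: le_trans (h _) _.
    move=> x; rewrite in_itv/= => /andP[yx x0].
    by rewrite ltr0_norm// (le_trans _ yM)// ltr0_norm// lerN2 ltW.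
  by rewrite ler_wpM2l// (le_trans _ yM)// -normrN ler_norm.
- by rewrite prim0 normr0 mulr_ge0// (le_trans _ yM).
Qed.

Lemma cvg_prim (f_ : nat -> R -> R) f y (C : R) : (forall n, continuous (f_ n)) ->
  continuous f ->
  (forall n x, `|x| <= `|y| -> `|f_ n x| <= C) ->
  (forall x, f_ n x @[n --> \oo] --> f x) ->
  prim (f_ n) y @[n --> \oo] --> prim f y.
Proof.
move=> fc_ fc fC cv.
have aux (a b : R) : (forall x, x \in `[a, b] -> `|x| <= `|y|) ->
    \int[mu]_(x in `[a, b]) f_ n x @[n --> \oo] --> \int[mu]_(x in `[a, b]) f x.
  move=> ab; have [||||| _ h] := @Rdominated _ _ _ mu `[a,
    b]%classic (measurable_itv _) f_ f (fun=> C); last exact: h.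
  - by move=> n; apply: measurable_funTS; exact: continuous_measurable_fun.
  - by apply: measurable_funTS; exact: continuous_measurable_fun.
  - by apply: aeW => x _; exact: cv.
  - by move=> n x /= xab; apply: fC; exact: ab.
  - by apply: integrable_itv; exact: cst_continuous.
apply: cvgB; apply: aux => x; rewrite in_itv/= => /andP[x0 xy].
  by rewrite !ger0_norm// (le_trans x0).
by rewrite !ler0_norm// ?lerN2// (le_trans x0).
Qed.

Definition iprim n f := iter n prim f.
Arguments iprim : simpl never.

Lemma iprimSr n f : iprim n.+1 f = iprim n (prim f).
Proof. exact: iterSr. Qed.

Lemma iprimS n f : iprim n.+1 f = prim (iprim n f).
Proof. by []. Qed.

Lemma continuous_iprim n f : continuous f -> continuous (iprim n f).
Proof. by move=> fc; elim: n => //= n ih; exact: continuous_prim. Qed.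

Lemma iprim_sum n (J : Type) (s : seq J) (a : J -> R) (f : J -> R -> R) :
  (forall j, continuous (f j)) ->
  iprim n (fun x => \sum_(j <- s) a j * f j x) = fun y =>
    \sum_(j <- s) a j * iprim n (f j) y.
Proof.
move=> fc; elim: n => // n ih; rewrite iprimS ih; apply/funext => y;
  rewrite prim_sum// => j.
exact: continuous_iprim.
Qed.

Lemma cvg_iprim n (f_ : nat -> R -> R) f : (forall m, continuous (f_ m)) ->
  continuous f ->
  (forall M, exists C, forall m x, `|x| <= M -> `|f_ m x| <= C) ->
  (forall x, f_ m x @[m --> \oo] --> f x) ->
  forall y, iprim n (f_ m) y @[m --> \oo] --> iprim n f y.
Proof.
(* The local bounds, uniform in m, go through the induction along with the convergence: they
   dominate the next integration. *)
move=> fc_ fc fC cv; suff [] : (forall M, exists C, forall m x, `|x| <= M ->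
  `|iprim n (f_ m) x| <= C) /\
  forall y, iprim n (f_ m) y @[m --> \oo] --> iprim n f y by [].
elim: n => [|n [b ih]]; first by split.
split=> [M|y] /=.
  have [C hC] := b M; exists (C * M) => m x xM; apply: prim_bound => // [|z zM].
    exact: continuous_iprim.
  exact: hC.
have [C hC] := b `|y|.
by apply: (@cvg_prim _ _ y C) => // [m|]; exact: continuous_iprim.
Qed.

Lemma prim_horner (r : {poly R}) : exists s : {poly R},
  (size s <= (size r).+1)%N /\ prim (fun x => r.[x]) = fun y => s.[y].
Proof.
pose s : {poly R} := \poly_(i < (size r).+1) (if i is k.+1 then r`_k / k.+1%:R else 0).
have sr : s^`() = r.
  apply/polyP => k; rewrite coef_deriv coef_poly ltnS; case: ltnP => kr.
    by rewrite -[_ *+ k.+1]mulr_natr divfK// pnatr_eq0.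
  by rewrite mul0rn nth_default.
exists s; split; first exact: size_poly.
have d (x : R) : is_derive x 1 (fun y => s.[y]) (r.[x]).
  by rewrite -[in r.[x]]sr; exact: is_derive_horner.
apply/funext => y; rewrite (prim_unique (@continuous_horner _ r) d).
by rewrite [X in _ - X]horner_coef0 coef_poly subr0.
Qed.

Lemma iprim_horner n (r : {poly R}) k : (size r <= k)%N -> exists s : {poly R},
  (size s <= n + k)%N /\ iprim n (fun x => r.[x]) = fun y => s.[y].
Proof.
move=> rk; elim: n => [|n [s [sk e]]]; first by exists r.
have [t [ts e']] := prim_horner s; exists t; split; first exact: leq_trans ts _.
by rewrite iprimS e e'.
Qed.

(** Lagrange interpolation at fixed nodes recovers each polynomial from finitely many of its values,
    and these converge. No bound on the coefficients is needed, which suits constants of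
    integration. *)
Lemma poly_pointwise_limit n (r : nat -> {poly R}) (h : R -> R) :
  (forall m, (size (r m) <= n)%N) -> (forall x, (r m).[x] @[m --> \oo] --> h x) ->
  exists s : {poly R}, forall x, h x = s.[x].
Proof.
case: n => [|n] rn cv.
  exists 0 => x; rewrite horner0; move: (cv x).
  under eq_cvg do rewrite (size_poly_leq0P _ (rn _)) horner0.
  by move=> c; apply: cvg_unique c (cvg_cst _).
pose pt (i : nat) : R := i%:R.
have inj : injective pt by move=> i j /eqP; rewrite eqr_nat => /eqP.
pose s := \sum_(i < n.+1) (h (pt i))%:P * tnth (lagrange n.+1 pt) i.
exists s => x.
have c : (r m).[x] @[m --> \oo] --> s.[x].
  under eq_cvg do rewrite (lagrange_gen (ltn0Sn _) inj (rn _)) horner_sum.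
  rewrite /s horner_sum; apply: cvgr_sum => i _.
  under eq_cvg do rewrite hornerM hornerC.
  by rewrite hornerM hornerC; apply: cvgMl; exact: cv.
by apply: cvg_unique (cv x) c; exact: Rhausdorff.
Qed.

Lemma iprimD n (a b : R) f g : continuous f -> continuous g ->
  iprim n (fun x => a * f x + b * g x) = fun y => a * iprim n f y + b * iprim n g y.
Proof.
move=> fc gc; have := @iprim_sum n bool [:: true; false] (fun i => if i then a else b)
  (fun i => if i then f else g).
rewrite (_ : (fun x => \sum_(j <- _) _) = fun x => a * f x + b * g x); last first.
  by apply/funext => x; rewrite !big_cons big_nil addr0.
by move=> ->; [apply/funext => y; rewrite !big_cons big_nil addr0|case].
Qed.

Lemma iprim0 n f : (forall x, f x = 0) -> forall y, iprim n f y = 0.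
Proof.
move=> f0 y; have -> : f = (fun x => \sum_(j <- @nil unit) 0 * (fun=> 0) x).
  by apply/funext => x; rewrite big_nil.
rewrite iprim_sum ?big_nil// => j; exact: cst_continuous.
Qed.

Lemma continuousM_horner (d : {poly R}) f : continuous f ->
  continuous (fun x => d.[x] * f x).
Proof. by move=> fc x; apply: cvgM; [exact: continuous_horner|exact: fc]. Qed.

(* The e_j come from integrating n times by parts d g^(b); r collects the
   constants of integration. *)
Lemma iprim_parts n b (d : {poly R}) : (b <= n)%N -> exists e : nat -> {poly R},
  [/\ forall j, (j < n - b)%N -> e j = 0, e (n - b)%N = d &
   forall g : nat -> R -> R, (forall k (y : R), is_derive y 1 (g k) (g k.+1 y)) ->
     exists r : {poly R}, (size r <= n)%N /\ forall y,
       iprim n (fun x => d.[x] * g b x) y =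
       \sum_(j < n.+1) iprim j (fun x => (e j).[x] * g 0 x) y + r.[y]].
Proof.
elim: b n d => [|b ih] n d bn.
  exists (fun j => if j == n then d else 0); rewrite subn0 eqxx; split=> // [j|g g'].
    by case: eqP => // ->; rewrite ltnn.
  exists 0; rewrite size_poly0; split=> // y.
  rewrite horner0 addr0 big_ord_recr/= eqxx [X in _ = X + _]big1 ?add0r// => j _.
  by rewrite iprim0// => x; rewrite ltn_eqF// horner0 mul0r.
case: n bn => // n bn; rewrite subSS.
have [e1 [e1lt e1d h1]] := ih n d bn.
have [e2 [e2lt e2d h2]] := ih n.+1 d^`() (leqW bn).
(* [e1] comes from n integrations and is meaningful up to j = n only, [e2] from n + 1. *)
exists (fun j => (if j == n.+1 then 0 else e1 j) - e2 j); split=> [j jn||g g'].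
- rewrite e2lt ?e1lt ?subr0; [by case: ifP|exact: jn|].
  by rewrite (ltn_trans jn)// subSn.
- by rewrite e2lt ?subSn// subr0 ltn_eqF// ltnS leq_subr.
have gc k : continuous (g k) by move=> y; exact: is_derive1_continuous (g' k y).
have [r1 [r1n h1g]] := h1 g g'; have [r2 [r2n h2g]] := h2 g g'.
(* One integration by parts: [h] is a primitive of d g^(b+1). Its value at 0 becomes the polynomial
   [r3] under the remaining n integrations. *)
pose h y := d.[y] * g b y - prim (fun x => d^`().[x] * g b x) y.
have h' (x : R) : is_derive x 1 h (d.[x] * g b.+1 x).
  rewrite (_ : _ * _ = (d^`().[x] * g b x + d.[x] * g b.+1 x) + - (d^`().[x] * g b x));
    last by ring.
  apply: is_derive1D; first by apply: is_derive1M.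
  by apply: is_deriveN; apply: is_derive_prim; exact: continuousM_horner.
have pc : continuous (fun x => d.[x] * g b.+1 x) by exact: continuousM_horner.
have [r3 [r3n h3]] := @iprim_horner n (- (h 0))%:P 1 (size_polyC_leq1 _).
exists (r1 - r2 + r3); split.
  rewrite (leq_trans (size_polyD _ _))// geq_max -[n.+1]addn1 r3n andbT.
  rewrite (leq_trans (size_polyD _ _))// geq_max size_polyN (leq_trans r1n) ?leq_addr//.
  by rewrite (leq_trans r2n)// addn1.
move=> y; rewrite iprimSr.
have -> : prim (fun x => d.[x] * g b.+1 x) = fun y => 1 * (1 * (d.[y] * g b y) +
    (-1) * prim (fun x => d^`().[x] * g b x) y) + 1 * (- h 0)%:P.[y].
  by apply/funext => z; rewrite (prim_unique pc h') hornerC /h; ring.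
have c1 : continuous (fun x => d.[x] * g b x) by exact: continuousM_horner.
have c2 : continuous (prim (fun x => d^`().[x] * g b x)).
  by apply: continuous_prim; exact: continuousM_horner.
rewrite iprimD; [|by move=> x; apply: cvgD; apply: cvgMr;
  [exact: c1|exact: c2]|exact: continuous_horner].
rewrite iprimD// h3 h1g -iprimSr h2g.
rewrite !hornerD hornerN.
have -> : \sum_(j < n.+2) iprim j (fun x => ((if j == n.+1 :> nat then 0 else e1 j) - e2
  j).[x] * g 0%N x) y =
   \sum_(j < n.+1) iprim j (fun x => (e1 j).[x] * g 0%N x) y -
   \sum_(j < n.+2) iprim j (fun x => (e2 j).[x] * g 0%N x) y.
  transitivity (\sum_(j < n.+2) (iprim j (fun x =>
    (if j == n.+1 :> nat then 0 else e1 j).[x] * g 0%N x) y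
      - iprim j (fun x => (e2 j).[x] * g 0%N x) y)).
    apply: eq_bigr => j _.
    have -> : (fun x => ((if j == n.+1 :> nat then 0 else e1 j) - e2 j).[x] * g 0%N x) =
       (fun x => 1 * ((if j == n.+1 :> nat then 0 else e1 j).[x] * g 0%N x) + (-1) *
         ((e2 j).[x] * g 0%N x)).
      by apply/funext => x; rewrite hornerD hornerN; ring.
    by rewrite iprimD ?mul1r ?mulN1r//; exact: continuousM_horner.
  rewrite big_split/= sumrN; congr (_ + _).
  rewrite big_ord_recr/= eqxx iprim0 ?addr0; last by move=> x; rewrite horner0 mul0r.
  by apply: eq_bigr => j _; rewrite ltn_eqF.
ring.
Qed.

(* Horner's scheme for the sum of the prim^j (E_j f), see horE. *)
Fixpoint hor (E : seq {poly R}) f : R -> R :=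
  if E is e :: E' then fun x => e.[x] * f x + prim (hor E' f) x else fun=> 0.

Lemma continuous_hor E f : continuous f -> continuous (hor E f).
Proof.
move=> fc; elim: E => [|e E ih] /=; first by move=> x; exact: cst_continuous.
by move=> x; apply: cvgD; [exact: continuousM_horner|exact: continuous_prim].
Qed.

Lemma horE E f : continuous f ->
  hor E f = fun y => \sum_(j < size E) iprim j (fun x => (E`_j).[x] * f x) y.
Proof.
move=> fc; elim: E => [|e E ih]; first by apply/funext => y; rewrite big_ord0.
apply/funext => y; rewrite /= big_ord_recl/= ih; congr (_ + _).
have -> : (fun y => \sum_(j < size E) iprim j (fun x => (E`_j).[x] * f x) y) =
   (fun y => \sum_(j < size E) 1 * iprim j (fun x => (E`_j).[x] * f x) y).
  by apply/funext => z; apply: eq_bigr => j _; rewrite mul1r.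
rewrite prim_sum; last by move=> j; apply: continuous_iprim; exact: continuousM_horner.
by apply: eq_bigr => j _; rewrite mul1r.
Qed.

Lemma sum_if_eq (c : {poly R}) (W : nat -> R) n j x :
  \sum_(i < n) (if i == j :> nat then c else 0).[x] * W i =
    if (j < n)%N then c.[x] * W j else 0.
Proof.
case: ltnP => jn.
  rewrite (bigD1 (Ordinal jn))//= eqxx big1 ?addr0// => i.
  by rewrite -val_eqE/= => /negbTE ->; rewrite horner0 mul0r.
rewrite big1// => i _; rewrite ltn_eqF ?horner0 ?mul0r//.
by rewrite (leq_trans _ jn).
Qed.

(* A Volterra equation sum_j prim^j (E_j f) = r: the inner stages of Horner's
   scheme, together with the constant 1, form the system. *)
Lemma rational_system_hor E f (r : {poly R}) : continuous f ->
  (exists j, E`_j != 0) -> (forall y, hor E f y = r.[y]) -> rational_system f.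
Proof.
move=> fc; elim: E r => [|e0 E ih] r [j Ej] h; first by rewrite nth_nil eqxx in Ej.
(* If the first polynomial is zero, the equation is differentiated once and has one stage less. *)
have [e00|e00] := eqVneq e0 0.
  case: j Ej => [|j] Ej; first by rewrite /= e00 eqxx in Ej.
  apply: (ih r^`()); first by exists j.
  move=> y; have hc := @continuous_hor E _ fc.
  rewrite -(is_derive1E (is_derive_prim y hc)) -(is_derive1E (is_derive_horner r y)).
  by congr (derive1 _ y); apply/funext => z; rewrite -h /= e00 horner0 mul0r add0r.
(* The stages satisfy W_k' = E_k f + W_(k+1), and the outermost one is solved for f as (r - W_0) /
   e0, which closes the system with denominator e0. *)
move=> {j Ej}; pose n := size E; pose W k : R -> R := prim (hor (drop k E) f).
have W' k (x : R) : is_derive x 1 (W k) ((E`_k).[x] * f x + W k.+1 x).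
  apply: is_derive_eq (is_derive_prim x (@continuous_hor (drop k E) _ fc)) _.
  have [kE|kE] := ltnP k (size E); first by rewrite (drop_nth 0 kE).
  rewrite drop_oversize// /W (drop_oversize (leqW kE)) nth_default//
    horner0 mul0r add0r /=.
  by rewrite -[RHS]/(iprim 1 _ x) iprim0.
have W0 x : W n.+1 x = 0 by rewrite /W drop_oversize//= -[LHS]/(iprim 1 _ x) iprim0.
pose w (k : 'I_n.+2) : R -> R := if k is Ordinal k'.+1 _ then W k' else fun=> 1.
pose A (j k : 'I_n.+2) : {poly R} := if val j is j'.+1 then
   if val k is k'.+1 then (if k' == 0%N then - E`_j' else 0) + (if k' == j'.+1 then e0
     else 0)
   else E`_j' * r else 0.
pose B (k : 'I_n.+2) : {poly R} := if val k is k'.+1 then if k' == 0%N then -1 else 0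
  else r.
have fE x : e0.[x] != 0 -> f x = (r.[x] - W 0 x) / e0.[x].
  by move=> ex; rewrite -h /= /W drop0 addrK mulrAC mulfV// mul1r.
exists n.+2, e0, A, B, w; split=> // x ex; split=> [j|]; last first.
  rewrite fE//; congr (_ / _); rewrite !big_ord_recl big1 ?addr0//=.
    by rewrite mulr1 /B/= hornerN hornerC mulN1r.
  by move=> i _; rewrite /B/= horner0 mul0r.
case: j => -[|j] jn.
  apply: is_derive_eq (is_derive_cst _ _ _) _.
  by rewrite big1 ?mul0r// => k _; rewrite /A/= horner0 mul0r.
apply: is_derive_eq (W' j x) _; apply: (mulIf ex); rewrite divfK// big_ord_recl/=.
rewrite /A/= mulr1.
under eq_bigr do rewrite hornerD mulrDl.
rewrite big_split/= mulrDl {1}fE// -mulrA divfK// hornerM mulrBr -addrA; congr (_ + _).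
rewrite (sum_if_eq _ (fun k => W k x) n.+1 0) (sum_if_eq _ (fun k => W k x) n.+1 j.+1).
rewrite /= hornerN mulNr; congr (_ + _); case: ifP => jn1; first by rewrite mulrC.
have -> : j.+1 = n.+1 by lia.
by rewrite W0 mul0r.
Qed.

End Primitive.

Section VolterraLimit.
Variable R : realType.

(* After n integrations no derivative of g m 0 is left in the relation, so that
   it passes to the limit. *)
Lemma rational_system_limit (J : finType) (n A : nat) (b : J -> nat) (d : J -> {poly R})
    (c_ : nat -> J -> R) (c : J -> R) (g : nat -> nat -> R -> R) (f : R -> R) (C : R) :
  (forall j, (b j <= n)%N) -> (forall j, c_ m j @[m --> \oo] --> c j) ->
  (forall m k (y : R), is_derive y 1 (g m k) (g m k.+1 y)) ->
  (forall m y, \sum_j c_ m j * ((d j).[y] * g m (b j) y) = 0) ->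
  (forall m y, `|g m 0%N y| <= C) -> (forall y, g m 0%N y @[m --> \oo] --> f y) ->
  continuous f ->
  (forall j, (A < b j)%N -> c j = 0) -> \sum_(j | b j == A) c j *: d j != 0 ->
  rational_system f.
Proof.
move=> bn cc g' rel gC gf fc cA dA.
have gc m k : continuous (g m k) by move=> y; exact: is_derive1_continuous (g' m k y).
have An : (A <= n)%N.
  have [j /eqP <- //|none] := pickP (fun j => b j == A).
  by move: dA; rewrite big_pred0// eqxx.
have [e e_] := choice (fun j => @iprim_parts R n (b j) (d j) (bn j)).
pose rem m j (s : {poly R}) := (size s <= n)%N /\ forall y,
    iprim n (fun x => (d j).[x] * g m (b j) x) y =
    \sum_(i < n.+1) iprim i (fun x => (e j i).[x] * g m 0%N x) y + s.[y].
have rem_ex m j : exists s, rem m j s by have [_ _ /(_ (g m) (g' m))] := e_ j.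
have rem_ex' m : exists r : J -> {poly R}, forall j, rem m j (r j).
  by have [r hr] := choice (rem_ex m); exists r.
have [r r_] := choice rem_ex'.
pose rr m := - \sum_j c_ m j *: r m j.
pose h y := \sum_j c j * \sum_(i < n.+1) iprim i (fun x => (e j i).[x] * f x) y.
have rrE m y : (rr m).[y] = \sum_j c_ m j * \sum_(i < n.+1) iprim i (fun x =>
  (e j i).[x] * g m 0%N x) y.
  have : iprim n (fun x => \sum_j c_ m j * ((d j).[x] * g m (b j) x)) y = 0.
    by apply: iprim0 => x; exact: rel.
  rewrite iprim_sum; last by move=> j; exact: continuousM_horner.
  under eq_bigr do rewrite (r_ _ _).2 mulrDr.
  rewrite big_split/= => /eqP; rewrite addr_eq0 => /eqP ->.
  rewrite /rr hornerN horner_sum; congr (- _); apply: eq_bigr => j _.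
  by rewrite hornerZ.
have rr_size m : (size (rr m) <= n)%N.
  rewrite size_polyN; apply: (leq_trans (size_sum _ _ _)); apply/bigmax_leqP => j _.
  exact: leq_trans (size_scale_leq _ _) (r_ m j).1.
have cvh y : (rr m).[y] @[m --> \oo] --> h y.
  under eq_cvg do rewrite rrE.
  apply: cvgr_sum => j _; apply: cvgM; first exact: cc.
  apply: cvgr_sum => i _; apply: cvg_iprim.
  - by move=> m; exact: continuousM_horner.
  - exact: continuousM_horner.
  - move=> M; have [K K0 hK] := @poly_bound R (e j i) (size (e j i)) (leqnSn _).
    exists (K * (1 + M) ^+ size (e j i) * C) => m x xM.
    have C0 : 0 <= C by exact: le_trans (gC 0%N 0).
    rewrite normrM ler_pM// (le_trans (hK x))// ler_wpM2l// lerXn2r ?nnegrE ?addr_ge0//.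
      exact: le_trans xM.
    by rewrite lerD2l.
  - by move=> x; apply: cvgMr; exact: gf.
have [s hs] := poly_pointwise_limit rr_size cvh.
pose E := mkseq (fun i => \sum_j c j *: e j i) n.+1.
apply: (@rational_system_hor _ E f s fc).
  (* At index n - A the derivatives of order A leave their coefficient d_j; those of lower order
     contribute to larger indices only, and those of higher order have c_j = 0. So the Volterra
     equation is not trivial. *)
  exists (n - A)%N; rewrite nth_mkseq ?ltnS ?leq_subr//.
  rewrite (bigID (fun j => b j == A))/= [X in _ + X]big1 ?addr0.
    rewrite (eq_bigr (fun j => c j *: d j))// => j /eqP bA.
    by have [_ <- _] := e_ j; rewrite bA.
  move=> j; case: (ltngtP (b j) A) => // bA _.
    by have [e0 _ _] := e_ j; rewrite e0 ?scaler0// ltn_sub2l// (leq_trans bA).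
  by rewrite cA// scale0r.
move=> y; rewrite -hs (horE _ fc) size_mkseq /h.
under [RHS]eq_bigr do rewrite mulr_sumr.
rewrite exchange_big/=; apply: eq_bigr => i _.
rewrite -[RHS]/((fun y => \sum_j c j * iprim i (fun x => (e j i).[x] * f x) y) y).
rewrite -iprim_sum; last by move=> j; exact: continuousM_horner.
congr (iprim _ _ y); apply/funext => x; rewrite nth_mkseq// horner_sum mulr_suml.
by apply: eq_bigr => j _; rewrite hornerZ mulrA.
Qed.

End VolterraLimit.

(** * Gaussian kernels *)

Section LineIntegral.
Variable R : realType.
Notation mu := (@lebesgue_measure R).
Implicit Types f : R -> R.

Lemma cvg_Rintegral_itv f : continuous f -> mu.-integrable setT (EFin \o f) ->
  \int[mu]_(x in `[- n%:R, n%:R]) f x @[n --> \oo] --> \int[mu]_x f x.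
Proof.
move=> fc fi.
under eq_cvg do rewrite Rintegral_mkcond.
have [||||| _ h] := @Rdominated _ _ R mu setT measurableT
  (fun n => f \_ `[- n%:R, n%:R]) f (fun x => `|f x|); last exact: h.
- move=> n; apply/(measurable_restrictT _ (measurable_itv _)).
  by apply: measurable_funTS; exact: continuous_measurable_fun.
- exact: continuous_measurable_fun.
- apply: aeW => x _; apply: cvg_near_cst; near=> n.
  rewrite patchE ifT// inE/= in_itv/= -ler_norml; near: n.
  exact: nbhs_infty_ger.
- by move=> n x _; rewrite patchE; case: ifP; rewrite ?normr0.
- exact: intR_abs.
Unshelve. all: by end_near. Qed.

Lemma Rintegral_derive_line f f' : (forall x : R, is_derive x 1 f (f' x)) ->
  continuous f' -> mu.-integrable setT (EFin \o f') ->
  f n%:R @[n --> \oo] --> 0 -> f (- n%:R) @[n --> \oo] --> 0 ->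
  \int[mu]_x f' x = 0.
Proof.
move=> ff' c' fi fp fn; have h := cvg_Rintegral_itv c' fi.
apply: cvg_unique h _; first exact: Rhausdorff.
rewrite -(subr0 (0 : R)); apply: (@cvg_trans _ ((f n%:R - f (- n%:R)) @[n --> \oo]));
  last exact: cvgB.
apply: near_eq_cvg; near=> n.
have n0 : - n%:R < n%:R :> R by rewrite gtrN// ltr0n; near: n; exact: nbhs_infty_gt.
rewrite /Rintegral (@continuous_FTC2 _ _ f)//.
- exact: continuous_subspaceT.
- have cf : continuous f by move=> x; exact: is_derive1_continuous (ff' x).
  split; first by move=> x _; exact: ex_derive.
  + by apply: cvg_at_right_filter; exact: cf.
  + by apply: cvg_at_left_filter; exact: cf.
- by move=> x _; exact: is_derive1E (ff' x).
Unshelve. all: by end_near. Qed.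

End LineIntegral.

Lemma is_derive_chain (R : realType) (f g : R -> R) (x a b : R) :
  is_derive (g x) 1 f a -> is_derive x 1 g b ->
    is_derive x 1 (fun y => f (g y)) (a * b).
Proof. by move=> df dg; have := is_derive1_comp df dg; rewrite mulrC. Qed.

Lemma is_derive_scale (R : realType) (c x : R) : is_derive x 1 (fun y => y * c) c.
Proof.
have := is_derive1M (is_derive_id x 1) (is_derive_cst c x 1).
by rewrite mulr0 addr0 mul1r.
Qed.

Section Cosn.
Variable R : realType.

(* The n-th derivative of cos. *)
Definition cosn n (s : R) := cos (s + n%:R * (pi / 2)).

Lemma cosnS n s : cosn n.+1 s = - sin (s + n%:R * (pi / 2)).
Proof. by rewrite /cosn -natr1 mulrDl mul1r addrA cosDpihalf. Qed.

Lemma cosnSS n s : cosn n.+2 s = - cosn n s.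
Proof. by rewrite cosnS -natr1 mulrDl mul1r addrA sinDpihalf. Qed.

Lemma cosnD4 n k s : cosn (n + 4 * k) s = cosn n s.
Proof.
elim: k => [|k ih]; first by rewrite muln0 addn0.
by rewrite mulnS addnCA !addSn add0n !cosnSS !opprK.
Qed.

Lemma cosn00 : cosn 0 0 = 1.
Proof. by rewrite /cosn mul0r addr0 cos0. Qed.

Lemma cosn_le1 n s : `|cosn n s| <= 1.
Proof. exact: cos_max. Qed.

Lemma cosnB n a b : cosn n (a - b) = cos b * cosn n a + sin b * cosn (n + 3) a.
Proof.
rewrite addnC !addSn add0n cosnSS cosnS opprK /cosn addrAC cosB.
by rewrite mulrC [sin _ * sin _]mulrC.
Qed.

Lemma is_derive_cosn n (s : R) : is_derive s 1 (cosn n) (cosn n.+1 s).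
Proof.
rewrite cosnS; have h : is_derive s 1 (fun s => s + n%:R * (pi / 2)) 1.
  by have := is_derive1D (is_derive_id s 1) (is_derive_cst (n%:R * (pi / 2)) s 1);
    rewrite addr0.
by have := is_derive_chain (is_derive_cos _) h; rewrite mulr1.
Qed.

Lemma continuous_cosn n : continuous (cosn n).
Proof. by move=> s; exact: is_derive1_continuous (is_derive_cosn n s). Qed.

Lemma cosn0_neq0 n : ~~ odd n -> cosn n 0 != 0.
Proof.
move=> /negbTE on; rewrite -(odd_double_half n) on add0n.
elim: n./2 => [|k ih]; first by rewrite /cosn mul0r addr0 cos0 oner_eq0.
by rewrite doubleS cosnSS oppr_eq0.
Qed.

Lemma is_derive_cosnM n (t z : R) : is_derive t 1 (fun t =>
  cosn n (t * z)) (z * cosn n.+1 (t * z)).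
Proof. by have := is_derive_chain (is_derive_cosn n _) (is_derive_scale z t);
  rewrite mulrC. Qed.

End Cosn.

Lemma is_derive_under_integral {R : realType} d (Y : measurableType d)
    (mu : {measure set Y -> \bar R}) (f f' : R -> Y -> R) (G : Y -> R) (x : R) :
  (forall x, mu.-integrable setT (EFin \o f x)) ->
  (forall (x : R) y, is_derive x 1 (f ^~ y) (f' x y)) ->
  mu.-integrable setT (EFin \o G) -> (forall x y, `|f' x y| <= G y) ->
  is_derive x 1 (fun x => \int[mu]_y f x y) (\int[mu]_y f' x y).
Proof.
move=> fi ff' Gi fG.
have pE z y : partial1of2 f z y = f' z y by exact: is_derive1E (ff' z y).
have xI : `](x - 1), (x + 1)[%classic x by rewrite /= in_itv/= ltrBlDr ltrDl ltr01.
have der z y : derivable (f ^~ y) z 1 by have [] := ff' z y.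
have GI z y : `|partial1of2 f z y| <= G y by rewrite pE.
have G0 y : 0 <= G y by exact: le_trans (fG 0 y).
apply: DeriveDef.
  exact: (@derivable_under_integral _ _ _ mu f setT measurableT x (x - 1) (x + 1) xI
    (fun z _ => fi z) (fun z y _ _ => der z y) G G0 Gi (fun z y _ _ => GI z y)).
rewrite -derive1E (@differentiation_under_integral _ _ _ mu f setT measurableT x (x - 1)
  (x + 1) xI
    (fun z _ => fi z) (fun z y _ _ => der z y) G G0 Gi (fun z y _ _ => GI z y)).
by apply: eq_Rintegral => y _; rewrite pE.
Qed.

Lemma Rintegral_norm_le {R : realType} d (Y : measurableType d)
    (mu : {measure set Y -> \bar R}) (f g : Y -> R) : measurable_fun setT f ->
  mu.-integrable setT (EFin \o g) -> (forall y, `|f y| <= g y) ->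
  `|\int[mu]_y f y| <= \int[mu]_y g y.
Proof.
move=> mf gi fg; have fi : mu.-integrable setT (EFin \o f) by exact: (intR_le
  measurableT mf).
apply: (le_trans (le_normr_Rintegral measurableT fi)).
by apply: le_Rintegral => //; exact: intR_abs.
Qed.

Section Gauss.
Variables (R : realType) (sg : R).
Hypothesis sg0 : 0 < sg.
Notation mu := (@lebesgue_measure R).

Definition gs (t : R) := gauss_fun (sg * t).
Definition gvar := 2 * sg ^+ 2.

Lemma gs_ge0 t : 0 <= gs t. Proof. exact: gauss_fun_ge0. Qed.

Lemma is_derive_gauss (c t : R) :
  is_derive t 1 (fun t => gauss_fun (c * t)) (- (2 * c ^+ 2 * t) * gauss_fun (c * t)).
Proof.
have h := @is_derive_horner R ((- c ^+ 2)%:P * 'X^2) t.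
have -> : (fun t => gauss_fun (c * t)) = fun t => expR (((- c ^+ 2)%:P * 'X^2).[t]).
  by apply/funext => x; rewrite /gauss_fun hornerM hornerC hornerXn exprMn mulNr.
apply: is_derive_eq (is_derive_chain (is_derive_expR _) h) _.
have -> : ((- c ^+ 2)%:P * 'X^2).[t] = - (c * t) ^+ 2.
  by rewrite hornerM hornerC hornerXn exprMn mulNr.
rewrite derivM derivC mul0r add0r derivXn hornerM hornerC hornerMn hornerX.
by rewrite /gauss_fun -mulr_natl; ring.
Qed.

Lemma is_derive_gs (t : R) : is_derive t 1 gs (- (gvar * t) * gs t).
Proof. exact: is_derive_gauss. Qed.

Lemma continuous_gs : continuous gs.
Proof. by move=> t; exact: is_derive1_continuous (is_derive_gs t). Qed.

(** With z = (sg t)^2 / 2, one factor exp (- z) of the Gaussian is kept and the other absorbs the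
    power of t, because exp z dominates z^(a+1) / (a+1)!. The kept factor is a normal density of
    deviation 1 / sg up to a constant, see [integrable_gauss2]. *)
Lemma gs_moment_bound a : exists2 C : R, 0 <= C &
  forall t, (1 + `|t|) ^+ a * gs t <= C * expR (- (sg * t) ^+ 2 / 2).
Proof.
pose k := (2 / sg ^+ 2) ^+ a.+1 * a.+1`!%:R.
have k0 : 0 <= k by rewrite mulr_ge0 ?ler0n// exprn_ge0// divr_ge0// exprn_ge0// ltW.
exists (2 ^+ a * (2 + k)); first by rewrite mulr_ge0 ?exprn_ge0 ?addr_ge0.
move=> t; set z := (sg * t) ^+ 2 / 2.
have z0 : 0 <= z by rewrite divr_ge0 ?sqr_ge0.
have -> : gs t = expR (- z) * expR (- z).
  by rewrite -expRD /gs /gauss_fun /z; congr expR; field.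
rewrite mulNr -/z mulrA ler_wpM2r ?expR_ge0//.
have ta : `|t| ^+ a <= 1 + (t ^+ 2) ^+ a.+1.
  have [t1|t1] := leP `|t| 1.
    apply: (@le_trans _ _ 1); first exact: exprn_ile1.
    by rewrite lerDl exprn_ge0 ?sqr_ge0.
  rewrite (@le_trans _ _ ((t ^+ 2) ^+ a.+1)) ?lerDr// -real_normK ?num_real// -exprM.
  by rewrite ler_weXn2l ?(ltW t1)//; lia.
have tz : (t ^+ 2) ^+ a.+1 <= k * expR z.
  have -> : t ^+ 2 = (2 / sg ^+ 2) * z by rewrite /z exprMn; field; rewrite gt_eqF.
  rewrite exprMn /k -mulrA ler_wpM2l ?exprn_ge0 ?divr_ge0 ?exprn_ge0 ?(ltW sg0)//.
  have := expR_ge1Dxn a z0; rewrite -lerBrDl => h.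
  rewrite mulrC -ler_pdivrMr ?ltr0n ?fact_gt0// (le_trans h)// lerBlDr lerDl//.
have e1 : 1 <= expR z by rewrite -expR0 ler_expR.
rewrite (@le_trans _ _ (2 ^+ a * (1 + `|t| ^+ a) * expR (- z)))//.
  by rewrite ler_wpM2r ?expR_ge0// exprD1_bound.
rewrite -mulrA ler_wpM2l ?exprn_ge0// expRN ler_pdivrMr ?expR_gt0//.
rewrite (le_trans (lerD (lexx 1) ta))// mulrDl addrA lerD//.
by rewrite ler_peMr.
Qed.

Lemma integrable_gauss2 : mu.-integrable setT (EFin \o (fun t =>
  expR (- (sg * t) ^+ 2 / 2))).
Proof.
have s0 : sg^-1 != 0 by rewrite invr_eq0 gt_eqF.
have := intRZ measurableT (normal_peak sg^-1)^-1 (integrable_normal_pdf (0 : R) sg^-1).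
apply: (eq_intR measurableT) => t _; rewrite normal_pdfE//
  mulKf ?gt_eqF ?normal_peak_gt0//.
rewrite /normal_fun subr0; congr expR; rewrite exprMn exprVn.
by field; rewrite gt_eqF.
Qed.

Lemma integrable_gs_moment (h : R -> R) a : measurable_fun setT h ->
  (forall t, `|h t| <= (1 + `|t|) ^+ a * gs t) -> mu.-integrable setT (EFin \o h).
Proof.
move=> mh hb; have [C C0 hC] := gs_moment_bound a.
apply: (@intR_le _ _ _ mu setT measurableT h _ mh (fun t _ => le_trans (hb t) (hC t))).
apply: intRZ => //; exact: integrable_gauss2.
Qed.

Lemma cvg_gs_moment (h : R -> R) a : (forall t, `|h t| <= (1 + `|t|) ^+ a * gs t) ->
  h n%:R @[n --> \oo] --> 0 /\ h (- n%:R) @[n --> \oo] --> 0.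
Proof.
move=> hb; have [C C0 hC] := gs_moment_bound a.
have c : C * gauss_fun (sg / 2 * n%:R) @[n --> \oo] --> (0 : R).
  rewrite -[X in _ --> X](mulr0 C); apply: cvgMr.
  have c : sg / 2 * n%:R @[n --> \oo] --> +oo.
    apply/cvgryPge => A; near=> n; rewrite mulrC -ler_pdivrMr ?divr_gt0//.
    by near: n; exact: nbhs_infty_ger.
  exact: (cvg_comp _ _ c (@cvg_gauss_fun R)).
have b t : `|h t| <= C * gauss_fun (sg / 2 * t).
  rewrite (le_trans (hb t))// (le_trans (hC t))// ler_wpM2l// ler_expR.
  by rewrite mulrAC mulNr lerN2 exprMn exprVn ler_wpM2l ?sqr_ge0//; lra.
split; apply: norm_cvg0; apply: (@squeeze_cvgr _ _ _ _ (fun=> 0) _ _ _ _ _ c);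
  try exact: cvg_cst; apply: nearW => n; rewrite normr_ge0//=.
by rewrite (le_trans (b _))// /gauss_fun mulrN sqrrN.
Unshelve. all: by end_near. Qed.

(** Cosine transform of t^a gs t with phase n, a quarter period per unit; differentiation in z
    raises a and n by one. *)
Definition kap a n z := \int[mu]_t (t ^+ a * gs t * cosn n (t * z)).

Lemma continuous_kapint a n z : continuous (fun t : R =>
  t ^+ a * gs t * cosn n (t * z)).
Proof.
move=> t; apply: cvgM; first by apply: cvgM; [exact: exprn_continuous|exact:
  continuous_gs].
exact: is_derive1_continuous (is_derive_cosnM n t z).
Qed.

Lemma kapint_bound a n z t : `|t ^+ a * gs t * cosn n (t * z)| <= `|t| ^+ a * gs t.
Proof.
rewrite !normrM normrX (ger0_norm (gs_ge0 t)) ler_piMr ?cosn_le1//.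
by rewrite mulr_ge0 ?exprn_ge0 ?gs_ge0.
Qed.

Lemma kapint_bound1 a t : `| `|t| ^+ a * gs t | <= (1 + `|t|) ^+ a * gs t.
Proof.
rewrite normrM normrX normr_id (ger0_norm (gs_ge0 t)) ler_wpM2r ?gs_ge0//.
by rewrite lerXn2r ?nnegrE ?addr_ge0// lerDr.
Qed.

Lemma integrable_abs_moment a : mu.-integrable setT (EFin \o (fun t =>
  `|t| ^+ a * gs t)).
Proof.
apply: (@integrable_gs_moment _ a _ (kapint_bound1 a)).
apply: continuous_measurable_fun => t; apply: cvgM; last exact: continuous_gs.
exact: (cvg_comp (fun t : R => `|t|) (fun s =>
  s ^+ a) (@norm_continuous R R t) (@exprn_continuous _ a _)).
Qed.

Lemma integrable_kapint a n z : mu.-integrable setT (EFin \o (fun t =>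
  t ^+ a * gs t * cosn n (t * z))).
Proof.
apply: intR_le (integrable_abs_moment a) => //; last by move=> t _; exact: kapint_bound.
by apply: continuous_measurable_fun; exact: continuous_kapint.
Qed.

Lemma kap_bound a n z : `|kap a n z| <= \int[mu]_t (`|t| ^+ a * gs t).
Proof.
apply: Rintegral_norm_le => [||t].
- by apply: continuous_measurable_fun; exact: continuous_kapint.
- exact: integrable_abs_moment.
- exact: kapint_bound.
Qed.

Lemma is_derive_kap a n (z : R) : is_derive z 1 (kap a n) (kap a.+1 n.+1 z).
Proof.
apply: (@is_derive_under_integral _ _ _ mu (fun z t => t ^+ a * gs t * cosn n (t * z))
  (fun z t => t ^+ a.+1 * gs t * cosn n.+1 (t * z)) (fun t => `|t| ^+ a.+1 * gs t)).
- exact: integrable_kapint.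
- move=> {}z t; have h := is_derive_cosnM n z t.
  have -> : (fun z => t ^+ a * gs t * cosn n (t * z)) = (fun z =>
    t ^+ a * gs t * cosn n (z * t)).
    by apply/funext => y; rewrite [t * y]mulrC.
  apply: is_derive_eq (is_derive1Z _ h) _.
  by rewrite [z * t]mulrC exprS; ring.
- exact: integrable_abs_moment.
- by move=> {}z t; exact: kapint_bound.
Qed.

Lemma continuous_kap a n : continuous (kap a n).
Proof. by move=> z; exact: is_derive1_continuous (is_derive_kap a n z). Qed.

Lemma kap_ibp n z : gvar * kap 1 n.+1 z = - (z * kap 0 n z).
Proof.
pose f t := gs t * cosn n.+1 (t * z).
pose f' t := - gvar * (t ^+ 1 * gs t * cosn n.+1 (t * z)) + - z * (t ^+ 0 * gs t * cosn
  n (t * z)).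
have df (t : R) : is_derive t 1 f (f' t).
  apply: is_derive_eq (is_derive1M (is_derive_gs t) (is_derive_cosnM n.+1 t z)) _.
  by rewrite /f' cosnSS expr1 expr0; ring.
have i1 := intRZ measurableT (- gvar) (integrable_kapint 1 n.+1 z).
have i2 := intRZ measurableT (- z) (integrable_kapint 0 n z).
have b t : `|f t| <= (1 + `|t|) ^+ 0 * gs t.
  rewrite expr0 mul1r normrM (ger0_norm (gs_ge0 t)) ler_piMr ?gs_ge0 ?cosn_le1//.
have [fp fn] := cvg_gs_moment b.
have : \int[mu]_t f' t = 0.
  apply: (Rintegral_derive_line df _ _ fp fn); last exact: intRD.
  move=> t; apply: cvgD; apply: cvgMr; exact: continuous_kapint.
rewrite /f' RintegralD// !RintegralZl//; try exact: integrable_kapint.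
by move=> /eqP; rewrite addr_eq0 mulNr eqr_opp => /eqP ->; rewrite mulNr.
Qed.

(* By kap_ibp, kap 0 n solves the equation k' = - z k / gvar. *)
Lemma kap0E n z : kap 0 n z = cosn n 0 * (kap 0 0 0 * gauss_fun (z / (2 * sg))).
Proof.
have g0 : 2 * gvar != 0 by rewrite !mulf_neq0 ?gt_eqF ?exprn_gt0 ?pnatr_eq0.
pose E (x : R) := expR (((2 * gvar)^-1%:P * 'X^2).[x]).
have dE (x : R) : is_derive x 1 E (E x * (x / gvar)).
  apply: is_derive_eq (is_derive_chain (is_derive_expR _) (is_derive_horner _ _)) _.
  rewrite /E derivM derivC mul0r add0r derivXn; congr (_ * _).
  by rewrite hornerM hornerC hornerMn hornerX -mulr_natl; field; rewrite -/gvar;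
    move: g0; rewrite mulf_eq0 negb_or => /andP[].
have h0 (x : R) : is_derive x 1 (fun x => kap 0 n x * E x) 0.
  apply: is_derive_eq (is_derive1M (is_derive_kap 0 n x) (dE x)) _.
  have gv : gvar != 0 by move: g0; rewrite mulf_eq0 negb_or => /andP[].
  have -> : kap 1 n.+1 x = - (x * kap 0 n x) / gvar by rewrite -kap_ibp mulrC mulKf.
  by field.
have := is_derive_0_is_cst z 0 h0.
have E0 : E 0 = 1 by rewrite /E hornerM hornerXn expr0n mulr0 expR0.
rewrite E0 mulr1 => e.
have -> : gauss_fun (z / (2 * sg)) = (E z)^-1.
  rewrite -expRN /gauss_fun; congr expR; rewrite hornerM hornerC hornerXn /gvar.
  by field; rewrite gt_eqF.
rewrite mulrA; apply: (canRL (mulfK _)); first by rewrite gt_eqF ?expR_gt0.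
rewrite e /kap -RintegralZl//; last exact: integrable_kapint.
by apply: eq_Rintegral => t _; rewrite mulr0 cosn00; ring.
Qed.

(** For a = 0 this follows from [kap0E], and differentiating in z raises both indices on both
    sides. *)
Lemma kap_shift a m z : kap a (m + a) z = cosn m 0 * kap a a z.
Proof.
elim: a z => [|a ih] z.
  by rewrite addn0 (kap0E m z) (kap0E 0 z) cosn00 mul1r.
have d1 := is_derive_kap a (m + a) z.
have d2 := is_derive1Z (cosn m 0) (is_derive_kap a a z).
rewrite addnS -(is_derive1E d1) -(is_derive1E d2); congr (derive1 _ z).
exact/funext.
Qed.

(* If n and a have different parities, both sides vanish. *)
Lemma kapE a n z : kap a n z = cosn (n + 3 * a) 0 * kap a a z.
Proof.
rewrite -kap_shift -addnA -mulSnr; apply: eq_Rintegral => t _.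
by rewrite cosnD4.
Qed.

Lemma kap00_gt0 : 0 < kap 0 0 0.
Proof.
have -> : kap 0 0 0 = \int[mu]_t gs t.
  by apply: eq_Rintegral => t _; rewrite expr0 mul1r mulr0 cosn00 mulr1.
have gi : mu.-integrable setT (EFin \o gs).
  have := integrable_abs_moment 0; apply: (eq_intR measurableT) => t _.
  by rewrite expr0 mul1r.
apply: (@lt_le_trans _ _ (\int[mu]_(t in `[0%R, 1%R]) gauss_fun sg)).
  rewrite Rintegral_cst; last exact: measurable_itv.
  have := @lebesgue_measure_itv R `[0%R, 1%R];
    rewrite /= lte_fin ltr01 oppr0 adde0 => e.
  rewrite [X in fine X]e mulr1.
  exact: expR_gt0.
rewrite Rintegral_mkcond; apply: le_Rintegral => // [|t _].
  have := iffLR (@integrable_mkcond _ _ R mu `[0, 1]%classic _ (measurable_itv _))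
    (integrable_itv 0 1 (@cst_continuous R R (gauss_fun sg))).
  by rewrite restrict_EFin.
rewrite patchE; case: ifPn => [|_]; last exact: gs_ge0.
rewrite inE/= in_itv/= => /andP[t0 t1].
rewrite ler_expR lerN2 lerXn2r ?nnegrE ?mulr_ge0 ?(ltW sg0)//.
by rewrite ler_piMr// ltW.
Qed.

End Gauss.

(** * Characteristic functions against Gaussians *)

Section GaussPoly.
Variables (R : realType).

(* gpoly s l b is the coefficient of d^b in the normal form of (y + s d)^l: on
   gs t * cosn k (t y), the derivative in t acts as y + gvar d/dy followed by
   the shift of k, because gs' = - gvar t gs. *)
Fixpoint gpoly (s : R) (l b : nat) : {poly R} := if l is l'.+1 then
    'X * gpoly s l' b + b.+1%:R *: gpoly s l' b.+1 + (if b is b'.+1 then s *: gpoly s l'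
      b' else 0)
  else (b == 0%N)%:R%:P.

Lemma gpoly_gt s l b : (l < b)%N -> gpoly s l b = 0.
Proof.
elim: l b => [|l ih] [|b]//= lb.
by rewrite !ih ?mulr0 ?scaler0 ?addr0//; lia.
Qed.

Lemma size_gpoly s l b : (size (gpoly s l b) <= l.+1)%N.
Proof.
elim: l b => [|l ih] b /=; first exact: size_polyC_leq1.
have sz (c : R) k : (size (c *: gpoly s l k) <= l.+2)%N.
  by rewrite (leq_trans (size_scale_leq _ _))// (leq_trans (ih k)).
rewrite (leq_trans (size_polyD _ _))// geq_max (leq_trans (size_polyD _ _))/=.
  by case: b => [|b]; rewrite ?size_poly0//.
rewrite geq_max sz andbT (leq_trans (size_polyMleq _ _))// size_polyX.
by rewrite add2n ltnS (leq_trans (ih b)).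
Qed.

(** As s tends to 0, (y + s d)^l degenerates to y^l, whose only coefficient sits at b = 0. *)
Lemma cvg_gpoly (s : nat -> R) l b e : s m @[m --> \oo] --> 0 ->
  (gpoly (s m) l b)`_e @[m --> \oo] --> (((b == 0%N) && (e == l))%:R : R).
Proof.
move=> s0; elim: l b e => [|l ih] b e /=.
  under eq_cvg do rewrite coefC.
  by case: b; case: e => *; exact: cvg_cst.
under eq_cvg do rewrite !coefD coefXM coefZ.
have -> : ((b == 0%N) && (e == l.+1))%:R =
  (if e == 0%N then 0 else ((b == 0%N) && (e.-1 == l))%:R) + b.+1%:R * 0 + 0 :> R.
  by rewrite mulr0 !addr0; case: e => //; rewrite andbF.
apply: cvgD.
  apply: cvgD; first by case: eqP => _; [exact: cvg_cst|exact: ih].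
  by apply: cvgMr; exact: (ih b.+1 e).
case: b => [|b]; first by under eq_cvg do rewrite coef0; exact: cvg_cst.
under eq_cvg do rewrite coefZ.
by have := cvgM s0 (ih b e); rewrite mul0r; apply.
Qed.

End GaussPoly.

Section Smoothing.
Context {d : measure_display} {Om : measurableType d} {R : realType}.
Variables (P : probability Om R) (X : {RV P >-> R}) (sg : R).
Hypothesis sg0 : 0 < sg.
Notation mu := (@lebesgue_measure R).
Notation gs := (gs sg).
Notation gvar := (gvar sg).
Notation kap := (kap sg).

Lemma measurable_comp_RV (h : R -> R) : continuous h ->
  measurable_fun setT (fun w => h (X w)).
Proof.
move=> hc; have mX : measurable_fun setT (X : Om ->
  measurableTypeR R) := measurable_funP X.
by apply: measurableT_comp mX; exact: continuous_measurable_fun.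
Qed.

Lemma intR_bounded (h : Om -> R) (C : R) : measurable_fun setT h ->
  (forall w, `|h w| <= C) ->
  P.-integrable setT (EFin \o h).
Proof.
move=> mh hC; apply: (@intR_le _ _ _ P setT measurableT h (fun=> C)) => //.
exact: finite_measure_integrable_cst.
Qed.

Definition smooth_kap a n y := \int[P]_w kap a n (y - X w).

Lemma measurable_shift_RV (h : R -> R) y : continuous h ->
  measurable_fun setT (fun w => h (y - X w)).
Proof.
move=> hc; apply: (@measurable_comp_RV (fun x => h (y - x))) => x.
by apply: continuous_comp; [apply: cvgB; [exact: cvg_cst|exact: cvg_id]|exact: hc].
Qed.

Lemma is_derive_expect_shift (h h' : R -> R) (C C' : R) (y : R) : (forall x : R,
  is_derive x 1 h (h' x)) ->
  (forall x, `|h x| <= C) -> (forall x, `|h' x| <= C') ->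
  is_derive y 1 (fun y => \int[P]_w h (y - X w)) (\int[P]_w h' (y - X w)).
Proof.
move=> hh' hC hC'; apply: (@is_derive_under_integral _ _ _ P (fun y w => h (y - X w))
  (fun y w => h' (y - X w)) (fun=> C')) => [z|z w||z w].
- apply: (@intR_bounded _ C) => //; apply: measurable_shift_RV => x.
  exact: is_derive1_continuous (hh' x).
- have d1 : is_derive z 1 (fun y => y - X w) 1.
    by have := is_derive1D (is_derive_id z 1) (is_derive_cst (- X w) z 1);
      rewrite addr0.
  by have := @is_derive_chain R h (fun y => y - X w) z _ _ (hh' (z - X w)) d1;
    rewrite mulr1.
- exact: finite_measure_integrable_cst.
- exact: hC'.
Qed.

Lemma is_derive_smooth_kap a n (y : R) :
  is_derive y 1 (smooth_kap a n) (smooth_kap a.+1 n.+1 y).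
Proof.
by apply: is_derive_expect_shift => [x|x|x]; [exact: is_derive_kap|exact:
  kap_bound|exact: kap_bound].
Qed.

Definition echar n y t := \int[P]_w cosn n (t * (y - X w)).

Lemma measurable_cosn_RV n y t : measurable_fun setT (fun w => cosn n (t * (y - X w))).
Proof.
apply: (@measurable_shift_RV (fun z => cosn n (t * z))) => z.
apply: continuous_comp; last exact: continuous_cosn.
by apply: cvgMr; exact: cvg_id.
Qed.

Lemma integrable_cosn_RV n y t : P.-integrable setT (EFin \o (fun w =>
  cosn n (t * (y - X w)))).
Proof. by apply: (@intR_bounded _ 1); [exact: measurable_cosn_RV|move=> w;
  exact: cosn_le1]. Qed.

(** The link to the characteristic function: testing its real part against cosn n (t y) and its
    imaginary part against cosn (n + 3) (t y) amounts to an expectation in y - X. *)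
Lemma echarE n y t : echar n y t =
  fine ('E_P[fun w => cos (t * X w)])%E * cosn n (t * y) +
  fine ('E_P[fun w => sin (t * X w)])%E * cosn (n + 3) (t * y).
Proof.
have cE z : cos z = cosn 0 z :> R by rewrite /cosn mul0r addr0.
have sE z : sin z = cosn 3 z :> R by rewrite cosnSS cosnS mul0r addr0 opprK.
have i0 (k : nat) : P.-integrable setT (EFin \o (fun w => cosn k (t * X w))).
  apply: (@intR_bounded _ 1); last by move=> w; exact: cosn_le1.
  apply: (@measurable_comp_RV (fun z => cosn k (t * z))) => z.
  apply: continuous_comp; last exact: continuous_cosn.
  by apply: cvgMr; exact: cvg_id.
rewrite unlock -/(Rintegral P setT _) -/(Rintegral P setT _).
have -> : \int[P]_w cos (t * X w) = \int[P]_w cosn 0 (t * X w).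
  by apply: eq_Rintegral => w _; exact: cE.
have -> : \int[P]_w sin (t * X w) = \int[P]_w cosn 3 (t * X w).
  by apply: eq_Rintegral => w _; exact: sE.
rewrite mulrC [X in _ = _ + X]mulrC -!RintegralZl// -RintegralD//; try exact: intRZ.
by apply: eq_Rintegral => w _; rewrite mulrBr cosnB cE sE; ring.
Qed.

Lemma echar_le1 n y t : `|echar n y t| <= 1.
Proof.
have := @Rintegral_norm_le _ _ _ P _ _ (measurable_cosn_RV n y t)
  (finite_measure_integrable_cst P 1 measurableT) (fun w => cosn_le1 n (t * (y - X w))).
rewrite -[X in _ <= X -> _]/(\int[P]_(_ in setT) 1) Rintegral_cst//.
by rewrite [X in fine X](probability_setT P) mulr1.
Qed.

Lemma continuous_echar n y : continuous (echar n y).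
Proof.
move=> t; have tI : t \in `](t - 1), (t + 1)[%classic by rewrite inE/= in_itv/= ltrBlDr
  ltrDl ltr01.
apply: (@continuity_under_integral _ _ _ P (fun t w =>
  cosn n (t * (y - X w))) setT measurableT
  (t - 1) (t + 1) _ _ (fun=> 1) _ _ t tI).
- by move=> z _; exact: integrable_cosn_RV.
- apply: aeW => w _ z _; apply: continuous_comp; last exact: continuous_cosn.
  by apply: cvgMl; exact: cvg_id.
- exact: finite_measure_integrable_cst.
- by move=> z _; apply: aeW => w _; exact: cosn_le1.
Qed.

(** As [cosn] is bounded by 1, the Gaussian moment makes the integrand absolutely integrable on the
    product, so that an integral over frequencies becomes the expectation of a kernel at y - X. *)
Lemma smooth_kap_fubini a n y :
  \int[mu]_t (t ^+ a * gs t * echar n y t) = smooth_kap a n y.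
Proof.
pose F (z : Om * measurableTypeR R) : \bar R :=
  (z.2 ^+ a * gs z.2 * cosn n (z.2 * (y - X z.1)))%:E.
have mF : measurable_fun setT F.
  apply/measurable_EFinP; apply: measurable_funM.
    have c : continuous (fun t : R => t ^+ a * gs t).
      by move=> t; apply: cvgM; [exact: exprn_continuous|exact: continuous_gs].
    exact: (measurableT_comp (continuous_measurable_fun c) measurable_snd).
  apply: (measurableT_comp (continuous_measurable_fun (@continuous_cosn R n))).
  apply: measurable_funM; first exact: measurable_snd.
  apply: measurable_funB => //; apply: measurableT_comp; last exact: measurable_fst.
  exact: (measurable_funP X).
pose la : {sigma_finite_measure set (measurableTypeR R) -> \bar R} := mu.
have FE w t : F (w, t) = (t ^+ a * gs t * cosn n (t * (y - X w)))%:E by [].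
have mM := integrable_abs_moment sg0 a.
have iF : (P \x la)%E.-integrable setT F.
  apply/(integrable12ltyP P la mF).
  apply: (@le_lt_trans _ _ (\int[P]_w (\int[mu]_t (`|t| ^+ a * gs t))%:E)%E);
    last first.
    by rewrite integral_cst// [X in (_ * X)%E](probability_setT P) mule1 ltry.
  apply: ge0_le_integral => //.
  - by move=> w _; exact: integral_ge0.
  - apply: (@measurable_fun_fubini_tonelli_F _ _ _ _ _ la (abse \o F)) => //.
      exact: measurableT_comp.
    by move=> z; exact: abse_ge0.
  - move=> w _; rewrite /Rintegral fineK; last exact: integrable_fin_num.
    apply: ge0_le_integral => //.
    + apply: measurableT_comp => //; apply/measurable_EFinP.
      exact: (continuous_measurable_fun (@continuous_kapint R sg a n (y - X w))).
    + exact: measurable_int mM.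
    + by move=> t _; rewrite FE lee_fin; exact: kapint_bound.
have h := @Fubini _ _ _ _ _ P la F iF.
rewrite /smooth_kap /Rintegral; congr fine.
transitivity (\int[la]_t \int[P]_w F (w, t))%E.
  apply: eq_integral => t _.
  rewrite /echar -RintegralZl//; last exact: integrable_cosn_RV.
  rewrite /Rintegral fineK//; apply: integrable_fin_num => //.
  by apply: intRZ => //; exact: integrable_cosn_RV.
rewrite -h; apply: eq_integral => w _.
by rewrite /kap /Rintegral fineK//; apply: integrable_fin_num => //;
  exact: integrable_kapint.
Qed.

Definition tfun k b (y t : R) := t ^+ b * gs t * cosn k (t * y).

(** The minus sign of gs' is turned into two steps of phase. Then each term has phase minus power of
    t raised by one, which is why [tsum] can use the phase m + l + b throughout. *)
Lemma is_derive_tfun k b y (t : R) : is_derive t 1 (tfun k b y)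
  (b%:R * tfun k b.-1 y t + gvar * tfun k.+2 b.+1 y t + y * tfun k.+1 b y t).
Proof.
have d1 : is_derive t 1 (fun t : R => t ^+ b) (b%:R * t ^+ b.-1).
  have -> : (fun t : R => t ^+ b) = fun t => 'X^b.[t] by apply/funext => z;
    rewrite hornerXn.
  by apply: is_derive_eq (is_derive_horner _ _) _;
    rewrite derivXn hornerMn hornerXn mulr_natl.
rewrite -[tfun k b y]/(fun t => t ^+ b * gs t * cosn k (t * y)).
have d2 := is_derive1M d1 (is_derive_gs sg t).
have d3 := is_derive1M d2 (is_derive_cosnM k t y).
apply: is_derive_eq d3 _.
by rewrite /tfun cosnSS exprS; ring.
Qed.

Variable N : nat.

(* The l-th derivative of gs t * cosn m (t y) in t, for l < N. *)
Definition tsum m l y t := \sum_(b < N) (gpoly gvar l b).[y] * tfun (m + l + b) b y t.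

Lemma is_derive_tsum m l y (t : R) : (l.+1 < N)%N ->
  is_derive t 1 (tsum m l y) (tsum m l.+1 y t).
Proof.
move=> lN; have ds := @is_derive1_sum R _ (index_enum 'I_N) xpredT _ t _
  (fun b _ => is_derive1Z (gpoly gvar l b).[y] (is_derive_tfun (m + l + b) b y t)).
apply: is_derive_eq ds _; rewrite /tsum.
pose G b := (gpoly gvar l b).[y].
(* Together with l + 1 < N, this annuls the terms that the index shifts below push out of the
   range. *)
have G0 b : (l < b)%N -> G b = 0 by move=> lb; rewrite /G gpoly_gt// horner0.
under eq_bigr do rewrite -/(G _) 2!mulrDr.
have -> : \sum_(b < N) (gpoly gvar l.+1 b).[y] * tfun (m + l.+1 + b) b y t =
    \sum_(b < N) (b.+1%:R * G b.+1 * tfun (m + l + b).+1 b y t +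
      (if val b is b'.+1 return R then gvar * G b' * tfun (m + l + b').+2 b y t else 0)
        +
      y * (G b * tfun (m + l + b).+1 b y t)) :> R.
  apply: eq_bigr => b _; rewrite addnS addSn /= !hornerD hornerM hornerX hornerZ -!/(G
    _).
  case: (nat_of_ord b) => [|b']; first by rewrite horner0; ring.
  by rewrite hornerZ -/(G _) addnS; ring.
rewrite !big_split/=; congr (_ + _ + _); last by apply: eq_bigr => b _; rewrite mulrCA.
- case: N lN => // N' lN; rewrite big_ord_recl/= mul0r mulr0 add0r [RHS]big_ord_recr/=
  (G0 N'.+1); last by lia.
  rewrite mulr0 mul0r addr0.
  by apply: eq_bigr => b _; rewrite /bump/= !add1n addnS; ring.
- case: N lN => // N' lN; rewrite [RHS]big_ord_recl/= add0r big_ord_recr/= (G0 N');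
  last by lia.
  rewrite mul0r addr0.
  by apply: eq_bigr => b _; rewrite /bump/= !add1n; ring.
Qed.

Variables (L : diffop R) (Q : {poly R}).
Hypotheses (Q0 : Q != 0) (L1 : (1 <= Defs.order L)%N).
Let u (t : R) := fine ('E_P[fun w => cos (t * X w)])%E.
Let v (t : R) := fine ('E_P[fun w => sin (t * X w)])%E.
Hypothesis LQ : forall (b : bool) (x : R), let f := if b then u else v in Q.[x] != 0 ->
  (forall t, is_derive x 1 (derive1n t f) (derive1n t.+1 f x)) /\
  \sum_(t < size L) (L`_t).[x] * derive1n t f x = 0.
Hypothesis NL : N = size L.
Notation S := (adjoint_op L Q).

Let pf y k j t := derive1n k u t * tsum 0 j y t + derive1n k v t * tsum 3 j y t.

Lemma pf0E y j t : pf y 0 j t =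
  \sum_(b < N) (gpoly gvar j b).[y] * (t ^+ b * gs t * echar (j + b) y t).
Proof.
rewrite /pf /tsum 2!mulr_sumr -big_split/=; apply: eq_bigr => b _.
rewrite echarE -/(u t) -/(v t) /tfun add0n.
have -> : (3 + j + b = j + b + 3)%N by lia.
by ring.
Qed.

Lemma continuous_gs_echar a n y : continuous (fun t : R => t ^+ a * gs t * echar n y t).
Proof.
move=> t; apply: cvgM; last exact: continuous_echar.
by apply: cvgM; [exact: exprn_continuous|exact: continuous_gs].
Qed.

Lemma integrable_gs_echar K a n y :
  mu.-integrable setT (EFin \o (fun t => (1 + `|t|) ^+ K * (t ^+ a * gs t * echar n y
    t))).
Proof.
apply: (@integrable_gs_moment _ sg sg0 _ (K + a)) => [|t].
  apply: continuous_measurable_fun => t; apply: cvgM; last exact: continuous_gs_echar.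
  apply: (cvg_comp (fun t : R => 1 + `|t|) (fun s =>
    s ^+ K) _ (@exprn_continuous _ K _)).
  by apply: cvgD; [exact: cvg_cst|exact: (@norm_continuous R R t)].
rewrite !normrM !normrX (ger0_norm (gs_ge0 sg t)) exprD -!mulrA.
rewrite [`|1 + _|]ger0_norm ?addr_ge0// ler_wpM2l ?exprn_ge0 ?addr_ge0//.
rewrite ler_pM ?exprn_ge0 ?mulr_ge0 ?gs_ge0//.
  by rewrite lerXn2r ?nnegrE ?addr_ge0// lerDr.
by rewrite ler_piMr ?gs_ge0 ?echar_le1.
Qed.

(** [adjoint_op_integral] for u and v together, with test functions of phases 0 and 3: by [pf0E] the
    two products add up to Gaussian moments of [echar], whose integrals are the [smooth_kap]. *)
Lemma gauss_relation N1 y : (forall l, (size (S`_l)%R <= N1)%N) ->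
  \sum_(l < size L) \sum_(b < size L) \sum_(a < N1)
    (S`_l)`_a * ((gpoly gvar l b).[y] * smooth_kap (a + b) (l + b) y) = 0.
Proof.
move=> SN; have L0 : L != 0 by apply: contraTneq L1 => ->;
  rewrite /Defs.order size_poly0.
have sL : size L = (Defs.order L).+1 by rewrite /Defs.order prednK// size_poly_gt0.
have [D [LD _]] := max_coef_size L1.
have duv (b : bool) k (x : R) : Q.[x] != 0 ->
    let f := if b then u else v in is_derive x 1 (derive1n k f) (derive1n k.+1 f x).
  by move=> Qx; have [] := LQ b Qx.
have pf0fun j : pf y 0 j = fun t =>
    \sum_(b < N) (gpoly gvar j b).[y] * (t ^+ b * gs t * echar (j + b) y t).
  by apply/funext => t; exact: pf0E.
have [|||||_ pi0] := @adjoint_op_integral R L Q Q0 L0 (pf y) _ _ _ _ D LD _.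
- move=> k j x kT jT Qx; have jN : (j.+1 < N)%N by rewrite NL sL.
  have du := is_derive1M (duv true k x Qx) (is_derive_tsum 0 y x jN).
  have dv := is_derive1M (duv false k x Qx) (is_derive_tsum 3 y x jN).
  apply: is_derive_eq (is_derive1D du dv) _; exact: addrACA.
- move=> k j x kT jT Qx.
  have tc m : {for x, continuous (tsum m j y)}.
    apply: cvg_big => //; [exact: add_continuous|move=> b _; apply: cvgMr].
    exact: is_derive1_continuous (is_derive_tfun (m + j + b) b y x).
  apply: cvgD; apply: cvgM; [|exact: tc| |exact: tc].
    exact: is_derive1_continuous (duv true k x Qx).
  exact: is_derive1_continuous (duv false k x Qx).
- move=> x Qx; rewrite /pf.
  under eq_bigr do rewrite mulrDr !mulrA.
  by rewrite big_split/= -!mulr_suml (LQ true Qx).2 (LQ false Qx).2 !mul0r addr0.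
- move=> j jT; rewrite pf0fun; apply: continuous_measurable_fun => t.
  apply: cvg_big => //; [exact: add_continuous|move=> b _; apply: cvgMr].
  exact: continuous_gs_echar.
- move=> j jT; rewrite pf0fun.
  have := @intR_sum _ _ _ mu setT measurableT _ (index_enum 'I_N) xpredT _
    (fun b _ => intRZ measurableT (gpoly gvar j b).[y] (integrable_gs_echar (D + 2 *
      (Defs.order L).+3 * (size Q).-1) b (j + b) y)).
  apply: (eq_intR measurableT) => t _; rewrite mulr_sumr.
  by apply: eq_bigr => b _; rewrite mulrCA.
rewrite -[RHS]pi0.
pose F (l b a : nat) t := (S`_l)`_a * ((gpoly gvar l b).[y] * (t ^+ (a + b) * gs t *
  echar (l + b) y t)).
have Fi l b a : mu.-integrable setT (EFin \o F l b a).
  apply: intRZ => //; apply: intRZ => //.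
  have := integrable_gs_echar 0 (a + b) (l + b) y; apply: (eq_intR measurableT) => t _.
  by rewrite expr0 mul1r.
transitivity (\int[mu]_t \sum_(l < size L) \sum_(b < size L) \sum_(a < N1) F l b a t).
  rewrite Rintegral_sum//; last by move=> l _; do 2 (apply: intR_sum => // ? _).
  apply: eq_bigr => l _; rewrite Rintegral_sum//; last by move=> b _; apply: intR_sum.
  apply: eq_bigr => b _; rewrite Rintegral_sum//.
  apply: eq_bigr => a _; have ei : mu.-integrable setT (EFin \o (fun t =>
    t ^+ (a + b) * gs t * echar (l + b) y t)).
    have := integrable_gs_echar 0 (a + b) (l + b) y;
      apply: (eq_intR measurableT) => t _.
    by rewrite expr0 mul1r.
  by rewrite /F RintegralZl//; [rewrite RintegralZl// smooth_kap_fubini|exact: intRZ].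
apply: eq_Rintegral => t _; apply: eq_bigr => l _.
rewrite pf0E NL mulr_sumr; apply: eq_bigr => b _.
rewrite (horner_coef_wide _ (SN l)) mulr_suml; apply: eq_bigr => a _.
by rewrite /F exprD; ring.
Qed.

End Smoothing.

(** * Recovering the density *)

Section Derivative.
Variable R : realType.

(** The last clause admits every g that agrees with c f' off the zeros of q, so that a density may
    be prescribed freely on that finite set. *)
Lemma rational_system_derivative (f : R -> R) (c : R) : rational_system f ->
  exists q : {poly R}, [/\ q != 0,
    forall x : R, q.[x] != 0 -> is_derive x 1 f (derive1 f x),
    forall x, q.[x] != 0 -> {for x, continuous (derive1 f)} &
    forall g, (forall x, q.[x] != 0 -> g x = c * derive1 f x) -> rational_system g].
Proof.
move=> [m [q [A [B [w [q0 wf]]]]]]; exists q; split=> //.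
- by move=> x qx; exact: (is_derive_derive1n wf 0 qx).
- by move=> x qx; exact: is_derive1_continuous (is_derive_derive1n wf 1 qx).
move=> g gE; exists m, (q ^+ 2), (fun j k => q * A j k), (fun k =>
  c *: derivn_coef q A B 1 k), w.
split; first by rewrite expf_neq0.
move=> x; rewrite horner_exp expf_eq0/= => qx; have [dw _] := wf x qx; split=> [j|].
  apply: is_derive_eq (dw j) _.
  under [X in _ = X / _]eq_bigr do rewrite hornerM -mulrA.
  by rewrite -mulr_sumr expr2 -mulf_div divff// mul1r.
rewrite gE// -[derive1 f]/(derive1n 1 f) (derive1n_comb wf 1 qx) mulrA mulr_sumr;
  congr (_ / _).
by apply: eq_bigr => k _; rewrite hornerZ mulrA.
Qed.

End Derivative.

Section Erf.
Variable R : realType.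
Notation mu := (@lebesgue_measure R).
Import gauss_integral_proof.

(** Error function without normalisation: its limits are plus and minus sqrt pi / 2. *)
Definition erf : R -> R := prim (@gauss_fun R).

Lemma is_derive_erf (z : R) : is_derive z 1 erf (gauss_fun z).
Proof. by apply: is_derive_prim; exact: continuous_gauss_fun. Qed.

Lemma erfN z : erf (- z) = - erf z.
Proof.
have d (x : R) : is_derive x 1 (fun x => - erf (- x)) (gauss_fun x).
  have dN : is_derive x 1 (fun x : R => - x) (- 1) by exact: is_deriveN.
  have := is_deriveN (@is_derive_chain R erf (fun x =>
    - x) x _ _ (is_derive_erf (- x)) dN).
  by rewrite mulrN1 opprK /gauss_fun sqrrN.
by rewrite [in RHS]/erf (prim_unique (@continuous_gauss_fun R) d) oppr0 /erf prim0 oppr0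
  subr0 opprK.
Qed.

Lemma erf_ge0E z : 0 <= z -> erf z = integral0_gauss z.
Proof. by move=> z0; rewrite /erf /prim [X in _ - X]Rintegral_itv_ge// subr0. Qed.

Definition erf_lim : R := Num.sqrt (pi / 4).

Lemma erf_lim_gt0 : 0 < erf_lim.
Proof. by rewrite sqrtr_gt0 divr_gt0 ?pi_gt0. Qed.

Lemma cvg_erf : erf z @[z --> +oo] --> erf_lim.
Proof.
have : Num.sqrt (@integral0_gauss R x ^+ 2) @[x --> +oo] --> Num.sqrt (pi / 4).
  by apply: continuous_cvg => //; [exact: sqrt_continuous|exact:
    cvg_integral0_gauss_sqr].
apply: cvg_trans; apply: near_eq_cvg; near=> z.
rewrite sqrtr_sqr ger0_norm ?integral0_gauss_ge0// erf_ge0E//.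
Unshelve. all: by end_near. Qed.

Lemma erf_mono z1 z2 : z1 <= z2 -> erf z1 <= erf z2.
Proof.
rewrite le_eqVlt => /predU1P[->//|z12].
have pd (x : R) : x \in `]z1, z2[ -> is_derive x 1 erf (gauss_fun x).
  by move=> _; exact: is_derive_erf.
rewrite -subr_ge0; have [|x xab ->] := @MVT _ erf (@gauss_fun R) z1 z2 z12 pd.
  apply: continuous_subspaceT => x; exact: is_derive1_continuous (is_derive_erf x).
by rewrite mulr_ge0 ?gauss_fun_ge0 ?subr_ge0 ?ltW.
Qed.

Lemma erf_bound z : `|erf z| <= erf_lim.
Proof.
have pos x : 0 <= x -> `|erf x| <= erf_lim.
  move=> x0; rewrite ger0_norm; last by rewrite erf_ge0E// integral0_gauss_ge0.
  apply: (cvgr_to_ge cvg_erf); near=> y; apply: erf_mono; near: y.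
  by apply: nbhs_pinfty_ge; exact: num_real.
have [/pos//|z0] := leP 0 z.
by rewrite -(opprK z) erfN normrN pos// oppr_ge0 ltW.
Unshelve. all: by end_near. Qed.

Lemma cvg_erf_scale z : erf (m.+1%:R * z) @[m --> \oo] --> erf_lim * Num.sg z.
Proof.
have pos x : 0 < x -> erf (m.+1%:R * x) @[m --> \oo] --> erf_lim.
  move=> x0; have c : m.+1%:R * x @[m --> \oo] --> +oo.
    apply/cvgryPge => A; near=> n; rewrite -ler_pdivrMr//.
    rewrite (@le_trans _ _ n%:R) ?ler_nat//; near: n; exact: nbhs_infty_ger.
  exact: (cvg_comp _ _ c cvg_erf).
have [z0|z0|<-] := ltgtP 0 z.
- by rewrite gtr0_sg// mulr1; exact: pos.
- rewrite ltr0_sg// mulrN1.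
  have h : - erf (m.+1%:R * - z) @[m --> \oo] --> - erf_lim.
    by apply: cvgN; apply: pos; rewrite oppr_gt0.
  by move: h; under eq_cvg do rewrite mulrN erfN opprK.
- rewrite sgr0 mulr0; under eq_cvg do rewrite mulr0 [erf 0]prim0.
  exact: cvg_cst.
Unshelve. all: by end_near. Qed.

End Erf.

Lemma nondecreasing_derive_ge0 (R : realType) (f : R -> R) (x a : R) :
  (forall y z, y <= z -> f y <= f z) -> is_derive x 1 f a -> 0 <= a.
Proof.
move=> mono d; rewrite -(is_derive1E d) /derive1.
have [dx _] := d; apply: limr_ge.
  by move: dx; rewrite /derivable; under eq_fun do rewrite scaler1.
near=> h; have h0 : h != 0 by near: h; exact: nbhs_dnbhs_neq.
have [hp|hn|/esym he] := ltgtP 0 h; last by rewrite he eqxx in h0.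
  by rewrite mulr_ge0 ?invr_ge0 ?(ltW hp)// subr_ge0 mono// lerDr ltW.
by rewrite mulr_le0 ?invr_le0 ?(ltW hn)// subr_le0 mono// gerDr ltW.
Unshelve. all: by end_near. Qed.

Section Cdf.
Context {d : measure_display} {Om : measurableType d} {R : realType}.
Variables (P : probability Om R) (X : {RV P >-> R}) (p : R -> R).
Hypothesis pd : is_density X p.
Notation mu := (@lebesgue_measure R).

Let F (y : R) := \int[mu]_(x in `]-oo, y]) p x.

(** Equal to 2 F y - 1; this form arises as the limit of the expectations of rescaled error
    functions at y - X. *)
Definition expect_sg (y : R) := \int[P]_w Num.sg (y - X w).

Lemma measurable_sg_shift (y : R) : measurable_fun setT (fun x : R => Num.sg (y - x)).
Proof.
have -> : (fun x : R => Num.sg (y - x)) = fun x =>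
  \1_(`]-oo, y[%classic : set R) x - \1_(`]y, +oo[%classic : set R) x.
  apply/funext => x; rewrite !indicE !mem_setE !in_itv/= andbT.
  have [xy|xy|->] := ltgtP x y; last by rewrite subrr sgr0 subr0.
    by rewrite gtr0_sg ?subr_gt0// subr0.
  by rewrite ltr0_sg ?subr_lt0// sub0r.
by apply: measurable_funB; exact: measurable_indic.
Qed.

Lemma expect_sgE y : expect_sg y = \int[mu]_x (Num.sg (y - x) * p x).
Proof.
rewrite /expect_sg /Rintegral -(density_expectation pd);
  last exact: measurable_sg_shift.
by rewrite unlock.
Qed.

Lemma integrable_sg_density y : mu.-integrable setT (EFin \o (fun x =>
  Num.sg (y - x) * p x)).
Proof.
have [mp p0 _] := pd; apply: intR_le (density_integrable1 pd) => //.
  by apply: measurable_funM => //; exact: measurable_sg_shift.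
move=> x _; rewrite normrM (ger0_norm (p0 x)) ler_piMl//.
by rewrite normr_sg; case: (_ != 0); rewrite ?lexx ?ler01.
Qed.

Lemma sgr_le1 (z : R) : `|Num.sg z| <= 1.
Proof. by rewrite normr_sg; case: (_ != 0). Qed.

Lemma sgr_mono (y z : R) : y <= z -> Num.sg y <= Num.sg z.
Proof.
move=> yz; have [y0|y0|e] := ltgtP 0 y.
- by rewrite !gtr0_sg// (lt_le_trans y0).
- by rewrite (ltr0_sg y0); have := sgr_le1 z; rewrite ler_norml => /andP[].
- by rewrite -e sgr0 sgr_ge0 e.
Qed.

Lemma integrable_half y : mu.-integrable `]-oo, y] (EFin \o p).
Proof. by apply: integrableS (density_integrable1 pd) => //; exact: measurable_itv. Qed.

Lemma expect_sg_cdf y : expect_sg y = 2 * F y - 1.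
Proof.
have [mp p0 pA] := pd; have ip := density_integrable1 pd.
have p1 : \int[mu]_x p x = 1.
  by rewrite /Rintegral -(pA setT measurableT) [X in fine X]probability_setT.
have ih : mu.-integrable setT (EFin \o (p \_ `]-oo, y])).
  have := iffLR (@integrable_mkcond _ _ R mu `]-oo,
    y]%classic _ (measurable_itv _)) (integrable_half y).
  by rewrite restrict_EFin.
have -> : 2 * F y - 1 = \int[mu]_x (2 * (p \_ `]-oo, y]) x - p x).
  by rewrite RintegralB// ?RintegralZl// -?Rintegral_mkcond ?p1//; exact: intRZ.
rewrite expect_sgE.
rewrite /Rintegral; congr fine; apply: ae_eq_integral => //.
- by apply/measurable_EFinP; apply: measurable_funM => //; exact: measurable_sg_shift.
- apply/measurable_EFinP; apply: measurable_funB => //; apply: measurable_funM => //.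
  by apply/(measurable_restrictT _ (measurable_itv _)); exact: measurable_funTS.
have X0 : 'X - y%:P != 0 by rewrite polyXsubC_eq0.
apply: (@filterS _ _ (ae_filter_ringOfSetsType mu)) (ae_poly_neq0 X0) => x /=.
rewrite hornerXsubC subr_eq0 => xy _; congr EFin.
rewrite patchE mem_setE in_itv/=; have [xy'|xy'|e] := ltgtP x y;
  last by rewrite e eqxx in xy.
  by rewrite gtr0_sg ?subr_gt0//; ring.
by rewrite -[point]/(0 : R) ltr0_sg ?subr_lt0//; ring.
Qed.

(** For x different from y, sgn (u_n - x) is eventually sgn (y - x); the one exceptional point is
    negligible, and p dominates. *)
Lemma continuous_expect_sg : continuous expect_sg.
Proof.
have -> : expect_sg = fun y => \int[mu]_x (Num.sg (y - x) * p x) by apply/funext => y;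
  exact: expect_sgE.
move=> y; apply/(@cvg_nbhsP _ R^o) => u uy; have [mp p0 _] := pd.
have [||||| _ h] := @Rdominated _ _ R mu setT measurableT
  (fun n x => Num.sg (u n - x) * p x) (fun x => Num.sg (y - x) * p x) p; last exact: h.
- by move=> n; apply: measurable_funM => //; exact: measurable_sg_shift.
- by apply: measurable_funM => //; exact: measurable_sg_shift.
- have X0 : 'X - y%:P != 0 by rewrite polyXsubC_eq0.
  apply: (@filterS _ _ (ae_filter_ringOfSetsType mu)) (ae_poly_neq0 X0) => x /=.
  rewrite hornerXsubC subr_eq0 => xy _; apply: cvgMl; apply: cvg_near_cst.
  have [xy'|xy'|e] := ltgtP x y; last by rewrite e eqxx in xy.
    near=> n; rewrite !gtr0_sg ?subr_gt0//; near: n.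
    exact: (cvgr_gt y).
  near=> n; rewrite !ltr0_sg ?subr_lt0//; near: n.
  exact: (cvgr_lt y).
- by move=> n x _; rewrite normrM (ger0_norm (p0 x)) ler_piMl// sgr_le1.
- exact: density_integrable1 pd.
Unshelve. all: by end_near. Qed.

Lemma ae_derive_expect_sg : {ae mu, forall x : R, is_derive x 1 expect_sg (2 * p x)}.
Proof.
have loc : locally_integrable [set: R] p.
  exact: (open_integrable_locally openT (density_integrable1 pd)).
have := FTC1Ny integrable_half loc.
apply: (@filterS _ _ (ae_filter_ringOfSetsType mu)) => x [dF F'].
have h : is_derive x 1 F (p x) by apply: DeriveDef; [exact: dF|rewrite -derive1E;
  exact: F'].
have -> : expect_sg = fun y => 2 * F y + - 1 by apply/funext => y; exact: expect_sg_cdf.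
have hc : is_derive x 1 (fun=> - 1 : R) 0 by exact: is_derive_cst.
by have := is_derive1D (is_derive1Z 2 h) hc; rewrite addr0.
Qed.

Lemma expect_sg_mono y z : y <= z -> expect_sg y <= expect_sg z.
Proof.
move=> yz; have [mp p0 _] := pd; rewrite !expect_sgE; apply: le_Rintegral => //.
- exact: integrable_sg_density.
- exact: integrable_sg_density.
move=> x _; rewrite ler_wpM2r//.
by apply: sgr_mono; rewrite lerD2r.
Qed.

(* By Lebesgue differentiation, the density is almost everywhere half the
   derivative of 2 F - 1, where F is the distribution function. *)
Lemma density_of_expect_sg (c : R) : 0 < c ->
  rational_system (fun y => c * expect_sg y) ->
  exists2 p2 : R -> R, is_density X p2 & rational_system p2.
Proof.
move=> c0 rs; have [mp p0 pA] := pd.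
have [q [q0 df cf gf]] := rational_system_derivative (2 * c)^-1 rs.
set f := fun y => c * expect_sg y in rs df cf gf.
pose p2 := (fun x => (2 * c)^-1 * derive1 f x) \_ [set x | q.[x] != 0].
have p2E x : q.[x] != 0 -> p2 x = (2 * c)^-1 * derive1 f x.
  by move=> qx; rewrite /p2 patchE ifT// inE.
have Uo : open [set x | q.[x] != 0].
  rewrite openE => x /= qx; exact: near_poly_neq0.
have mp2 : measurable_fun setT p2.
  have mU : measurable [set x : measurableTypeR R | q.[x] != 0] by exact:
    open_measurable.
  apply/(measurable_restrictT _ mU).
  apply: open_continuous_measurable_fun => // x; rewrite inE/= => qx.
  by apply: cvgMr; exact: cf.
have ae2 : {ae mu, forall x, p2 x = p x}.
  apply: (@filterS2 _ _ (ae_filter_ringOfSetsType mu)) (ae_poly_neq0 q0)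
    ae_derive_expect_sg.
  move=> x qx dx; rewrite p2E// (is_derive1E (is_derive1Z c dx)).
  by field; rewrite gt_eqF.
exists p2; last exact: gf.
split=> [//|x|A mA].
- have [qx|qx] := boolP (q.[x] != 0); last by rewrite /p2 patchE memNset//=; exact/negP.
  rewrite p2E// mulr_ge0 ?invr_ge0 ?mulr_ge0 ?(ltW c0)//.
  apply: nondecreasing_derive_ge0 (df x qx) => y z yz.
  by rewrite /f ler_wpM2l ?(ltW c0)// expect_sg_mono.
rewrite pA//; apply: ae_eq_integral => //.
- by apply/measurable_EFinP; exact: measurable_funTS.
- by apply/measurable_EFinP; exact: measurable_funTS.
by apply: (@filterS _ _ (ae_filter_ringOfSetsType mu)) ae2 => x -> _.
Qed.

End Cdf.

(** * Holonomic characteristic functions *)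

Lemma smooth_kapE {d : measure_display} {Om : measurableType d} {R : realType}
    (P : probability Om R) (X : {RV P >-> R}) (sg : R) a n y : 0 < sg ->
  smooth_kap X sg a n y = cosn (n + 3 * a) 0 * smooth_kap X sg a a y.
Proof.
move=> sg0; rewrite /smooth_kap -RintegralZl//.
  by apply: eq_Rintegral => w _; rewrite (kapE sg0).
apply: (@intR_bounded _ _ _ _ _ (\int[@lebesgue_measure R]_t (`|t| ^+ a * gs sg t))).
  by apply: measurable_shift_RV; exact: continuous_kap.
by move=> w; exact: kap_bound.
Qed.

Section CharacteristicFunction.
Context {d : measure_display} {Om : measurableType d} {R : realType}.
Variables (P : probability Om R) (X : {RV P >-> R}) (p : R -> R).
Hypothesis pd : is_density X p.
Variables (L : diffop R) (Q : {poly R}) (i D : nat).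
Hypotheses (Q0 : Q != 0) (L1 : (1 <= Defs.order L)%N).
Let u (t : R) := fine ('E_P[fun w => cos (t * X w)])%E.
Let v (t : R) := fine ('E_P[fun w => sin (t * X w)])%E.
Hypothesis LQ : forall (b : bool) (x : R), let f := if b then u else v in Q.[x] != 0 ->
  (forall t, is_derive x 1 (derive1n t f) (derive1n t.+1 f x)) /\
  \sum_(t < size L) (L`_t).[x] * derive1n t f x = 0.
Hypothesis LD : forall t : nat, (size (L`_t)%R <= D.+1)%N.
Hypotheses (iL : (i < size L)%N) (LiD : size (L`_i)%R = D.+1) (Di : odd D = odd i).

Notation S := (adjoint_op L Q).
Let A := (D + 2 * (Defs.order L).+3 * (size Q).-1)%N.
Let N := size L.
Let tau m : R := m.+1%:R.
(** Chosen so that z / (2 sg) in [kap0E] is tau z: the kernel is a Gaussian that concentrates at 0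
    as m grows. *)
Let sg m : R := (2 * tau m)^-1.

Let tau0 m : 0 < tau m. Proof. exact: ltr0Sn. Qed.
Let sg0 m : 0 < sg m. Proof. by rewrite invr_gt0 mulr_gt0. Qed.
Let k0 m := kap (sg m) 0 0 0.
Let k00 m : 0 < k0 m. Proof. exact: kap00_gt0. Qed.

(** The sequence of derivatives starts at the primitive of the normalised kernel: smoothing the
    distribution function, and not the density, gives a bound uniform in m. *)
Let g m k (y : R) := if k is k'.+1 then tau m / k0 m * smooth_kap X (sg m) k' k' y
  else \int[P]_w erf (tau m * (y - X w)).

Let kap00E m z : kap (sg m) 0 0 z = k0 m * gauss_fun (tau m * z).
Proof.
rewrite (kap0E (sg0 m)) cosn00 mul1r; congr (_ * gauss_fun _).
by rewrite /sg; field; rewrite gt_eqF.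
Qed.

Let g_derive m k (y : R) : is_derive y 1 (g m k) (g m k.+1 y).
Proof.
case: k => [|k]; last by apply: is_derive1Z; exact: is_derive_smooth_kap.
have h (z : R) : is_derive z 1 (fun z => erf (tau m * z)) (gauss_fun (tau m * z) * tau
  m).
  have s := is_derive_scale (tau m) z.
  rewrite (_ : (fun z => erf (tau m * z)) = fun z => erf (z * tau m)); last first.
    by apply/funext => x; rewrite mulrC.
  rewrite [tau m * z]mulrC.
  exact: (@is_derive_chain R (@erf R) (fun y =>
    y * tau m) z _ _ (is_derive_erf (z * tau m)) s).
have hC' z : `|gauss_fun (tau m * z) * tau m| <= tau m.
  rewrite normrM (ger0_norm (gauss_fun_ge0 _)) (gtr0_norm (tau0 m)).
  by rewrite ler_piMl ?(ltW (tau0 m))// gauss_fun_le1.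
have hd := @is_derive_expect_shift _ _ _ P X _ _ _ _ y h (fun z => erf_bound _) hC'.
apply: is_derive_eq hd _; rewrite /g /smooth_kap -RintegralZl//.
  by apply: eq_Rintegral => w _; rewrite kap00E -mulrA mulKf ?gt_eqF// mulrC.
apply: (@intR_bounded _ _ _ _ _ (\int[@lebesgue_measure R]_t (`|t| ^+ 0 * gs (sg m)
  t))).
  by apply: measurable_shift_RV; exact: continuous_kap.
by move=> w; exact: kap_bound.
Qed.

(** An index (l, b', a, e') selects the coefficient of t^a in S_l and that of y^(e') in [gpoly] l
    b'. Its term is y^(e') times a kernel differentiated a + b' times, so a derivative of [g] of
    order a + b' + 1. *)
Let index : finType := ('I_N * 'I_N * 'I_A.+1 * 'I_N)%type.
Let c_ m (j : index) : R :=
  (S`_j.1.1.1)`_j.1.2 * cosn (j.1.1.1 + 3 * j.1.2) 0 * (gpoly (gvar (sg m)) j.1.1.1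
    j.1.1.2)`_j.2.
Let c (j : index) : R :=
  (S`_j.1.1.1)`_j.1.2 * cosn (j.1.1.1 + 3 * j.1.2) 0 *
  (((j.1.1.2 == 0 :> nat) && (j.2 == j.1.1.1 :> nat))%:R).
Let b (j : index) : nat := (j.1.2 + j.1.1.2).+1.
Let e (j : index) : {poly R} := 'X^(j.2).

Let measurable_erf_shift m y : measurable_fun setT (fun w => erf (tau m * (y - X w))).
Proof.
apply: (@measurable_shift_RV _ _ _ P X (fun z => erf (tau m * z))) => z.
apply: continuous_comp; first by apply: cvgMr; exact: cvg_id.
exact: is_derive1_continuous (is_derive_erf _).
Qed.

Let gvar_cvg0 : gvar (sg m) @[m --> \oo] --> 0.
Proof.
have h : 2^-1 * (@harmonic R m * @harmonic R m) @[m --> \oo] --> (2^-1 * (0 * 0) : R).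
  by apply: cvgMr; apply: cvgM; exact: cvg_harmonic.
move: h; rewrite mulr0 mulr0; under eq_cvg => m.
  have -> : 2^-1 * (@harmonic R m * @harmonic R m) = gvar (sg m).
    rewrite -[harmonic m]/((tau m)^-1) /gvar /sg; move: (tau0 m) => /lt0r_neq0.
    by move: (tau m) => t t0; field.
  over.
by [].
Qed.

Lemma size_adjoint_le l : (size (S`_l)%R <= A.+1)%N.
Proof.
rewrite coef_poly; case: ifP => _; last by rewrite size_poly0.
apply: (leq_trans (size_sum _ _ _)); apply/bigmax_leqP => t _.
rewrite -scaler_nat (leq_trans (size_scale_leq _ _))// size_Msign.
rewrite (leq_trans (size_derivn _ _))// (leq_trans (leq_subr _ _))//.
exact: size_adjoint_coef_le.
Qed.

Let relation m y : \sum_j c_ m j * ((e j).[y] * g m (b j) y) = 0.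
Proof.
have rel := gauss_relation (sg0 m) Q0 L1 LQ (erefl N) y size_adjoint_le.
transitivity (tau m / k0 m * 0); last by rewrite mulr0.
rewrite -[in RHS]rel.
have -> : \sum_(l < size L) \sum_(b' < size L) \sum_(a < A.+1) (S`_l)`_a *
     ((gpoly (gvar (sg m)) l b').[y] * smooth_kap X (sg m) (a + b') (l + b') y) =
   \sum_(l < N) \sum_(b' < N) \sum_(a < A.+1) \sum_(e' < N) (S`_l)`_a *
     ((gpoly (gvar (sg m)) l b')`_e' * y ^+ e' * smooth_kap X (sg m) (a + b') (l + b')
       y).
  apply: eq_bigr => l _; apply: eq_bigr => b' _; apply: eq_bigr => a _.
  rewrite (horner_coef_wide _ (leq_trans (size_gpoly _ l b') (ltn_ord l))).
  by rewrite mulr_suml mulr_sumr.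
rewrite pair_bigA/= pair_bigA/= pair_bigA/= mulr_sumr.
apply: eq_bigr => -[[[l b'] a] e'] _ /=.
rewrite /c_ /e /b /= hornerXn (@smooth_kapE _ _ _ P X (sg m) (a + b') (l + b') y (sg0
  m)).
(* The phase has period 4, so the constant from [smooth_kapE] depends on l and a only. *)
have -> : (l + b' + 3 * (a + b') = l + 3 * a + 4 * b')%N by lia.
by rewrite cosnD4; ring.
Qed.

Let g0_bound m y : `|g m 0 y| <= erf_lim R.
Proof.
have := @Rintegral_norm_le _ _ _ P (fun w => erf (tau m * (y - X w))) (fun=> erf_lim R).
rewrite Rintegral_cst// [X in fine X](probability_setT P) mulr1; apply.
- exact: measurable_erf_shift.
- exact: finite_measure_integrable_cst.
- by move=> w; exact: erf_bound.
Qed.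

Let g0_cvg y : g m 0%N y @[m --> \oo] --> erf_lim R * expect_sg X y.
Proof.
have mX : measurable_fun setT (X : Om -> measurableTypeR R) := measurable_funP X.
have ms : measurable_fun setT (fun w => Num.sg (y - X w)).
  exact: (measurableT_comp (measurable_sg_shift y) mX).
rewrite /expect_sg -RintegralZl//; last first.
  by apply: (@intR_bounded _ _ _ P _ 1) => // w; exact: sgr_le1.
have [||||| _ h] := @Rdominated _ _ R P setT measurableT
  (fun m w => erf (tau m * (y - X w))) (fun w =>
    erf_lim R * Num.sg (y - X w)) (fun=> erf_lim R); last exact: h.
- by move=> m; exact: measurable_erf_shift.
- exact: measurable_funM.
- by apply: aeW => w _; exact: cvg_erf_scale.
- by move=> m w _; exact: erf_bound.
- exact: finite_measure_integrable_cst.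
Qed.

(** In the limit b' = 0 and e' = l, so order A + 1 means a = A, and y^i receives the single index
    [j0]. Its coefficient is that of [coef_adjoint_top] times cosn (i + 3 A) 0, nonzero because A
    has the parity of D, hence of i. *)
Let top : \sum_(j | b j == A.+1) c j *: e j != 0.
Proof.
have N0 : (0 < N)%N by exact: leq_ltn_trans iL.
pose j0 : index := (Ordinal iL, Ordinal N0, ord_max, Ordinal iL).
have odd0 : ~~ odd (i + 3 * A).
  rewrite oddD oddM /= /A oddD -mulnA oddM /= addbF Di.
  by rewrite addbb.
apply/eqP => /(congr1 (fun r : {poly R} => r`_i)); apply/eqP; rewrite coef0 coef_sum.
rewrite (bigD1 j0)/=; last by rewrite /b /= addn0.
rewrite big1 ?addr0.
  rewrite coefZ coefXn /= eqxx mulr1 /c /= !eqxx mulr1 mulf_neq0 ?cosn0_neq0//.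
  exact: coef_adjoint_top.
move=> [[[l b'] a] e'] /andP[]; rewrite /b /c /e /= coefZ coefXn => ba jj.
case: eqP => [b0|_]; last by rewrite mulr0 mul0r.
case: eqP => [el|_]; last by rewrite mulr0 mul0r.
case: eqP => [ie|_]; last by rewrite mulr0.
case/negP: jj; apply/eqP; rewrite /j0; congr (_, _, _, _); apply/val_inj => //=.
- by rewrite ie el.
- by move: ba; rewrite b0 addn0 eqSS => /eqP.
Qed.

Lemma rational_system_expect_sg : rational_system (fun y => erf_lim R * expect_sg X y).
Proof.
apply: (@rational_system_limit R index (A.+1 + N)%N A.+1 b e c_ c g _ (erf_lim R)) =>
  //.
- by move=> j; have := ltn_ord j.1.2; have := ltn_ord j.1.1.2; rewrite /b; lia.
- by move=> j; apply: cvgMr; exact: cvg_gpoly.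
- by move=> y; apply: cvgMr; exact: (continuous_expect_sg pd).
(* Orders beyond A + 1 require b' > 0, as a <= A, and those coefficients vanish in the limit. *)
- move=> [[[l b'] a] e'] /=; rewrite /b /c/=; case: b' => [[|b'] b'N] /=;
  last by rewrite mulr0.
  by rewrite addn0 ltnS ltnNge -ltnS ltn_ord.
Qed.

End CharacteristicFunction.

Lemma holonomic_charfun_density {d : measure_display} {Om : measurableType d}
    {R : realType} (P : probability Om R) (X : {RV P >-> R}) :
  continuous_RV X -> holonomic_charfun X ->
  exists2 p : R -> R, is_density X p & rational_system p.
Proof.
move=> [p pd] /holonomic_charfun_rational_system[ru rv].
set u := fun t => fine ('E_P[fun w => cos (t * X w)])%E in ru.
set v := fun t => fine ('E_P[fun w => sin (t * X w)])%E in rv.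
(* One operator must serve both u and v, since only their combination [echar] turns into an
   expectation. *)
have [|L [Q [L1 Q0 LQ]]] := @common_annihilator R 2 (fun k =>
  if k == ord0 then u else v).
  by move=> k; case: (k == ord0).
have LQ' (b : bool) (x : R) : let f := if b then u else v in Q.[x] != 0 ->
    (forall t, is_derive x 1 (derive1n t f) (derive1n t.+1 f x)) /\
    \sum_(t < size L) (L`_t).[x] * derive1n t f x = 0.
  by case: b => f Qx; [exact: (LQ ord0 x Qx)|exact: (LQ ord_max x Qx)].
have main (M : diffop R) i D : (1 <= Defs.order M)%N ->
    (forall (b : bool) (x : R), let f := if b then u else v in Q.[x] != 0 ->
      (forall t, is_derive x 1 (derive1n t f) (derive1n t.+1 f x)) /\
      \sum_(t < size M) (M`_t).[x] * derive1n t f x = 0) ->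
    (forall t : nat, (size (M`_t)%R <= D.+1)%N) -> (i < size M)%N ->
    size (M`_i)%R = D.+1 -> odd D = odd i ->
    exists2 p : R -> R, is_density X p & rational_system p.
  move=> M1 MQ MD iM MiD Di.
  have rs := rational_system_expect_sg pd Q0 M1 MQ MD iM MiD Di.
  exact (density_of_expect_sg pd (erf_lim_gt0 R) rs).
have [D [LD [i iL LiD]]] := max_coef_size L1.
have [Di|Di] := eqVneq (odd D) (odd i).
  exact: main L1 LQ' LD iL LiD Di.
(* Multiplying L by x makes D of the parity of i, so that the leading term in
   cosn (i + 3 A) 0 survives. *)
pose M : diffop R := 'X *: (L : {poly {poly R}}).
have X0 : ('X : {poly R}) != 0 by rewrite polyX_eq0.
have sM : size M = size L by rewrite /M size_scale.
have Mt t : M`_t = 'X * L`_t by rewrite coefZ.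
apply: (main M i D.+1).
- by rewrite /Defs.order sM.
- move=> b x f Qx; have [df sf] := LQ' b x Qx; split=> //.
  transitivity (x * \sum_(t < size L) (L`_t).[x] * derive1n t f x);
    last by rewrite sf mulr0.
  rewrite sM mulr_sumr; apply: eq_bigr => t _.
  by rewrite Mt hornerM hornerX mulrA.
- move=> t; rewrite Mt (leq_trans (size_polyMleq _ _))// size_polyX add2n /= ltnS.
  exact: LD.
- by rewrite sM.
- have Li0 : L`_i != 0 by rewrite -size_poly_eq0 LiD.
  by rewrite Mt mulrC size_mulX// LiD.
- by move: Di; rewrite /=; case: (odd D); case: (odd i).
Qed.

Theorem theorem5p1 (R : realType) (d : measure_display) (Om : measurableType d)
    (P : probability Om R) (n : nat) (X : 'I_n -> {RV P >-> R})
    (hn : (1 <= n)%N)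
    (hX : forall i, continuous_RV (X i))
    (hol : (forall i, holonomic_charfun (X i)) \/
           (forall i, holonomic_density (X i))) :
  \bigcap_(i in [set: 'I_n]) PSO (X i) (@schwartz R) <> [set 0] /\
  ((forall i, all_moments (X i)) ->
    [/\ \bigcap_(i in [set: 'I_n]) PSO (X i) (@poly_funs R) <> [set 0],
        \bigcap_(i in [set: 'I_n]) PSO (X i) (@poly_growth R) <> [set 0] &
        \bigcap_(i in [set: 'I_n]) PSO_adapted (X i) <> [set 0]]).
Proof.
have ex i : exists p : R -> R, is_density (X i) p /\ rational_system p.
  case: hol => [hc|hd].
    by have [p pd rp] := holonomic_charfun_density (hX i) (hc i); exists p.
  have [p [pd hp]] := hd i; exists p; split => //.
  exact: holonomic_rational_system.
have [p pP] := choice ex.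
exact (common_stein_operator (fun i => (pP i).1) (fun i => (pP i).2)).
Qed.
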